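(* Let $T>0$, let $(U,d_U)$ be a compact metric space, and let $f:\mathbb{R}^d\times U\to\mathbb{R}^d$ satisfy: (i) $f$ is continuous and there exists $m>0$ such that $|f(x,u)|\le m(1+|x|)$ for all $(x,u)\in\mathbb{R}^d\times U$; (ii) for each compact set $K\subset\mathbb{R}^d$ there exists $\ell_K>0$ such that $|f(x,u)-f(y,u)|\le \ell_K|x-y|$ for all $x,y\in K$ and $u\in U$. Assume in addition that $f_u=f(\cdot,u)\in C^1(\mathbb{R}^d,\mathbb{R}^d)$ for each $u\in U$, and fix $\varphi\in\mathcal{D}$. Let $\mathcal{K}_{(\tau,t)}$ and $\mathcal{L}$ be the associated set-valued Koopman and Liouville operators. Then a family of Koopman observables $(\tau,t)\in[0,T]\times[0,T]\mapsto\psi_{(\tau,t)}\in\mathcal{K}_{(\tau,t)}(\varphi)$ is of the form $\psi_{(\tau,t)}=\varphi\circ\Phi^u_{(\tau,t)}$ for some fixed control signal $u(\cdot)\in\mathcal{U}$ if and only if it is a strong solution of the differential inclusion $$\begin{cases}\partial_\tau\psi_{(\tau,t)}\in-\mathcal{L}(\psi_{(\tau,t)}),\\ \psi_{(t,t)}=\varphi,\end{cases}$$ in the space of observables $(\mathcal{D},\|\cdot\|_{\mathcal{D}})$.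
   Context: $\mathcal{X}:=C^0_c(\mathbb{R}^d,\mathbb{C})$ with the supremum norm and $\mathcal{D}:=C^1_c(\mathbb{R}^d,\mathbb{C})$ with the $C^1$-norm $\|\cdot\|_{\mathcal{D}}$. $\mathcal{U}$ is the set of Lebesgue-measurable maps $u:[0,T]\to U$. For $u(\cdot)\in\mathcal{U}$, the controlled flow $(\Phi^u_{(\tau,t)})_{\tau,t\in[0,T]}\subset C^0(\mathbb{R}^d,\mathbb{R}^d)$ is the unique solution of $\Phi^u_{(\tau,t)}(x)=x+\int_\tau^t f(\Phi^u_{(\tau,s)}(x),u(s))\,ds$ for all $\tau,t\in[0,T]$, $x\in\mathbb{R}^d$. The set-valued Koopman operators are $\mathcal{K}_{(\tau,t)}(\varphi):=\{\varphi\circ\Phi^u_{(\tau,t)}~:~u(\cdot)\in\mathcal{U}\}\subset\mathcal{X}$, and the set-valued Liouville operator is $\mathcal{L}(\varphi):=\{\nabla_x\varphi\cdot f_u~:~u\in U\}\subset\mathcal{X}$ for $\varphi\in\mathcal{D}$. Strong solution: $t\in[0,T]$ is a parameter and $\tau\in[0,T]$ is the evolution variable; the observables $\psi_{(\tau,t)}$ belong to $\mathcal{D}$, the map $\tau\mapsto\psi_{(\tau,t)}$ is absolutely continuous with values in $\mathcal{X}$, the difference quotients $\frac{1}{h}(\psi_{(\tau+h,t)}-\psi_{(\tau,t)})$ converge strongly in $\mathcal{X}$ as $h\to0$ to an element $\partial_\tau\psi_{(\tau,t)}$ for almost every $\tau\in[0,T]$ and all $t\in[0,T]$, the inclusion holds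 for almost every $\tau$, and $\psi_{(t,t)}=\varphi$.
   Formalization: In the ''if'' direction the control u may depend on the parameter t; a single u for all t is impossible in general (f(x,u)=u, U=[0,1], T=1, ψ_(τ,t)(x)=φ(x+(t−τ)t)). The ''only if'' direction is also stated for one u serving all t. *)

(* Defs.v *)
From HB Require Import structures.
From mathcomp Require Import all_boot all_order all_algebra.
From mathcomp Require Import all_classical all_reals all_analysis.
From mathcomp.real_closed Require Import complex.

Set Implicit Arguments.
Unset Strict Implicit.
Unset Printing Implicit Defensive.

Import Order.TTheory GRing.Theory Num.Theory.
Import numFieldNormedType.Exports.

Local Open Scope classical_set_scope.
Local Open Scope ring_scope.

(* The library norm on 'rV is the maximum norm; the Euclidean norm is [enorm]. *)
Definition enorm (R : realType) (d : nat) (x : 'rV[R]_d) : R :=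
  Num.sqrt (\sum_(i < d) x 0 i ^+ 2).

(* Continuity of the differential is stated pointwise in the direction [v],
   which in finite dimension is continuity in operator norm. *)
Definition C1 (R : realType) (V W : normedModType R) (g : V -> W) : Prop :=
  (forall x, differentiable g x) /\ forall v, continuous (fun x => 'd g x v).

(* R[i] carries no topology over the real field R, so the regularity of a
   complex-valued function is that of its real and imaginary parts. *)
Definition observable (R : realType) (d : nat) : Type := 'rV[R]_d -> R[i].

Definition obs_re (R : realType) d (g : observable R d) : 'rV[R]_d -> R :=
  fun x => complex.Re (g x).

Definition obs_im (R : realType) d (g : observable R d) : 'rV[R]_d -> R :=
  fun x => complex.Im (g x).

Definition compactly_supported (R : realType) d (g : observable R d) : Prop :=
  compact (closure [set x | g x != 0]).

Definition C0c (R : realType) d : set (observable R d) :=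
  [set g | [/\ continuous (obs_re g), continuous (obs_im g)
             & compactly_supported g]].

Definition C1c (R : realType) d : set (observable R d) :=
  [set g | [/\ C1 (obs_re g), C1 (obs_im g) & compactly_supported g]].

(* [sup] is 0 on unbounded sets; it is only applied below to ranges of
   moduli of functions in C0c, which are bounded. *)
Definition supnorm (R : realType) d (g : observable R d) : R :=
  sup (range (fun x => Normc.normc (g x))).

Definition partial (R : realType) d (i : 'I_d) (g : observable R d) :
    observable R d :=
  fun x => Complex ('D_(delta_mx 0 i) (obs_re g) x)
                   ('D_(delta_mx 0 i) (obs_im g) x).

(* Lebesgue measurability refers to the completed Lebesgue sigma-algebra. *)
Definition Lebesgue_measurable (R : realType) (A : set R) : Prop :=
  measurable (A : set (caratheodory_type (wlength (@idfun R))^*%mu)).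

Definition control (R : realType) (U : metricType R) (T : R) : set (R -> U) :=
  [set u | forall O : set U, open O ->
     Lebesgue_measurable (`[0, T] `&` u @^-1` O)].

Definition oriented_integral (R : realType) (a b : R) (F : R -> R) : R :=
  if a <= b then \int[@completed_lebesgue_measure R]_(s in `[a, b]) F s
  else - \int[@completed_lebesgue_measure R]_(s in `[b, a]) F s.

(* Integrability has to be required explicitly: the integral is a total
   operator. The values of [Phi] outside [0,T] x [0,T] are irrelevant. *)
Definition is_flow (R : realType) (d : nat) (U : metricType R) (T : R)
    (f : 'rV[R]_d * U -> 'rV[R]_d) (u : R -> U)
    (Phi : R -> R -> 'rV[R]_d -> 'rV[R]_d) : Prop :=
  forall tau t, tau \in `[0, T] -> t \in `[0, T] ->
    continuous (Phi tau t) /\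
    forall (x : 'rV[R]_d) (i : 'I_d),
      (@completed_lebesgue_measure R).-integrable `[0, T]
        (fun s => (f (Phi tau s x, u s) 0 i)%:E) /\
      Phi tau t x 0 i =
        x 0 i + oriented_integral tau t (fun s => f (Phi tau s x, u s) 0 i).

Definition koopman (R : realType) (d : nat) (U : metricType R) (T : R)
    (f : 'rV[R]_d * U -> 'rV[R]_d) (tau t : R) (phi : observable R d) :
    set (observable R d) :=
  [set g | exists u Phi,
     [/\ control T u, is_flow T f u Phi & g = phi \o Phi tau t]].

Definition liouville (R : realType) (d : nat) (U : metricType R)
    (f : 'rV[R]_d * U -> 'rV[R]_d) (phi : observable R d) :
    set (observable R d) :=
  [set g | exists u : U,
     g = fun x => \sum_(i < d) partial i phi x * Complex (f (x, u) 0 i) 0].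

Definition abs_continuous (R : realType) d (T : R)
    (psi : R -> observable R d) : Prop :=
  forall e : R, 0 < e -> exists2 delta : R, 0 < delta &
    forall (n : nat) (a b : 'I_n -> R),
      (forall i, [/\ 0 <= a i, a i <= b i & b i <= T]) ->
      trivIset [set: 'I_n] (fun i => `]a i, b i[%classic) ->
      \sum_(i < n) (b i - a i) < delta ->
      \sum_(i < n) supnorm (psi (b i) - psi (a i)) < e.

(* Strong convergence of the difference quotients of [psi] at [tau]. *)
Definition strong_derivative (R : realType) d (psi : R -> observable R d)
    (tau : R) (dpsi : observable R d) : Prop :=
  supnorm (fun x => Complex h^-1 0 * (psi (tau + h) x - psi tau x) - dpsi x)
    @[h --> 0^'] --> (0 : R).

(* [J] is the set of values of the parameter [t] under consideration; the
   exceptional null set of [tau] does not depend on [t] in [J]. *)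
Definition strong_solution (R : realType) (d : nat) (U : metricType R) (T : R)
    (f : 'rV[R]_d * U -> 'rV[R]_d) (phi : observable R d) (J : set R)
    (psi : R -> R -> observable R d) : Prop :=
  [/\ forall tau t, tau \in `[0, T] -> J t -> C1c (psi tau t),
      forall t, J t -> abs_continuous T (psi^~ t),
      {ae @completed_lebesgue_measure R, forall tau, tau \in `[0, T] ->
         forall t, J t -> exists dpsi,
           [/\ C0c dpsi,
               strong_derivative (psi^~ t) tau dpsi
             & [set - g | g in liouville f (psi tau t)] dpsi]}
    & forall t, J t -> psi t t = phi].

(* [psi tau t = phi o Phi^u_(tau,t)] for all [tau] in [0,T] and [t] in [J],
   with the same control [u]. *)
Definition generated_by (R : realType) (d : nat) (U : metricType R) (T : R)
    (f : 'rV[R]_d * U -> 'rV[R]_d) (phi : observable R d) (J : set R)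
    (u : R -> U) (psi : R -> R -> observable R d) : Prop :=
  exists2 Phi, is_flow T f u Phi &
    forall tau t, tau \in `[0, T] -> J t -> psi tau t = phi \o Phi tau t.

(* Main.v *)
(* Forward direction. For a fixed control u, the maps h |-> h^-1 (Phi_(tau+h,tau) - id)
   converge to - f_(u(tau)) uniformly on compact sets for almost every tau: this is
   Lebesgue differentiation of s |-> f(x, u(s)) for rational x, extended to every x by
   the local Lipschitz bound, so that the null set does not depend on x. Since
   psi_(tau+h,t) = psi_(tau,t) o Phi_(tau+h,tau), and psi_(tau,t) is C^1 with compact
   support because the flow is C^1 (variational equation), the difference quotients of
   psi converge in the supremum norm to - grad psi_(tau,t) . f_(u(tau)).

   Converse. A measurable selection u(tau) among the control values realising the
   inclusion turns it into a transport equation. Along a trajectory gamma of Phi^u the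
   function tau |-> psi_(tau,t)(gamma(tau)) is absolutely continuous, because Koopman
   observables are Lipschitz on bounded sets uniformly in the control, and its
   derivative vanishes almost everywhere; hence it is constant, equal to
   phi(gamma(t)). *)

Require Import Defs.
From HB Require Import structures.
From mathcomp Require Import all_boot all_order all_algebra.
From mathcomp Require Import all_classical all_reals all_analysis.
From mathcomp.real_closed Require Import complex.
From mathcomp Require Import measurable_realfun ring lra.

Set Implicit Arguments.
Unset Strict Implicit.
Unset Printing Implicit Defensive.

Import Order.TTheory GRing.Theory Num.Theory.
Import numFieldNormedType.Exports.

Local Open Scope classical_set_scope.
Local Open Scope ring_scope.

(** * Integration against completed Lebesgue measure *)

(** The control behind a Koopman observable may change with tau, so in the converse no estimate may
    see it: the constants for Koopman observables depend only on phi, f, T and a radius.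
    Trajectories are started at time t, so that a single one passes through all times tau and its
    value at t gives phi. Along it the observable and the point move together; convergence of the
    quotients in the supremum norm is what permits evaluation at a moving point.

    The differential of f in x is not assumed continuous in the control. Its bounds come from
    Lipschitz constants uniform in the control, and its measurability in time from difference
    quotients.

    The selected control has to satisfy the transport equation for all x at once; by continuity in x
    this amounts to countably many scalar equations, measurable in tau and continuous in the control
    value.

    Controls are measurable for the completed sigma-algebra, whereas the differentiation theorem is
    applied to Borel functions; an almost everywhere equal Borel function bridges the two. *)

Notation lam R := (@completed_lebesgue_measure R).
Notation LT R := (caratheodory_type (wlength (@idfun R))^*%mu).

Section Integral.
Context {R : realType}.
Implicit Types (F G : R -> R) (D : set R) (a b c s t : R).

Lemma lam_measurable_itv (i : interval R) : measurable ([set` i] : set (LT R)).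
Proof. by apply: sub_caratheodory; exact: measurable_itv. Qed.

Lemma lam_itvcc a b : a <= b -> lam R `[a, b]%classic = (b - a)%:E.
Proof.
move=> ab; rewrite -[LHS]/(lebesgue_measure `[a, b]%classic).
rewrite lebesgue_measure_itv /= lte_fin; case: ltP => // ba.
by rewrite (@le_anti _ _ a b) ?ab// subrr.
Qed.

Lemma lam_itvcc_lty a b : (lam R `[a, b]%classic < +oo)%E.
Proof.
have [ab|ba] := leP a b; first by rewrite [X in (X < _)%E](lam_itvcc ab) ltry.
have -> : `[a, b]%classic = set0 :> set (LT R).
  by apply: set_itv_ge; rewrite bnd_simp -ltNge.
by rewrite measure0.
Qed.

Lemma borel_lam_measurable D F :
  measurable_fun setT F -> measurable_fun (D : set (LT R)) F.
Proof.
move=> mF mD Y mY; apply: measurableI => //; apply: sub_caratheodory.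
by have := mF measurableT Y mY; rewrite setTI.
Qed.

(** The class of integrands used throughout: stable under the operations below and integrable on
    every subinterval of [[0, T]]. Values outside [[0, T]] are left free. *)
Definition bmeas (T : R) F := measurable_fun (`[0, T]%classic : set (LT R)) F /\
  exists M, forall s, s \in `[0, T] -> `|F s| <= M.

Context {T : R}.

Lemma sub_itv0T a b : a \in `[0, T] -> b \in `[0, T] ->
  `[a, b]%classic `<=` `[0, T]%classic.
Proof.
rewrite !in_itv /= => /andP[a0 _] /andP[_ bT] x /=.
by rewrite !in_itv /= => /andP[ax xb]; rewrite (le_trans a0 ax) (le_trans xb bT).
Qed.

Lemma bmeas_integrable F a b : bmeas T F -> a \in `[0, T] -> b \in `[0, T] ->
  (lam R).-integrable `[a, b]%classic (EFin \o F).
Proof.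
move=> [mF [M FM]] aT bT; have sab := sub_itv0T aT bT.
apply: measurable_bounded_integrable.
- exact: lam_measurable_itv.
- exact: lam_itvcc_lty.
- by apply: measurable_funS mF => //; exact: lam_measurable_itv.
- exists M; split; first exact: num_real.
  move=> M' MM' x xab /=; apply: le_trans (ltW MM'); apply: FM.
  exact: sab.
Qed.

Lemma integrable_bmeas_cst M : bmeas T (fun=> M).
Proof. by split; [exact: measurable_cst|exists `|M|]. Qed.

Lemma bmeasN F : bmeas T F -> bmeas T (fun s => - F s).
Proof.
move=> [mF [M FM]]; split; first exact: measurableT_comp.
by exists M => s sT; rewrite normrN; exact: FM.
Qed.

Lemma bmeasD F G : bmeas T F -> bmeas T G -> bmeas T (fun s => F s + G s).
Proof.
move=> [mF [M FM]] [mG [N GN]]; split; first exact: measurable_funD.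
by exists (M + N) => s sT; rewrite (le_trans (ler_normD _ _))// lerD// ?FM ?GN.
Qed.

Lemma bmeasB F G : bmeas T F -> bmeas T G -> bmeas T (fun s => F s - G s).
Proof. by move=> bF bG; apply: bmeasD bF (bmeasN bG). Qed.

Lemma bmeasZ k F : bmeas T F -> bmeas T (fun s => k * F s).
Proof.
move=> [mF [M FM]]; split.
  by apply: measurable_funM => //; exact: measurable_cst.
by exists (`|k| * M) => s sT; rewrite normrM ler_wpM2l// FM.
Qed.

Lemma bmeas_norm F : bmeas T F -> bmeas T (fun s => `|F s|).
Proof.
move=> [mF [M FM]]; split; first exact: measurableT_comp.
by exists M => s sT; rewrite normr_id; exact: FM.
Qed.

Lemma eq_bmeas F G : {in `[0, T], F =1 G} -> bmeas T F -> bmeas T G.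
Proof.
move=> FG [mF [M FM]]; split.
  by apply: eq_measurable_fun mF => s; rewrite inE; exact: FG.
by exists M => s sT; rewrite -FG ?FM.
Qed.

Lemma bmeas_continuous F : continuous F -> bmeas T F.
Proof.
move=> cF; split.
  by apply: borel_lam_measurable; exact: continuous_measurable_fun.
have : compact (F @` `[0, T]%classic).
  apply: continuous_compact; last exact: segment_compact.
  exact: continuous_subspaceT.
move=> /compact_bounded[M [_ MF]]; exists (M + 1) => s sT.
by apply: (MF (M + 1)); [rewrite ltrDl|exists s].
Qed.

Lemma Rint_le_bound F a b M : bmeas T F -> a \in `[0, T] -> b \in `[0, T] ->
  a <= b -> (forall s, s \in `[a, b] -> `|F s| <= M) ->
  `|\int[lam R]_(s in `[a, b]) F s| <= M * (b - a).
Proof.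
move=> bF aT bT ab FM.
have mab := lam_measurable_itv `[a, b].
apply: (le_trans (le_normr_Rintegral mab (bmeas_integrable bF aT bT))).
have -> : M * (b - a) = \int[lam R]_(s in `[a, b]) M.
  by rewrite (Rintegral_cst _ mab) [X in fine X](lam_itvcc ab).
apply: le_Rintegral => //.
- exact: (bmeas_integrable (bmeas_norm bF)).
- exact: (bmeas_integrable (integrable_bmeas_cst M)).
Qed.

Lemma Rint_chasles F a b c : bmeas T F ->
  a \in `[0, T] -> c \in `[0, T] -> a <= b -> b <= c ->
  \int[lam R]_(s in `[a, c]) F s =
  \int[lam R]_(s in `[a, b]) F s + \int[lam R]_(s in `[b, c]) F s.
Proof.
move=> bF aT cT ab bc.
have bT : b \in `[0, T].
  move: aT cT; rewrite !in_itv /= => /andP[a0 _] /andP[_ cT].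
  by rewrite (le_trans a0 ab) (le_trans bc cT).
have U1 : `[a, c]%classic = `[a, b]%classic `|` `]b, c]%classic.
  by apply: itv_bndbnd_setU; rewrite bnd_simp.
have U2 : `[b, c]%classic = `[b, b]%classic `|` `]b, c]%classic.
  by apply: itv_bndbnd_setU; rewrite bnd_simp.
have dj e : [disjoint `[e, b]%classic & `]b, c]%classic].
  apply/disj_setPS => x [] /=; rewrite !in_itv /= => /andP[_ xb] /andP[bx _].
  by move: (lt_le_trans bx xb); rewrite ltxx.
have mI := lam_measurable_itv.
have i1 := bmeas_integrable bF aT cT; have i2 := bmeas_integrable bF bT cT.
have -> : \int[lam R]_(s in `[a, c]) F s =
  \int[lam R]_(s in `[a, b]) F s + \int[lam R]_(s in `]b, c]) F s.
  by rewrite U1 Rintegral_setU//; rewrite -U1.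
have -> : \int[lam R]_(s in `[b, c]) F s =
  \int[lam R]_(s in `[b, b]) F s + \int[lam R]_(s in `]b, c]) F s.
  by rewrite U2 Rintegral_setU//; rewrite -U2.
suff -> : \int[lam R]_(x in `[b, b]) F x = 0 by rewrite add0r.
have [_ [M FM]] := bF.
apply/eqP; rewrite -normr_le0.
have /= := @Rint_le_bound F b b M bF bT bT (lexx _).
rewrite subrr mulr0; apply => s sb; apply: FM.
exact: (sub_itv0T bT bT).
Qed.

Definition prim F s := \int[lam R]_(r in `[0, s]) F r.

(** As a difference of values of one primitive, the oriented integral obeys the additivity and sign
    rules without case distinctions on the order of its bounds. *)
Lemma ori_prim F a b : bmeas T F -> a \in `[0, T] -> b \in `[0, T] ->
  oriented_integral a b F = prim F b - prim F a.
Proof.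
move=> bF aT bT; have T0 : 0 \in `[0, T].
  by move: aT; rewrite !in_itv /= lexx => /andP[]; exact: le_trans.
have a0 : 0 <= a by move: aT; rewrite in_itv /= => /andP[].
have b0 : 0 <= b by move: bT; rewrite in_itv /= => /andP[].
rewrite /oriented_integral /prim; case: (leP a b) => ab.
  by rewrite (@Rint_chasles F 0 a b)// addrC addrA addNr add0r.
by rewrite (@Rint_chasles F 0 b a) ?(ltW ab)// opprD addrA subrr add0r.
Qed.

Lemma ori_chasles F a b c : bmeas T F ->
  a \in `[0, T] -> b \in `[0, T] -> c \in `[0, T] ->
  oriented_integral a c F = oriented_integral a b F + oriented_integral b c F.
Proof.
move=> bF aT bT cT; rewrite !ori_prim//.
by rewrite [RHS]addrC addrA subrK.
Qed.

Lemma ori_self F a : bmeas T F -> a \in `[0, T] -> oriented_integral a a F = 0.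
Proof. by move=> bF aT; rewrite ori_prim// subrr. Qed.

Lemma ori_swap F a b : bmeas T F -> a \in `[0, T] -> b \in `[0, T] ->
  oriented_integral a b F = - oriented_integral b a F.
Proof. by move=> bF aT bT; rewrite !ori_prim// opprB. Qed.

Lemma eq_ori F G a b : a \in `[0, T] -> b \in `[0, T] ->
  {in `[0, T], F =1 G} -> oriented_integral a b F = oriented_integral a b G.
Proof.
move=> aT bT FG; rewrite /oriented_integral; case: (leP a b) => _.
  by apply: eq_Rintegral => s; rewrite inE => /(sub_itv0T aT bT); exact: FG.
congr (- _).
by apply: eq_Rintegral => s; rewrite inE => /(sub_itv0T bT aT); exact: FG.
Qed.

Lemma oriB F G a b : bmeas T F -> bmeas T G ->
  a \in `[0, T] -> b \in `[0, T] ->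
  oriented_integral a b (fun s => F s - G s) =
  oriented_integral a b F - oriented_integral a b G.
Proof.
move=> bF bG aT bT; have mI := lam_measurable_itv.
rewrite /oriented_integral; case: (leP a b) => ab.
  by rewrite RintegralB//; exact: bmeas_integrable.
rewrite RintegralB//; first by rewrite opprB opprK addrC.
- exact: bmeas_integrable.
- exact: bmeas_integrable.
Qed.

Lemma oriZ F k a b : bmeas T F -> a \in `[0, T] -> b \in `[0, T] ->
  oriented_integral a b (fun s => k * F s) = k * oriented_integral a b F.
Proof.
move=> bF aT bT; have mI := lam_measurable_itv.
rewrite /oriented_integral; case: (leP a b) => ab.
  by rewrite RintegralZl//; exact: bmeas_integrable.
by rewrite RintegralZl ?mulrN//; exact: bmeas_integrable.
Qed.

Lemma oriN F a b : bmeas T F -> a \in `[0, T] -> b \in `[0, T] ->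
  oriented_integral a b (fun s => - F s) = - oriented_integral a b F.
Proof.
move=> bF aT bT; rewrite -mulN1r -oriZ//.
by apply: eq_ori => // s _; rewrite mulN1r.
Qed.

Lemma oriD F G a b : bmeas T F -> bmeas T G ->
  a \in `[0, T] -> b \in `[0, T] ->
  oriented_integral a b (fun s => F s + G s) =
  oriented_integral a b F + oriented_integral a b G.
Proof.
move=> bF bG aT bT; have := oriB bF (bmeasN bG) aT bT.
rewrite (oriN bG aT bT) opprK => <-.
by apply: eq_ori => // s _; rewrite opprK.
Qed.

Lemma ori_cst k a b : oriented_integral a b (fun=> k) = k * (b - a).
Proof.
have mI := lam_measurable_itv.
rewrite /oriented_integral; case: (leP a b) => ab.
  by rewrite (Rintegral_cst _ (mI _)) [X in fine X](lam_itvcc ab).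
by rewrite (Rintegral_cst _ (mI _)) [X in fine X](lam_itvcc (ltW ab)) -mulrN opprB.
Qed.

(** Both integrals stand inside absolute values because the bounds may come in either order. *)
Lemma ori_le F G a b : bmeas T F -> bmeas T G ->
  a \in `[0, T] -> b \in `[0, T] ->
  {in `[0, T], forall s, `|F s| <= G s} ->
  `|oriented_integral a b F| <= `|oriented_integral a b G|.
Proof.
move=> bF bG.
suff H a' b' : a' \in `[0, T] -> b' \in `[0, T] ->
  {in `[0, T], forall s, `|F s| <= G s} ->
  `|\int[lam R]_(s in `[a', b']) F s| <= `|\int[lam R]_(s in `[a', b']) G s|.
  move=> aT bT FG; rewrite /oriented_integral.
  case: (leP a b) => ab; first by apply: (H a b).
  by rewrite normrN [leRHS]normrN; apply: (H b a).
move=> {}aT {}bT FG; have mI := lam_measurable_itv.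
apply: (le_trans (le_normr_Rintegral (mI _) (bmeas_integrable bF aT bT))).
apply: le_trans (ler_norm _).
apply: le_Rintegral => //.
- exact: (bmeas_integrable (bmeas_norm bF)).
- exact: (bmeas_integrable bG).
- by move=> s /(sub_itv0T aT bT); exact: FG.
Qed.

Lemma ori_dct (F_ : nat -> R -> R) F M a b : (forall n, bmeas T (F_ n)) ->
  a \in `[0, T] -> b \in `[0, T] ->
  (forall n, {in `[0, T], forall s, `|F_ n s| <= M}) ->
  {in `[0, T], forall s, F_ n s @[n --> \oo] --> F s} ->
  oriented_integral a b (F_ n) @[n --> \oo] --> oriented_integral a b F.
Proof.
move=> bF aT bT FM FF.
suff H a' b' : a' \in `[0, T] -> b' \in `[0, T] ->
   \int[lam R]_(s in `[a', b']) F_ n s @[n --> \oo] -->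
   \int[lam R]_(s in `[a', b']) F s.
  rewrite /oriented_integral; case: (leP a b) => ab; first exact: H.
  by apply: cvgN; exact: H.
move=> {}aT {}bT; have mI := lam_measurable_itv.
have H : (\int[lam R]_(s in `[a', b']) (F_ n s)%:E)%E @[n --> \oo] -->
   (\int[lam R]_(s in `[a', b']) (F s)%:E)%E.
  apply: (@dominated_cvg _ _ _ _ _ (mI _) _ _ (fun=> M%:E)).
  - by move=> n; have /integrableP[] := bmeas_integrable (bF n) aT bT.
  - move=> s /(sub_itv0T aT bT) sT; apply: cvg_EFin; last exact: FF.
    by apply: nearW.
  - by [].
  - exact: (bmeas_integrable (integrable_bmeas_cst M)).
  - by move=> n s /(sub_itv0T aT bT) sT /=; rewrite lee_fin FM.
apply: fine_cvg; rewrite fineK//.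
(* Passing to [fine] requires a finite limit: [F] inherits measurability and the bound [M] as a
   pointwise limit. *)
have mF : measurable_fun (`[a', b']%classic : set (LT R)) F.
  apply: (@measurable_fun_cvg _ (LT R) R `[a', b']%classic F_ F).
    move=> n; have [mFn _] := bF n.
    by apply: measurable_funS mFn; [exact: mI|exact: sub_itv0T].
  by move=> s /(sub_itv0T aT bT); exact: FF.
apply: integrable_fin_num; first exact: mI.
apply: measurable_bounded_integrable => //.
- exact: lam_itvcc_lty.
- exists M; split; first exact: num_real.
  move=> M' MM' x /(sub_itv0T aT bT) xab /=; apply: le_trans (ltW MM').
  have := FF _ xab => /cvg_norm cF.
  rewrite -(cvg_lim _ cF)//; apply: limr_le; first by apply/cvg_ex; eexists; exact: cF.
  by apply: nearW => n; exact: FM.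
Qed.

End Integral.

(** * Gronwall's inequality *)

Lemma cvg_div_exp2 (R : realType) (k : R) : k / 2 ^+ n @[n --> \oo] --> 0.
Proof.
rewrite -(mulr0 k); apply: cvgMr.
rewrite (_ : (fun x => (2 ^+ x)^-1) = (fun n => (2^-1) ^+ n)).
  by apply: cvg_expr; rewrite ger0_norm// invf_lt1// ltr1n.
by apply/funext => n; rewrite exprVn.
Qed.

Section Integral2.
Context {R : realType}.
Implicit Types (F G : R -> R) (D : set R) (a b c s t : R).

(** The identity, from the completed to the Borel sigma-algebra, is measurable and pushes [lam]
    forward to [lebesgue_measure]. This opens the way to the fundamental theorem of calculus. *)
Lemma Rint_lam_borel (D : set R) F : measurable D -> measurable_fun setT F ->
  (lam R).-integrable (D : set (LT R)) (EFin \o F) ->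
  \int[lam R]_(s in D) F s = \int[lebesgue_measure]_(s in D) F s.
Proof.
move=> mD mF iF; rewrite /Rintegral; congr fine; apply/esym.
pose phi : LT R -> measurableTypeR R := idfun.
have mphi : measurable_fun setT phi.
  by move=> _ Y mY; rewrite setTI; apply: sub_caratheodory.
have := @integral_pushforward _ _ (LT R) (measurableTypeR R) R phi mphi (lam R)
  D (EFin \o F); apply => //.
by apply/measurable_EFinP.
Qed.

Lemma Rint_expR (c p a b : R) : c != 0 -> a < b ->
  \int[lebesgue_measure]_(r in `[a, b]) expR (c * (r - p)) =
  (expR (c * (b - p)) - expR (c * (a - p))) / c.
Proof.
move=> c0 ab; pose F r := expR (c * (r - p)) / c.
have dF (r : R) : is_derive r (1 : R) F (expR (c * (r - p))).
  apply: is_derive_eq.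
  rewrite /GRing.scale /=; by field.
have cf : continuous (fun r => expR (c * (r - p))).
  move=> r; apply: (@continuous_comp _ _ _ (fun r => c * (r - p)) expR);
    last exact: continuous_expR.
  by apply: continuousM; [exact: cst_continuous|apply: continuousB => //; exact: cst_continuous].
have cF r : {for r, continuous F}.
  by apply: differentiable_continuous; apply/derivable1_diffP; case: (dF r).
rewrite /Rintegral (@continuous_FTC2 _ _ F)//.
- by rewrite /F /= mulrBl.
- exact: continuous_subspaceT.
- split.
  + by move=> x _; case: (dF x).
  + by apply: cvg_at_right_filter; exact: cF.
  + by apply: cvg_at_left_filter; exact: cF.
- by move=> x _; rewrite derive1E; apply: derive_val.
Qed.

Context {T : R}.

Lemma bmeas_expR (k p : R) : bmeas T (fun r => expR (k * `|r - p|)).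
Proof.
apply: bmeas_continuous => r; apply: continuous_comp; last exact: continuous_expR.
apply: continuousM; first exact: cst_continuous.
apply: (@continuous_comp _ _ _ (fun r => r - p) Num.norm); last exact: norm_continuous.
by apply: continuousB => //; exact: cst_continuous.
Qed.

(** Integrating the weight gains a factor 1/k on either side of [a]. With k = 2 L this is the
    contraction by 1/2 used for Gronwall and for Picard (a Bielecki norm). *)
Lemma ori_exp (k a b : R) : 0 < k -> a \in `[0, T] -> b \in `[0, T] ->
  `|oriented_integral a b (fun r => expR (k * `|r - a|))| <=
  expR (k * `|b - a|) / k.
Proof.
move=> k0 aT bT.
have E c p x y : c != 0 -> x \in `[0, T] -> y \in `[0, T] -> x < y ->
  \int[lam R]_(r in `[x, y]) expR (c * (r - p)) =
  (expR (c * (y - p)) - expR (c * (x - p))) / c.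
  move=> c0 xT yT xy.
  have ce : continuous (fun r => expR (c * (r - p))).
    move=> r; apply: continuous_comp; last exact: continuous_expR.
    by apply: continuousM; [exact: cst_continuous|apply: continuousB => //; exact: cst_continuous].
  rewrite Rint_lam_borel ?Rint_expR//; first exact: continuous_measurable_fun.
  exact: (bmeas_integrable (bmeas_continuous ce) xT yT).
have [->|ab] := eqVneq a b.
  by rewrite (ori_self (bmeas_expR k b) bT) normr0 divr_ge0 ?expR_ge0 ?(ltW k0).
rewrite /oriented_integral; case: (leP a b) => [|ba]; last first.
  rewrite (@eq_Rintegral _ (LT R) _ _ _ (fun r : R => expR ((- k) * (r - a)))); last first.
    move=> r; rewrite inE /= in_itv /= => /andP[_ ra].
    by rewrite ler0_norm ?subr_le0// mulrN mulNr.
  rewrite E ?oppr_eq0 ?gt_eqF// subrr mulr0 expR0 (@ltr0_norm _ (b - a)) ?subr_lt0//.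
  rewrite mulrN -mulNr; set X := expR _.
  have X1 : 1 <= X.
    by rewrite -expR0 ler_expR mulNr -mulrN mulr_ge0 ?(ltW k0)// oppr_ge0 subr_le0 ltW.
  have -> : - ((1 - X) / - k) = - ((X - 1) / k) by field; rewrite gt_eqF.
  rewrite normrN ger0_norm ?divr_ge0 ?(ltW k0) ?subr_ge0//.
  by rewrite ler_pM2r ?invr_gt0// gerBl.
rewrite le_eqVlt (negbTE ab) /= => {}ab.
rewrite (@eq_Rintegral _ (LT R) _ _ _ (fun r : R => expR (k * (r - a)))); last first.
  move=> r; rewrite inE /= in_itv /= => /andP[ar _].
  by rewrite ger0_norm ?subr_ge0.
rewrite E ?gt_eqF// subrr mulr0 expR0 (@gtr0_norm _ (b - a)) ?subr_gt0//.
rewrite ger0_norm; first by rewrite ler_pM2r ?invr_gt0// gerBl.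
rewrite divr_ge0 ?(ltW k0)// subr_ge0 -expR0 ler_expR mulr_ge0 ?(ltW k0)//.
by rewrite subr_ge0 ltW.
Qed.

(** A bound [u <= K e] in the exponential weight [e] improves to [(C + K / 2) e]. Iterating from any
    bound of [u] leads to the fixed point K = 2 C, which explains both factors 2. *)
Lemma gronwall (u : R -> R) (C L tau : R) : 0 <= C -> 0 < L -> tau \in `[0, T] ->
  bmeas T u ->
  {in `[0, T], forall s, u s <= C + L * `|oriented_integral tau s u|} ->
  {in `[0, T], forall s, 0 <= u s} ->
  {in `[0, T], forall s, u s <= 2 * C * expR (2 * L * `|s - tau|)}.
Proof.
move=> C0 L0 tauT bu uC u0 s sT.
have [_ [M uM]] := bu.
pose e r := expR (2 * L * `|r - tau|).
have e1 r : 1 <= e r.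
  by rewrite -expR0 ler_expR mulr_ge0// mulr_ge0// ltW.
have M0 : 0 <= M by apply: le_trans (uM _ tauT).
(* In the weight e, integration against 2 L contracts by 1/2, on either side of tau. *)
have H n : {in `[0, T], forall r, u r <= (2 * C + M / 2 ^+ n) * e r}.
  elim: n => [|n IH] r rT.
    rewrite expr0 divr1; apply: le_trans (_ : M <= _).
      exact: le_trans (ler_norm _) (uM _ rT).
    rewrite -[leLHS]mulr1 ler_pM//.
    by rewrite lerDr mulr_ge0.
  apply: (le_trans (uC _ rT)).
  set K := 2 * C + M / 2 ^+ n.
  have K0 : 0 <= K by rewrite addr_ge0 ?mulr_ge0// invr_ge0 exprn_ge0.
  have be : bmeas T e by exact: bmeas_expR.
  have : `|oriented_integral tau r u| <= `|oriented_integral tau r (fun x => K * e x)|.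
    apply: (ori_le bu (bmeasZ K be) tauT rT).
    by move=> x xT; rewrite ger0_norm ?IH ?u0.
  rewrite (oriZ _ be tauT rT) normrM (ger0_norm K0).
  have := @ori_exp (2 * L) tau r (mulr_gt0 (ltr0Sn _ 1) L0) tauT rT.
  rewrite -/e => h1 h2.
  have h3 : L * `|oriented_integral tau r u| <= K * e r / 2.
    have -> : K * e r / 2 = L * (K * (e r / (2 * L))) by field; rewrite gt_eqF.
    rewrite ler_pM2l//; apply: (le_trans h2); rewrite ler_wpM2l//.
  have -> : (2 * C + M / 2 ^+ n.+1) * e r = C * e r + K * e r / 2.
    by rewrite /K exprS; field; rewrite expf_neq0.
  by rewrite lerD// -[leLHS]mulr1 ler_wpM2l.
have cv : (fun n => (2 * C + M / 2 ^+ n) * e s) @ \oo --> (2 * C + 0) * e s.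
  apply: cvgMl; apply: cvgD; first exact: cvg_cst.
  exact: cvg_div_exp2.
rewrite addr0 in cv; rewrite -(cvg_lim _ cv)//; apply: limr_ge.
  by apply/cvg_ex; eexists; exact: cv.
by apply: nearW => n; exact: H.
Qed.
End Integral2.

(** * Lebesgue differentiation *)

Section LebesgueDiff.
Context {R : realType}.
Implicit Types (F G : R -> R) (D : set R) (a b c s t : R).

Lemma lebesgue_negligible_lam (N : set R) :
  (@lebesgue_measure R).-negligible N -> (lam R).-negligible N.
Proof. by move=> [A [mA A0 NA]]; exists A; split => //; exact: sub_caratheodory. Qed.

(** A set of the completed sigma-algebra is the union of a Borel set and a negligible set; the Borel
    part is kept. *)
Lemma lam_measurable_borel (A : set (LT R)) : measurable A ->
  exists B, [/\ measurable (B : set R), B `<=` A & (lam R).-negligible (A `\` B)].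
Proof.
move=> mA; have : completed_algebra_gen (@lebesgue_measure R) A.
  by rewrite -g_sigma_completed_algebra_genE completed_caratheodory_measurable.
move=> [B mB [N negN <-]]; exists B; split => //.
apply: negligibleS (lebesgue_negligible_lam negN).
by move=> x [[|]].
Qed.

Context {T : R}.

(** [F] is determined by the countably many level sets where it exceeds a rational; shrinking each
    of them to a Borel subset costs one null set in all. *)
Lemma bmeas_borel F : bmeas T F -> exists G M, [/\ measurable_fun setT G,
  (forall s, `|G s| <= M) & {ae lam R, forall s, s \in `[0, T] -> F s = G s}].
Proof.
move=> [mF [M0 FM0]]; pose M := `|M0|.
have FM s : s \in `[0, T] -> `|F s| <= M.
  by move=> sT; exact: le_trans (FM0 _ sT) (ler_norm _).
have M_ge0 : 0 <= M by exact: normr_ge0.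
pose q (n : nat) : R := if @unpickle rat n is Some r then ratr r else 0.
have q_dense a b : a < b -> exists n, a < q n < b.
  move=> /rat_in_itvoo[r]; rewrite in_itv /= => ab.
  by exists (pickle r); rewrite /q pickleK.
pose A (n : nat) : set (LT R) := `[0, T]%classic `&` F @^-1` `]q n, +oo[%classic.
have mA n : measurable (A n) by apply: mF => //; exact: lam_measurable_itv.
have [B BP] := choice (fun n => lam_measurable_borel (mA n)).
(* [h n] is [q n] on [B n] and the lower bound [- M] elsewhere, so outside the null sets [A n] minus
   [B n] the supremum over n recovers [F]. *)
pose h n s : R := (q n + M) * \1_(B n) s - M.
have h_le n s : h n s <= M.
  rewrite /h indicE; case: (boolP (s \in B n)) => [|_]; last first.
    by rewrite mulr0 sub0r (@le_trans _ _ 0)// oppr_le0.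
  rewrite inE => Bs; have [_ /(_ _ Bs) [/= sT]] := BP n.
  rewrite in_itv /= andbT => /ltW qF _.
  by rewrite mulr1 addrK; apply: (le_trans qF (le_trans (ler_norm _) (FM _ sT))).
have h_ub s : has_ubound (range (h^~ s)) by exists M => _ [n _ <-]; exact: h_le.
have mh n : measurable_fun setT (h n).
  apply: measurable_funB => //; apply: measurable_funM => //.
  by apply: measurable_indic; have [] := BP n.
pose G s := sups (h^~ s) 0.
have h_G n s : h n s <= G s.
  by apply: ub_le_sup; [have [u hu] := h_ub s; exists u => _ [k _ <-]; apply: hu; exists k|exists n].
have G_le s K : (forall n, h n s <= K) -> G s <= K.
  move=> hK; apply: ge_sup; first by exists (h 0%N s), 0%N.
  by move=> _ [n _ <-].
exists G, M; split.
- by apply: (@measurable_fun_sups _ _ _ setT h 0).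
- move=> s; rewrite ler_norml; apply/andP; split; last exact: G_le.
  have [n /andP[Mn _]] := q_dense M (M + 1) ltac:(by rewrite ltrDl).
  apply: (le_trans _ (h_G n s)); rewrite /h indicE.
  case: (s \in B n); last by rewrite mulr0 sub0r.
  by rewrite mulr1 addrK (le_trans _ (ltW Mn))// (@le_trans _ _ 0)// oppr_le0.
- have : (lam R).-negligible (\bigcup_n (A n `\` B n)).
    by apply: negligible_bigcup => n; have [] := BP n.
  apply: negligibleS => s /= /not_implyP[sT FG].
  apply: contrapT => nU; apply: FG.
  have AB n : A n s -> B n s.
    by move=> As; apply: contrapT => nB; apply: nU; exists n.
  have hF n : h n s <= F s.
    rewrite /h indicE; case: (boolP (s \in B n)) => [|_].
      rewrite inE => Bs; have [_ /(_ _ Bs) [/= _]] := BP n.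
      by rewrite in_itv /= andbT => /ltW qF _; rewrite mulr1 addrK.
    rewrite mulr0 sub0r; have := FM _ sT; rewrite ler_norml => /andP[] //.
  apply/eqP; rewrite eq_le; apply/andP; split; last exact: G_le.
  apply/ler_addgt0Pl => e e0.
  have [n /andP[Fn nF]] := q_dense (F s - e) (F s) ltac:(by rewrite ltrBlDr ltrDl).
  have Bs : B n s by apply: AB; split => //=; rewrite in_itv /= nF.
  rewrite -lerBlDl; apply: (le_trans (ltW Fn)).
  by apply: le_trans (h_G n s); rewrite /h indicE mem_set// mulr1 addrK.
Qed.

(** The primitives of [F] and of its Borel version [G] agree on [[0, T]]. The exceptional set unites
    the points where [F] and [G] differ with those where the primitive of [G] does not have
    derivative [G]. The interval is open so that [tau + h] stays in [[0, T]] for small h. *)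
Lemma ae_cvg_average F : bmeas T F ->
  {ae lam R, forall tau, tau \in `]0, T[ ->
     h^-1 * oriented_integral tau (tau + h) F @[h --> 0^'] --> F tau}.
Proof.
move=> bF; have [G [M [mG GM FG]]] := bmeas_borel bF.
have GI (K : set R) : measurable K -> (lebesgue_measure K < +oo)%E ->
    (@lebesgue_measure R).-integrable K (EFin \o G).
  move=> mK Koo; apply: measurable_bounded_integrable => //.
    exact: measurable_funS mG.
  exists M; split; first exact: num_real.
  by move=> M' MM' x _ /=; apply: le_trans (ltW MM').
have GI2 (a b : R) : (@lebesgue_measure R).-integrable `[a, b] (EFin \o G).
  by apply: GI => //; exact: (lam_itvcc_lty a b).
have lG : locally_integrable setT G.
  split; [by []|exact: openT|move=> K _ cK].
  have mK : measurable K by apply: closed_measurable; exact: compact_closed.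
  by have /integrableP[] := GI K mK (compact_finite_measure cK).
have := @FTC1 R G (BLeft 0) (GI2 0) lG.
set P := fun x => \int[lebesgue_measure]_(t in [set` Interval (BLeft 0) (BRight x)]) G t.
move=> /= /lebesgue_negligible_lam DG.
have primP s : s \in `[0, T] -> prim F s = P s.
  move=> sT; have T0 : 0 \in `[0, T].
    by move: sT; rewrite !in_itv /= lexx => /andP[]; exact: le_trans.
  have mI : measurable (`[0, s]%classic : set (LT R)) by exact: lam_measurable_itv.
  have mGl : measurable_fun (`[0, s]%classic : set (LT R)) G by exact: borel_lam_measurable.
  rewrite /P -[RHS]Rint_lam_borel//; last first.
    apply: measurable_bounded_integrable => //; first exact: lam_itvcc_lty.
    exists M; split; first exact: num_real.
    by move=> M' MM' x _ /=; apply: le_trans (ltW MM').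
  rewrite /prim /Rintegral; congr fine; apply: ae_eq_integral.
  - exact: mI.
  - by have /integrableP[] := bmeas_integrable bF T0 sT.
  - exact/measurable_EFinP.
  - apply: negligibleS FG => r /= /not_implyP[r0s FG] H; apply: FG; congr EFin.
    by apply: H; exact: (sub_itv0T T0 sT).
apply: negligibleS (negligibleU FG DG) => tau /= nF.
apply: contrapT => /not_orP[/contrapT FGt /contrapT dt]; apply: nF => tauT.
have tauT' : tau \in `[0, T].
  by move: tauT; rewrite !in_itv /= => /andP[/ltW-> /ltW].
have [] := dt; first by move: tauT; rewrite lte_fin in_itv /= => /andP[].
rewrite -FGt// => dP <-; rewrite derive1E.
have := dP; rewrite /derivable => /cvg_lim.
move=> H; rewrite /derive; apply: cvg_trans; last exact: dP.
apply: near_eq_cvg; near=> h.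
have hT : tau + h \in `[0, T].
  have : ball tau (Num.min tau (T - tau)) (tau + h).
    rewrite /ball /= opprD addrA subrr sub0r normrN.
    near: h; apply: dnbhs0_lt; rewrite lt_min subr_gt0.
    by move: tauT; rewrite in_itv /=.
  rewrite ball_itv /= !in_itv /= => /andP[h1 h2].
  have m1 : Num.min tau (T - tau) <= tau by rewrite ge_min lexx.
  have m2 : Num.min tau (T - tau) <= T - tau by rewrite ge_min lexx orbT.
  by apply/andP; split; move: h1 h2 m1 m2; set m := Num.min _ _; lra.
by rewrite (ori_prim bF tauT' hT) !primP// /GRing.scale /= mulr1 [h + tau]addrC.
Unshelve. all: by end_near. Qed.

End LebesgueDiff.

(** * Vector-valued integrals *)

Section VectorIntegral.
Context {R : realType} {d : nat}.
Implicit Types (x y : 'rV[R]_d) (G H : R -> 'rV[R]_d) (a b c s t : R).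

Lemma rV_norm_le x e : 0 <= e -> (forall i, `|x 0 i| <= e) -> `|x| <= e.
Proof.
move=> e0 xe; rewrite [leLHS]mx_normrE; apply/bigmax_leP; split => // -[i j] _ /=.
by rewrite ord1.
Qed.

Lemma le_rV_norm x i : `|x 0 i| <= `|x|.
Proof.
rewrite [leRHS]mx_normrE.
exact: (le_bigmax _ (fun ij : 'I_1 * 'I_d => `|x ij.1 ij.2|) (0, i)).
Qed.

Definition vbmeas (T : R) G := forall i, bmeas T (fun s => G s 0 i).

Definition vint a b G : 'rV[R]_d :=
  \row_i oriented_integral a b (fun s => G s 0 i).

Context {T : R}.

Lemma vbmeas_bound G : vbmeas T G ->
  exists M, forall s, s \in `[0, T] -> `|G s| <= M.
Proof.
move=> bG; have [M MP] := choice (fun i => (bG i).2).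
exists (\sum_i `|M i|) => s sT; apply: rV_norm_le; first by rewrite sumr_ge0.
move=> i; apply: (le_trans (MP i s sT)); apply: (le_trans (ler_norm _)).
by rewrite (bigD1 i)//= lerDl sumr_ge0.
Qed.

Lemma vbmeas_norm G : vbmeas T G -> bmeas T (fun s => `|G s|).
Proof.
move=> bG; split; last first.
  by have [M MP] := vbmeas_bound bG; exists M => s sT; rewrite normr_id MP.
suff H (r : seq ('I_1 * 'I_d)) : measurable_fun (`[0, T]%classic : set (LT R))
    (fun s => \big[Num.max/0]_(ij <- r) `|G s ij.1 ij.2|).
  apply: eq_measurable_fun (H (index_enum _)) => s _.
  by rewrite [RHS]mx_normrE.
elim: r => [|[i j] r IH].
  by apply: eq_measurable_fun (measurable_cst (0 : R)) => s _; rewrite big_nil.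
have mij : measurable_fun (`[0, T]%classic : set (LT R)) (fun s => `|G s i j|).
  by rewrite ord1; exact: (bmeas_norm (bG j)).1.
by apply: eq_measurable_fun (measurable_maxr mij IH) => s _; rewrite big_cons.
Qed.

Lemma vbmeasB G H : vbmeas T G -> vbmeas T H -> vbmeas T (fun s => G s - H s).
Proof.
move=> bG bH i; apply: eq_bmeas (bmeasB (bG i) (bH i)) => s _.
by rewrite !mxE.
Qed.

Lemma vintB G H a b : vbmeas T G -> vbmeas T H -> a \in `[0, T] ->
  b \in `[0, T] -> vint a b (fun s => G s - H s) = vint a b G - vint a b H.
Proof.
move=> bG bH aT bT; apply/rowP => i; rewrite !mxE -(oriB (bG i) (bH i) aT bT).
by apply: (eq_ori aT bT) => s _; rewrite !mxE.
Qed.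

Lemma vint_chasles G a b c : vbmeas T G ->
  a \in `[0, T] -> b \in `[0, T] -> c \in `[0, T] ->
  vint a c G = vint a b G + vint b c G.
Proof.
by move=> bG aT bT cT; apply/rowP => i; rewrite !mxE; exact: (ori_chasles (bG i)).
Qed.

Lemma vint_self G a : vbmeas T G -> a \in `[0, T] -> vint a a G = 0.
Proof. by move=> bG aT; apply/rowP => i; rewrite !mxE (ori_self (bG i) aT). Qed.

Lemma eq_vint G H a b : a \in `[0, T] -> b \in `[0, T] ->
  {in `[0, T], G =1 H} -> vint a b G = vint a b H.
Proof.
move=> aT bT GH; apply/rowP => i; rewrite !mxE.
by apply: (eq_ori aT bT) => s sT; rewrite GH.
Qed.

Lemma vbmeasP k G H : vbmeas T G -> vbmeas T H -> vbmeas T (fun s => k *: G s + H s).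
Proof.
move=> bG bH i; apply: eq_bmeas (bmeasD (bmeasZ k (bG i)) (bH i)) => s _.
by rewrite !mxE.
Qed.

Lemma vintP k G H a b : vbmeas T G -> vbmeas T H -> a \in `[0, T] ->
  b \in `[0, T] -> vint a b (fun s => k *: G s + H s) = k *: vint a b G + vint a b H.
Proof.
move=> bG bH aT bT; apply/rowP => i; rewrite !mxE -(oriZ k (bG i) aT bT).
rewrite -(oriD (bmeasZ k (bG i)) (bH i) aT bT).
by apply: (eq_ori aT bT) => s _; rewrite !mxE.
Qed.

Lemma vbmeas0 : vbmeas T (fun=> 0).
Proof. by move=> i; apply: eq_bmeas (integrable_bmeas_cst 0) => s _; rewrite mxE. Qed.

Lemma vint0 a b : vint a b (fun=> 0) = 0.
Proof.
apply/rowP => i; rewrite !mxE -[RHS](mul0r (b - a)) -ori_cst; congr oriented_integral.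
Qed.

(** The maximum norm reduces this to one scalar inequality per coordinate, with no constant
    depending on d. *)
Lemma vint_le G (rho : R -> R) a b : vbmeas T G -> bmeas T rho ->
  a \in `[0, T] -> b \in `[0, T] -> {in `[0, T], forall s, `|G s| <= rho s} ->
  `|vint a b G| <= `|oriented_integral a b rho|.
Proof.
move=> bG br aT bT Gr; apply: rV_norm_le => // i; rewrite mxE.
apply: (ori_le (bG i) br aT bT) => s sT.
exact: le_trans (le_rV_norm _ _) (Gr _ sT).
Qed.

Lemma vint_bound G M a b : vbmeas T G -> a \in `[0, T] -> b \in `[0, T] ->
  {in `[0, T], forall s, `|G s| <= M} -> `|vint a b G| <= M * `|b - a|.
Proof.
move=> bG aT bT GM.
apply: (le_trans (vint_le bG (integrable_bmeas_cst M) aT bT GM)).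
rewrite ori_cst normrM (ger0_norm (x := M))//; exact: le_trans (GM _ aT).
Qed.

Lemma ori_le0T rho a b : bmeas T rho -> {in `[0, T], forall s, 0 <= rho s} ->
  a \in `[0, T] -> b \in `[0, T] ->
  `|oriented_integral a b rho| <= oriented_integral 0 T rho.
Proof.
move=> br r0 aT bT.
have T0 : 0 <= T by move: aT; rewrite in_itv /= => /andP[]; exact: le_trans.
have oT : 0 \in `[0, T] by rewrite in_itv /= lexx.
have TT : T \in `[0, T] by rewrite in_itv /= lexx andbT.
have pos (x y : R) : x \in `[0, T] -> y \in `[0, T] -> x <= y -> 0 <= oriented_integral x y rho.
  move=> xT yT xy; rewrite /oriented_integral xy; apply: Rintegral_ge0 => s.
  by move=> /(sub_itv0T xT yT); exact: r0.
wlog ab : a b aT bT / a <= b.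
  move=> H; have [/H|/ltW/H] := leP a b; first exact.
  by move=> /(_ bT aT); rewrite (ori_swap br aT bT) normrN.
rewrite ger0_norm ?pos//.
have -> : oriented_integral 0 T rho = oriented_integral 0 a rho +
    oriented_integral a b rho + oriented_integral b T rho.
  by rewrite -(ori_chasles br oT aT bT) -(ori_chasles br oT bT TT).
rewrite -[leLHS]addr0 lerD//.
  by rewrite lerDr pos//; move: aT; rewrite in_itv /= => /andP[].
by rewrite pos//; move: bT; rewrite in_itv /= => /andP[].
Qed.

(** The regularity of every trajectory, since velocities are bounded; it is what makes a
    time-dependent field measurable along the trajectory. *)
Definition lipT (T : R) (X : R -> 'rV[R]_d) := exists2 C, 0 <= C &
  {in `[0, T] &, forall s r, `|X s - X r| <= C * `|s - r|}.

Lemma lipT_bound X : lipT T X -> exists M, {in `[0, T], forall s, `|X s| <= M}.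
Proof.
move=> [C C0 XC]; exists (`|X 0| + C * T) => s sT.
have T0 : 0 <= T by move: sT; rewrite in_itv /= => /andP[]; exact: le_trans.
have oT : 0 \in `[0, T] by rewrite in_itv /= lexx.
rewrite -[X s](subrK (X 0)) addrC (le_trans (ler_normD _ _))// lerD2l.
apply: (le_trans (XC _ _ sT oT)); rewrite subr0 ler_wpM2l//.
by move: sT; rewrite in_itv /= => /andP[s0 sT]; rewrite ger0_norm.
Qed.

Lemma vint_lipT G tau x (X : R -> 'rV[R]_d) : vbmeas T G -> tau \in `[0, T] ->
  {in `[0, T], forall s, X s = x + vint tau s G} -> lipT T X.
Proof.
move=> bG tT XG; have [M GM] := vbmeas_bound bG.
exists `|M| => // s r sT rT.
rewrite !XG// (vint_chasles bG tT rT sT) opprD addrACA subrr add0r addrAC subrr add0r.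
apply: (le_trans (vint_bound bG rT sT GM)).
by rewrite ler_wpM2r// ler_norm.
Qed.

(* X is approximated by its values at the points r n s of a grid, on each cell of which
   s |-> g s (X (r n s)) is a section of g. *)
Lemma measurable_carath (g : R -> 'rV[R]_d -> R) (X : R -> 'rV[R]_d) :
  (forall x, measurable_fun (`[0, T]%classic : set (LT R)) (g^~ x)) ->
  (forall s, s \in `[0, T] -> continuous (g s)) -> lipT T X ->
  measurable_fun (`[0, T]%classic : set (LT R)) (fun s => g s (X s)).
Proof.
move=> mg cg [C C0 XC].
pose r (n : nat) s : R := (Num.truncn (s * n.+1%:R))%:R / n.+1%:R.
have rs n s : 0 <= s -> r n s <= s < r n s + n.+1%:R^-1.
  move=> s0; have := @truncn_itv R (s * n.+1%:R) ltac:(by rewrite mulr_ge0).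
  move=> /andP[h1 h2]; rewrite /r ler_pdivrMr ?ltr0n// h1 /=.
  by rewrite -[X in _ < _ + X]div1r -mulrDl ltr_pdivlMr ?ltr0n// natr1.
apply: (@measurable_fun_cvg _ (LT R) R _ (fun n s => g s (X (r n s)))).
  move=> n.
  pose E (k : nat) : set (LT R) := `[0, T]%classic `&`
    `[k%:R / n.+1%:R, k.+1%:R / n.+1%:R[%classic.
  have EU : `[0, T]%classic = \bigcup_k E k.
    apply/seteqP; split => [s sT|s [k _ []]//].
    have s0 : 0 <= s by move: sT; rewrite /= in_itv /= => /andP[].
    exists (Num.truncn (s * n.+1%:R)) => //; split=> //=; rewrite in_itv /=.
    by have /andP[h1 h2] := rs n s s0; rewrite h1 -natr1 mulrDl div1r.
  have mE k : measurable (E k).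
    by apply: measurableI; exact: lam_measurable_itv.
  rewrite EU; apply/(measurable_fun_bigcup _ mE) => k.
  have mk : measurable_fun (E k) (g^~ (X (k%:R / n.+1%:R))).
    apply: measurable_funS (mg _); first exact: lam_measurable_itv.
    by move=> s [].
  apply: eq_measurable_fun mk => s; rewrite inE => -[sT].
  rewrite /= in_itv /= => /andP[h1 h2]; congr (g s (X _)).
  rewrite /r; congr (_%:R / _); apply/esym/truncn_def.
  by move: h1 h2; rewrite ler_pdivrMr ?ltr_pdivlMr ?ltr0n// => -> ->.
move=> s sT; apply: (@cvg_comp _ _ _ (fun n => X (r n s)) (g s) _ (nbhs (X s)));
  last exact: cg.
have C1 : 0 < C + 1 by rewrite ltr_pwDr.
apply/cvgrPdist_lt => e e0; near=> n.
have /andP[s0 sT'] : 0 <= s <= T by move: sT; rewrite /= in_itv.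
have /andP[h1 h2] := rs n s s0.
have rT : r n s \in `[0, T].
  by rewrite in_itv /= (le_trans h1 sT') /r divr_ge0.
apply: (le_lt_trans (XC _ _ sT rT)).
rewrite ger0_norm ?subr_ge0//.
apply: (@le_lt_trans _ _ ((C + 1) * n.+1%:R^-1)).
  apply: ler_pM => //; first by rewrite subr_ge0.
    by rewrite lerDl.
  by rewrite lerBlDl ltW.
rewrite mulrC -ltr_pdivlMr//.
near: n; exact: (near_infty_natSinv_lt (PosNum (divr_gt0 e0 C1))).
Unshelve. all: by end_near. Qed.

Lemma lipT_vbmeas (X : R -> 'rV[R]_d) : lipT T X -> vbmeas T X.
Proof.
move=> lX i; split.
  apply: (@measurable_carath (fun _ x => x 0 i) X) => //.
    by move=> s _; exact: coord_continuous.
have [M XM] := lipT_bound lX; exists M => s sT.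
exact: le_trans (le_rV_norm _ _) (XM _ sT).
Qed.

(** The velocities [G] and [H] are arbitrary, not tied to an equation. Uniqueness, dependence on the
    initial point, linearity of the variational equation, differentiability of the flow and
    continuity of its differential are all comparisons of this form, with a suitable error [rho]. *)
Lemma vint_stable (L tau : R) G H (X Y : R -> 'rV[R]_d) x y (rho : R -> R) : 0 < L ->
  tau \in `[0, T] -> vbmeas T G -> vbmeas T H -> bmeas T rho ->
  {in `[0, T], forall s, 0 <= rho s} ->
  {in `[0, T], forall s, X s = x + vint tau s G} ->
  {in `[0, T], forall s, Y s = y + vint tau s H} ->
  {in `[0, T], forall s, `|G s - H s| <= rho s + L * `|X s - Y s|} ->
  {in `[0, T], forall s, `|X s - Y s| <=
    2 * (`|x - y| + oriented_integral 0 T rho) * expR (2 * L * T)}.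
Proof.
move=> L0 tT bG bH br r0 XG YH GH s sT.
have T0 : 0 <= T by move: sT; rewrite in_itv /= => /andP[]; exact: le_trans.
have oT : 0 \in `[0, T] by rewrite in_itv /= lexx.
have TT : T \in `[0, T] by rewrite in_itv /= lexx andbT.
have bX := lipT_vbmeas (vint_lipT bG tT XG).
have bY := lipT_vbmeas (vint_lipT bH tT YH).
have bu := vbmeas_norm (vbmeasB bX bY).
set C := `|x - y| + oriented_integral 0 T rho.
have C0 : 0 <= C.
  by rewrite addr_ge0// (le_trans _ (ori_le0T br r0 oT TT)).
have uC : {in `[0, T], forall r, `|X r - Y r| <=
   C + L * `|oriented_integral tau r (fun s => `|X s - Y s|)|}.
  move=> r rT; rewrite XG// YH// opprD addrACA -(vintB bG bH tT rT).
  rewrite (le_trans (ler_normD _ _))// /C -addrA lerD2l.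
  have bL := bmeasZ L bu.
  apply: (le_trans (vint_le (vbmeasB bG bH) (bmeasD br bL) tT rT GH)).
  rewrite (oriD br bL tT rT) (le_trans (ler_normD _ _))// lerD//.
    exact: ori_le0T.
  by rewrite (oriZ L bu tT rT) normrM gtr0_norm.
have := gronwall C0 L0 tT bu uC.
move=> /(_ (fun _ _ => normr_ge0 _) s sT) h; apply: (le_trans h).
rewrite ler_wpM2l ?mulr_ge0// ler_expR ler_wpM2l ?mulr_ge0 ?(ltW L0)//.
move: sT tT; rewrite !in_itv /= => /andP[s0 sT] /andP[t0 tT].
by rewrite ler_norml; lra.
Qed.

End VectorIntegral.

(** * Caratheodory differential equations *)

(** The intervals of radius 2 K / 2^n around [a n] are nested, and the limit is the supremum of
    their left ends; it comes with its rate. *)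
Lemma geometric_cvg (R : realType) (a : nat -> R) (K : R) :
  (forall n, `|a n.+1 - a n| <= K / 2 ^+ n) ->
  exists l, forall n, `|l - a n| <= 2 * K / 2 ^+ n.
Proof.
move=> aK; pose b n := a n - 2 * K / 2 ^+ n; pose c n := a n + 2 * K / 2 ^+ n.
have step n : b n <= b n.+1 /\ c n.+1 <= c n.
  have e : K / 2 ^+ n = 2 * K / 2 ^+ n.+1 by rewrite exprS; field; rewrite expf_neq0.
  have e2 : 2 * K / 2 ^+ n = 2 * (K / 2 ^+ n) by field; rewrite expf_neq0.
  have := aK n; rewrite ler_norml => /andP[h1 h2].
  by rewrite /b /c e2 -e; split; lra.
have K0 : 0 <= K by have := aK 0%N; rewrite expr0 divr1; exact: le_trans.
have bc n : b n <= c n.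
  by rewrite /b /c lerD2l (@le_trans _ _ 0)// ?oppr_le0 ?divr_ge0 ?mulr_ge0 ?exprn_ge0.
have bmono : {homo b : n m / (n <= m)%N >-> n <= m}.
  by apply: homo_leq => // [x y z|n]; [exact: le_trans|have [] := step n].
have cmono : {homo c : n m / (n <= m)%N >-> m <= n}.
  apply: (@homo_leq _ c (fun x y => y <= x)) => // [x y z|n].
    by move=> h1 h2; exact: le_trans h2 h1.
  by have [] := step n.
have bcm n m : b n <= c m.
  have [nm|/ltnW mn] := leqP n m.
    exact: le_trans (bmono _ _ nm) (bc m).
  exact: le_trans (bc n) (cmono _ _ mn).
exists (sup (range b)) => n.
have h1 : b n <= sup (range b).
  by apply: ub_le_sup; [exists (c 0%N) => _ [m _ <-]; exact: bcm|exists n].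
have h2 : sup (range b) <= c n.
  by apply: ge_sup; [exists (b 0%N), 0%N|move=> _ [m _ <-]; exact: bcm].
by rewrite ler_norml; move: h1 h2; rewrite /b /c; set k := 2 * K / _; lra.
Qed.

Lemma lipschitz_continuous (R : realType) (V W : normedModType R) (h : V -> W) (L : R) :
  (forall x y, `|h x - h y| <= L * `|x - y|) -> continuous h.
Proof.
move=> hL x; apply/cvgrPdist_lt => e e0.
have L1 : 0 < `|L| + 1 by rewrite ltr_pwDr.
near=> y; apply: (le_lt_trans (hL _ _)).
apply: (@le_lt_trans _ _ ((`|L| + 1) * `|x - y|)).
  by rewrite ler_wpM2r// (le_trans (ler_norm _))// lerDl.
rewrite mulrC -ltr_pdivlMr//.
by near: y; apply: cvgr_dist_lt => //; rewrite divr_gt0.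
Unshelve. all: by end_near. Qed.

Section Picard.
Context {R : realType} {d : nat}.
Implicit Types (x y : 'rV[R]_d) (g : R -> 'rV[R]_d -> 'rV[R]_d).

Definition caratheodory (T L : R) g := [/\
  forall x i, measurable_fun (`[0, T]%classic : set (LT R)) (fun s => g s x 0 i),
  forall s, s \in `[0, T] -> forall x y, `|g s x - g s y| <= L * `|x - y| &
  exists M, forall s, s \in `[0, T] -> `|g s 0| <= M].

(** The first conjunct gives the integral its meaning: as a total operator it would also return a
    value for a velocity that is not integrable. *)
Definition solution (T : R) g tau x (X : R -> 'rV[R]_d) :=
  vbmeas T (fun r => g r (X r)) /\
  {in `[0, T], forall s, X s = x + vint tau s (fun r => g r (X r))}.

Context {T : R}.

Lemma carath_vbmeas L g X : 0 <= L -> caratheodory T L g -> lipT T X ->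
  vbmeas T (fun s => g s (X s)).
Proof.
move=> L0 [mg Lg [M gM]] lX i; split.
  apply: (@measurable_carath _ _ _ (fun s x => g s x 0 i) X) => //.
  move=> s sT x; apply: (@continuous_comp _ _ _ (g s) (fun x => x 0 i));
    last exact: coord_continuous.
  exact: (lipschitz_continuous (Lg _ sT)).
have [N XN] := lipT_bound lX; exists (M + L * N) => s sT.
apply: (le_trans (le_rV_norm _ _)).
rewrite -[g s (X s)](subrK (g s 0)) addrC (le_trans (ler_normD _ _))// lerD ?gM//.
by rewrite (le_trans (Lg _ sT _ _))// subr0 ler_wpM2l// XN.
Qed.

Lemma solution_lipT g tau x X : tau \in `[0, T] -> solution T g tau x X -> lipT T X.
Proof. by move=> tT [bG XG]; exact: vint_lipT bG tT XG. Qed.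

Lemma picard L g tau x : 0 < L -> caratheodory T L g -> tau \in `[0, T] ->
  exists X, solution T g tau x X.
Proof.
move=> L0 cg tT; have [mg Lg [M gM]] := cg.
have T0 : 0 <= T by move: tT; rewrite in_itv /= => /andP[]; exact: le_trans.
have M0 : 0 <= M by apply: le_trans (gM _ tT).
pose Xn (n : nat) := iter n
  (fun (X : R -> 'rV[R]_d) s => x + vint tau s (fun r => g r (X r))) (fun=> x).
have lX n : lipT T (Xn n).
  elim: n => [|n IH].
    by exists 0 => // s r _ _; rewrite subrr normr0 mul0r.
  exact: (vint_lipT (carath_vbmeas (ltW L0) cg IH) tT (x := x)).
have bG n := carath_vbmeas (ltW L0) cg (lX n).
pose e r := expR (2 * L * `|r - tau|).
have be : bmeas T e by exact: bmeas_expR.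
have e1 r : 1 <= e r.
  by rewrite -expR0 ler_expR mulr_ge0// mulr_ge0// ltW.
(* Bound for the first increment: the speed at the constant [x] is at most [M + L |x|], over a time
   at most [T]. *)
pose K := (M + L * `|x|) * T.
have K0 : 0 <= K by rewrite mulr_ge0// addr_ge0// mulr_ge0// ltW.
(* Picard iterates contract by 1/2 in the weighted norm sup_s |X s| / e s. *)
have dX n : {in `[0, T], forall s, `|Xn n.+1 s - Xn n s| <= K / 2 ^+ n * e s}.
  elim: n => [|n IH] s sT.
    rewrite expr0 divr1 /= addrAC subrr add0r.
    apply: (le_trans (vint_bound (M := M + L * `|x|) (bG 0%N) tT sT _)).
      move=> r rT /=; rewrite -[g r x](subrK (g r 0)) addrC.
      rewrite (le_trans (ler_normD _ _))// lerD ?gM//.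
      by rewrite (le_trans (Lg _ rT _ _))// subr0.
    apply: (@le_trans _ _ K); last by rewrite -[leLHS]mulr1 ler_wpM2l.
    rewrite ler_wpM2l// ?addr_ge0// ?mulr_ge0 ?(ltW L0)//.
    by move: sT tT; rewrite !in_itv /= => /andP[? ?] /andP[? ?]; rewrite ler_norml; lra.
  have -> : Xn n.+2 s - Xn n.+1 s =
      vint tau s (fun r => g r (Xn n.+1 r) - g r (Xn n r)).
    rewrite (vintB (bG n.+1) (bG n) tT sT) [LHS]/=.
    by rewrite opprD addrACA subrr add0r.
  have bk := bmeasZ (L * (K / 2 ^+ n)) be.
  apply: (le_trans (vint_le (vbmeasB (bG n.+1) (bG n)) bk tT sT _)).
    move=> r rT; apply: (le_trans (Lg _ rT _ _)).
    by rewrite -mulrA ler_wpM2l ?(ltW L0)// IH.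
  have k0 : 0 <= L * (K / 2 ^+ n) by rewrite mulr_ge0 ?(ltW L0)// divr_ge0// exprn_ge0.
  rewrite (oriZ _ be tT sT) normrM (ger0_norm k0).
  have := @ori_exp _ T (2 * L) tau s (mulr_gt0 (ltr0Sn _ 1) L0) tT sT.
  rewrite -/e => h; apply: (le_trans (ler_wpM2l k0 h)); rewrite le_eqVlt.
  apply/orP; left; apply/eqP; rewrite exprS /e; field.
  by rewrite expf_neq0// gt_eqF.
(* The weight is at most [expR (2 * L * T)] on [[0, T]], so [C] controls the increments without
   weight. *)
pose C := K * expR (2 * L * T).
have eT s : s \in `[0, T] -> e s <= expR (2 * L * T).
  move=> sT; rewrite ler_expR ler_wpM2l ?mulr_ge0 ?(ltW L0)//.
  by move: sT tT; rewrite !in_itv /= => /andP[? ?] /andP[? ?]; rewrite ler_norml; lra.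
have lim_ex s i : exists l, s \in `[0, T] -> forall n, `|l - Xn n s 0 i| <= 2 * C / 2 ^+ n.
  have [sT|_] := boolP (s \in `[0, T]); last by exists 0.
  have [|l Hl] := @geometric_cvg R (fun n => Xn n s 0 i) C; last by exists l.
  move=> n; have := le_rV_norm (Xn n.+1 s - Xn n s) i; rewrite !mxE => h.
  apply: (le_trans h); apply: (le_trans (dX n _ sT)).
  by rewrite /C mulrAC ler_wpM2r ?invr_ge0 ?exprn_ge0// ler_wpM2l// eT.
have [X0 XP0] : exists X : R -> 'rV[R]_d, forall s i, s \in `[0, T] ->
   forall n, `|X s 0 i - Xn n s 0 i| <= 2 * C / 2 ^+ n.
  have /choice[l lP] := fun si : R * 'I_d => lim_ex si.1 si.2.
  by exists (fun s => \row_i l (s, i)) => s i; rewrite mxE; exact: (lP (s, i)).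
have C0 : 0 <= C by rewrite mulr_ge0// expR_ge0.
have XP n s : s \in `[0, T] -> `|X0 s - Xn n s| <= 2 * C / 2 ^+ n.
  move=> sT; apply: rV_norm_le.
    by apply: divr_ge0; [exact: mulr_ge0|exact: exprn_ge0].
  by move=> i; rewrite !mxE; exact: XP0.
clearbody C; have cv0 := @cvg_div_exp2 R.
have GX n s : s \in `[0, T] -> `|g s (X0 s) - g s (Xn n s)| <= L * (2 * C) / 2 ^+ n.
  by move=> sT; apply: (le_trans (Lg _ sT _ _)); rewrite -mulrA ler_wpM2l ?(ltW L0)// XP.
have bX : vbmeas T (fun s => g s (X0 s)).
  move=> i; split.
    apply: (@measurable_fun_cvg _ (LT R) R _ (fun n s => g s (Xn n s) 0 i)).
      by move=> n; exact: (bG n i).1.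
    move=> s sT; apply/cvgrPdist_le => eps eps0; near=> n.
    have := le_rV_norm (g s (X0 s) - g s (Xn n s)) i; rewrite !mxE => h.
    apply: (le_trans h); apply: (le_trans (GX n _ sT)).
    rewrite -[leLHS]ger0_norm ?divr_ge0 ?mulr_ge0 ?exprn_ge0 ?(ltW L0)//.
    near: n.
    have /cvgrPdist_le/(_ eps eps0) := cv0 (L * (2 * C)).
    by under eq_near do rewrite sub0r normrN.
  exists (M + L * (2 * C + `|x|)) => s sT.
  apply: (le_trans (le_rV_norm _ _)).
  rewrite -[g s (X0 s)](subrK (g s 0)) addrC (le_trans (ler_normD _ _))// lerD ?gM//.
  rewrite (le_trans (Lg _ sT _ _))// subr0 ler_wpM2l ?(ltW L0)//.
  rewrite -[X0 s](subrK x) (le_trans (ler_normD _ _))// lerD2r.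
  by have := XP 0%N s sT; rewrite /= expr0 divr1.
exists X0; split => // s sT; apply/eqP; rewrite -subr_eq0 -normr_le0.
set D := `|_|.
have Dn n : D <= (2 * C + L * (2 * C) * T) / 2 ^+ n.
  rewrite /D -[X0 s](subrK (Xn n.+1 s)) -addrA (le_trans (ler_normD _ _))// mulrDl lerD//.
    apply: (le_trans (XP _ _ sT)); rewrite ler_wpM2l ?mulr_ge0//.
    by rewrite lef_pV2 ?posrE ?exprn_gt0// ler_eXn2l// ltr1n.
  have -> : Xn n.+1 s - (x + vint tau s (fun r => g r (X0 r))) =
     vint tau s (fun r => g r (Xn n r) - g r (X0 r)).
    by rewrite (vintB (bG n) bX tT sT) /= opprD addrACA subrr add0r.
  rewrite mulrAC.
  apply: (le_trans (vint_bound (M := L * (2 * C) / 2 ^+ n) (vbmeasB (bG n) bX) tT sT _)).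
    by move=> r rT; rewrite distrC GX.
  rewrite ler_wpM2l ?divr_ge0 ?mulr_ge0 ?exprn_ge0 ?(ltW L0)//.
  by move: sT tT; rewrite !in_itv /= => /andP[? ?] /andP[? ?]; rewrite ler_norml; lra.
have cv := cv0 (2 * C + L * (2 * C) * T).
rewrite -(cvg_lim _ cv)//; apply: limr_ge.
  by apply/cvg_ex; eexists; exact: cv.
by apply: nearW.
Unshelve. all: by end_near. Qed.

End Picard.

(** * Differentials, and the hypotheses on the vector field *)

Section Differentials.
Context {R : realType} {V W : normedModType R}.
Implicit Types (h : V -> W) (x v : V).

(** Turns a claim on a neighbourhood into one on sequences, where dominated convergence and cluster
    points apply. One good index suffices, since a counterexample sequence would violate [P] at
    every index; [Q] keeps the sequence where bounds are available. *)
Lemma near_seq (Q P : set V) x : (\forall y \near x, Q y) ->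
  (forall y_ : nat -> V, y_ n @[n --> \oo] --> x -> (forall n, Q (y_ n)) ->
     exists n, P (y_ n)) ->
  \forall y \near x, P y.
Proof.
move=> Qx H; apply: contrapT => nP.
have /choice[y_ yP] (n : nat) : exists y, [/\ `|x - y| < n.+1%:R^-1, Q y & ~ P y].
  apply: contrapT => nex; apply: nP; have /nbhs_ballP[r r0 rQ] := Qx.
  apply/nbhs_ballP; exists (Num.min r n.+1%:R^-1).
    by rewrite /= lt_min; apply/andP; split; [exact: r0|rewrite invr_gt0 ltr0n].
  move=> y; rewrite -ball_normE /= lt_min => /andP[xr xn].
  apply: contrapT => nPy; apply: nex; exists y; split => //.
  by apply: rQ; rewrite -ball_normE.
have [||n Pn] := H y_; last by case: (yP n).
  apply/cvgrPdist_lt => e e0; near=> n.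
  apply: (@lt_trans _ _ n.+1%:R^-1); first by case: (yP n).
  by near: n; exact: (near_infty_natSinv_lt (PosNum e0)).
by move=> n; case: (yP n).
Unshelve. all: by end_near. Qed.

Lemma near_dist1 x : \forall y \near x, `|x - y| <= 1.
Proof. by near=> y; apply: ltW; near: y; exact: cvgr_dist_lt. Unshelve. all: by end_near. Qed.

Lemma near_norm1 x : \forall y \near x, `|y| <= `|x| + 1.
Proof.
apply: filterS (near_dist1 x) => y xy.
by rewrite -[y](subKr x) (le_trans (ler_normB _ _))// lerD2l.
Qed.

Lemma diff_eps h x : differentiable h x -> forall e, 0 < e -> exists2 delta, 0 < delta &
  forall k, `|k| < delta -> `|h (x + k) - h x - 'd h x k| <= e * `|k|.
Proof.
move=> /diff_locally /eqaddoP H e e0; have /nbhs_ballP[delta d0 dP] := H e e0.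
exists delta => // k kd; have := dP k.
rewrite -ball_normE /= sub0r normrN => /(_ kd).
by rewrite -[(_ - _) k]/(h (k + x) - (h x + 'd h x k)) opprD addrA [k + x]addrC.
Qed.

Lemma diff_cvg_seq h x v : differentiable h x ->
  n.+1%:R *: (h (x + n.+1%:R^-1 *: v) - h x) @[n --> \oo] --> 'd h x v.
Proof.
move=> dh; apply/cvgrPdist_le => e e0.
have v1 : 0 < `|v| + 1 by rewrite ltr_pwDr.
have [delta d0 dP] := diff_eps dh (divr_gt0 e0 v1).
near=> n; have n0 : 0 < n.+1%:R^-1 :> R by rewrite invr_gt0.
have nv : `|n.+1%:R^-1 *: v| = n.+1%:R^-1 * `|v| by rewrite normrZ gtr0_norm.
have nd : `|n.+1%:R^-1 *: v| < delta.
  rewrite nv; apply: (@le_lt_trans _ _ (n.+1%:R^-1 * (`|v| + 1))).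
    by rewrite ler_pM2l// lerDl.
  rewrite -ltr_pdivlMr//.
  by near: n; exact: (near_infty_natSinv_lt (PosNum (divr_gt0 d0 v1))).
have := dP _ nd; rewrite linearZ /= nv => H.
have -> : 'd h x v = n.+1%:R *: (n.+1%:R^-1 *: 'd h x v).
  by rewrite scalerA divff ?scale1r.
rewrite -scalerBr normrZ distrC ger0_norm// mulrC -ler_pdivlMr ?ltr0n//.
apply: (le_trans H); rewrite [leRHS]mulrC mulrCA ler_pM2l// -mulrA -[leRHS]mulr1 ler_pM2l//.
by rewrite ler_pdivrMl// mulr1 lerDl.
Unshelve. all: by end_near. Qed.

(** The bound on [dh] supplies the continuity required of a differential. *)
Lemma eps_diff h x (dh : V -> W) (K : R) : linear dh -> (forall k, `|dh k| <= K * `|k|) ->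
  (forall e, 0 < e -> exists2 delta, 0 < delta &
    forall k, `|k| < delta -> `|h (x + k) - h x - dh k| <= e * `|k|) ->
  differentiable h x /\ 'd h x = dh :> (V -> W).
Proof.
move=> ldh bdh H.
pose D : {linear V -> W} := HB.pack dh (GRing.isLinear.Build _ _ _ _ dh ldh).
have cD : continuous D.
  by apply: (@lipschitz_continuous _ _ _ _ K) => y z; rewrite -linearB; exact: bdh.
have E : h \o shift x = cst (h x) + D +o_ 0 id.
  apply/eqaddoP => e e0; have [delta d0 dP] := H e e0.
  apply/nbhs_ballP; exists delta => // k; rewrite -ball_normE /= sub0r normrN => kd.
  rewrite -[(_ - _) k]/(h (k + x) - (h x + dh k)) opprD addrA [k + x]addrC.
  exact: dP.
have dE := diff_unique cD E.
split; last by rewrite dE.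
by apply/diff_locallyP; rewrite dE.
Qed.

Lemma diff_lip h x v (L : R) : differentiable h x ->
  (\forall y \near x, `|h y - h x| <= L * `|y - x|) -> `|'d h x v| <= L * `|v|.
Proof.
move=> dh hL; apply/ler_addgt0Pl => e e0.
have [->|v0] := eqVneq v 0; first by rewrite linear0 !normr0 mulr0 addr0 ltW.
have vp : 0 < `|v| by rewrite normr_gt0.
have e1 : 0 < e / `|v| by rewrite divr_gt0.
have [delta d0 dP] := diff_eps dh e1.
have /nbhs_ballP[r r0 rP] := hL.
pose m := Num.min delta r.
have m0 : 0 < m by rewrite lt_min d0.
(* The increment [t *: v] has length [m / 2], within reach of both [delta] and [r]; linearity then
   scales the estimate back to [v]. *)
pose t := m / 2 / `|v|.
have t0 : 0 < t by rewrite !divr_gt0.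
have tv : `|t *: v| = m / 2 by rewrite normrZ gtr0_norm// /t divfK// gt_eqF.
have tvm : `|t *: v| < m by rewrite tv ltr_pdivrMr// mulr2n mulrDr mulr1 ltrDr.
have h1 : `|h (x + t *: v) - h x| <= L * `|t *: v|.
  have := rP (x + t *: v); rewrite -ball_normE /= opprD addrA subrr sub0r normrN.
  rewrite [x + _]addrC addrK; apply.
  by apply: (lt_le_trans tvm); rewrite ge_min lexx orbT.
have h2 : `|h (x + t *: v) - h x - 'd h x (t *: v)| <= e / `|v| * `|t *: v|.
  by apply: dP; apply: (lt_le_trans tvm); rewrite ge_min lexx.
have h3 : `|'d h x (t *: v)| <= L * `|t *: v| + e / `|v| * `|t *: v|.
  rewrite -[X in `|X|](subKr (h (x + t *: v) - h x)).
  by apply: (le_trans (ler_normB _ _)); rewrite lerD.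
have h4 : `|t *: v| = t * `|v| by rewrite normrZ gtr0_norm.
have h5 : `|'d h x (t *: v)| = t * `|'d h x v| by rewrite linearZ normrZ gtr0_norm.
rewrite h4 h5 in h3.
rewrite -(ler_pM2l t0); apply: (le_trans h3).
rewrite le_eqVlt; apply/orP; left; apply/eqP; field.
by rewrite gt_eqF.
Qed.

End Differentials.

(** * The hypotheses on the vector field in the maximum norm, and truncation of the state *)

Section Setup.
Context {R : realType} {d : nat} {U : metricType R}.
Implicit Types (x y : 'rV[R]_d) (f : 'rV[R]_d * U -> 'rV[R]_d) (T m : R).

Lemma le_enorm x : `|x| <= enorm x.
Proof.
apply: rV_norm_le => [|i]; first exact: sqrtr_ge0.
rewrite -sqrtr_sqr ler_sqrt; last by rewrite sumr_ge0// => j _; rewrite sqr_ge0.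
by rewrite (bigD1 i)//= lerDl sumr_ge0// => j _; rewrite sqr_ge0.
Qed.

Lemma enorm_le x : enorm x <= Num.sqrt d%:R * `|x|.
Proof.
rewrite -[`|x|]ger0_norm// -sqrtr_sqr -sqrtrM// ler_sqrt; last first.
  by rewrite mulr_ge0// sqr_ge0.
apply: (@le_trans _ _ (\sum_(i < d) `|x| ^+ 2)).
  apply: ler_sum => i _; rewrite -real_normK ?num_real//.
  by rewrite lerXn2r ?nnegrE// le_rV_norm.
by rewrite sumr_const card_ord -[leLHS]mulr_natl.
Qed.

Definition linear_growth m f := forall x u, `|f (x, u)| <= m * (1 + `|x|).

Definition locally_lipschitz f := forall r, exists2 L, 0 < L &
  forall x y u, `|x| <= r -> `|y| <= r -> `|f (x, u) - f (y, u)| <= L * `|x - y|.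

(** The Euclidean norm lies between the maximum norm and sqrt d times it, whence the factor
    [1 + K]. *)
Lemma enorm_linear_growth f :
  (exists2 m : R, 0 < m & forall x u, enorm (f (x, u)) <= m * (1 + enorm x)) ->
  exists2 m, 0 < m & linear_growth m f.
Proof.
move=> [m m0 fm]; set K : R := Num.sqrt d%:R.
have K0 : 0 <= K by exact: sqrtr_ge0.
exists (m * (1 + K)); first by rewrite mulr_gt0// ltr_pwDl.
move=> x u; apply: (le_trans (le_enorm _)); apply: (le_trans (fm x u)).
rewrite -mulrA ler_pM2l//.
have := enorm_le x; rewrite -/K => h.
by rewrite mulrDl mul1r mulrDr mulr1; have : 0 <= `|x| by []; lra.
Qed.

Lemma compact_ball_rV (r : R) : compact [set x : 'rV[R]_d | `|x| <= r].
Proof.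
apply: bounded_closed_compact.
  by exists r; split; [exact: num_real|move=> M rM x /= xr; exact: le_trans xr (ltW rM)].
rewrite (_ : [set x | _] = (fun x : 'rV[R]_d => `|x|) @^-1` [set t | t <= r])//.
apply: preimage_closed; solve [exact: closed_le|move=> ?; exact: norm_continuous|move=> ? ?; exact: norm_continuous].
Qed.

Lemma enorm_locally_lipschitz f :
  (forall K : set 'rV[R]_d, compact K -> exists2 l : R, 0 < l &
     forall x y u, K x -> K y -> enorm (f (x, u) - f (y, u)) <= l * enorm (x - y)) ->
  locally_lipschitz f.
Proof.
move=> fl r; have [l l0 lP] := fl _ (@compact_ball_rV r).
set K : R := Num.sqrt d%:R; have K0 : 0 <= K by exact: sqrtr_ge0.
exists (l * (K + 1)); first by rewrite mulr_gt0// ltr_pwDr.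
move=> x y u xr yr; apply: (le_trans (le_enorm _)); apply: (le_trans (lP _ _ u xr yr)).
rewrite -mulrA ler_pM2l//; apply: (le_trans (enorm_le _)).
by rewrite -/K ler_wpM2r// lerDl.
Qed.

(** Truncation onto the cube that is the closed ball of the maximum norm; being 1-Lipschitz, it
    turns a Lipschitz bound on that ball into a global one. *)
Definition clamp (r : R) x : 'rV[R]_d := \row_i Num.max (- r) (Num.min r (x 0 i)).

Lemma clamp_le r x : 0 <= r -> `|clamp r x| <= r.
Proof.
move=> r0; apply: rV_norm_le => // i; rewrite mxE ler_norml le_max lexx /=.
by rewrite ge_max ge_min lexx /= andbT; lra.
Qed.

Lemma clamp_id r x : `|x| <= r -> clamp r x = x.
Proof.
move=> xr; apply/rowP => i; rewrite mxE; have := le_trans (le_rV_norm x i) xr.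
by rewrite ler_norml => /andP[h1 h2]; rewrite (min_idPr h2) (max_idPr h1).
Qed.

Lemma clamp_lip r x y : `|clamp r x - clamp r y| <= `|x - y|.
Proof.
apply: rV_norm_le => // i; apply: le_trans (le_rV_norm _ i); rewrite !mxE.
set a := x 0 i; set b := y 0 i; rewrite /Num.max /Num.min.
case: (ltP r a) => ?; case: (ltP r b) => ?;
 do ?[case: (ltP (- r) _) => ?]; rewrite ler_norml; apply/andP; split; have := ler_norm (a - b); have := ler_norm (b - a); rewrite (distrC b a); lra.
Qed.

Lemma clamp_norm r x : 0 <= r -> `|clamp r x| <= `|x|.
Proof.
by move=> r0; have := clamp_lip r x 0; rewrite subr0 (@clamp_id r 0) ?normr0// subr0.
Qed.

End Setup.

(** * The controlled flow *)

Section Flow.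
Context {R : realType} {d : nat} {U : metricType R}.
Implicit Types (x y : 'rV[R]_d) (u : R -> U) (s t tau : R) (X Y : R -> 'rV[R]_d).
Context (T m : R) (f : 'rV[R]_d * U -> 'rV[R]_d).
Hypotheses (T0 : 0 < T) (m0 : 0 < m) (fc : continuous f).
Hypotheses (fg : linear_growth m f) (fl : locally_lipschitz f).

Definition ode u : R -> 'rV[R]_d -> 'rV[R]_d := fun s x => f (x, u s).

(** The Gronwall bound for [1 + |X|] when the initial point has norm at most [r]. It holds forwards
    and backwards in time and does not involve the control. *)
Definition growth (r : R) := 2 * (1 + r) * expR (2 * m * T).

Lemma in0T : 0 \in `[0, T]. Proof. by rewrite in_itv /= lexx ltW. Qed.

Lemma dist_in0T s t : s \in `[0, T] -> t \in `[0, T] -> `|s - t| <= T.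
Proof. by rewrite !in_itv /= => /andP[? ?] /andP[? ?]; rewrite ler_norml; lra. Qed.

Lemma measurable_control u x i : control T u ->
  measurable_fun (`[0, T]%classic : set (LT R)) (fun s => f (x, u s) 0 i).
Proof.
move=> cu mD; apply: (measurability _ (RGenOInfty.measurableE R)) => //.
move=> _ [_ [a ->] <-]; have oa : open [set v : U | f (x, v) 0 i \in `]a, +oo[].
  apply: (@open_comp _ _ (fun v : U => f (x, v) 0 i) `]a, +oo[%classic);
    last exact: interval_open.
  move=> v _; apply: (@continuous_comp _ _ _ (fun v : U => f (x, v)) (fun y => y 0 i));
    last exact: coord_continuous.
  apply: (@continuous_comp _ _ _ (fun v : U => (x, v)) f); last exact: fc.
  exact: (cvg_pair (cvg_cst x) cvg_id).
exact: cu oa.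
Qed.

Lemma growth_le r : 0 <= r -> r <= growth r.
Proof.
move=> r0; rewrite /growth.
have e1 : 1 <= expR (2 * m * T) by rewrite -expR0 ler_expR !mulr_ge0// ltW.
apply: (@le_trans _ _ (2 * (1 + r) * 1)); last by rewrite ler_wpM2l// mulr_ge0// addr_ge0.
by rewrite mulr1; lra.
Qed.

Lemma growth_mono r r' : r <= r' -> growth r <= growth r'.
Proof. by move=> rr; rewrite /growth ler_wpM2r ?expR_ge0// ler_wpM2l// lerD2l. Qed.

(** Gronwall is applied to [1 + |X|], for which affine growth becomes linear. The velocity [G] is
    left general so that the truncated field is covered too. *)
Lemma apriori_bound G tau x X : tau \in `[0, T] -> vbmeas T G ->
  {in `[0, T], forall s, X s = x + vint tau s G} ->
  {in `[0, T], forall s, `|G s| <= m * (1 + `|X s|)} ->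
  {in `[0, T], forall s, `|X s| <= growth `|x|}.
Proof.
move=> tT bG XG Gm s sT.
have bX := vbmeas_norm (lipT_vbmeas (vint_lipT bG tT XG)).
have b1 := bmeasD (integrable_bmeas_cst 1) bX.
have C0 : 0 <= 1 + `|x| by rewrite addr_ge0.
have H : {in `[0, T], forall r, 1 + `|X r| <= (1 + `|x|) +
    m * `|oriented_integral tau r (fun s => 1 + `|X s|)|}.
  move=> r rT; rewrite -addrA lerD2l XG// (le_trans (ler_normD _ _))// lerD2l.
  apply: (le_trans (vint_le bG (bmeasZ m b1) tT rT Gm)).
  by rewrite (oriZ m b1 tT rT) normrM gtr0_norm.
have := gronwall C0 m0 tT b1 H (fun r _ => addr_ge0 ler01 (normr_ge0 _)) sT.
rewrite /= => h; apply: (@le_trans _ _ (1 + `|X s|)); first by rewrite lerDr.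
apply: (le_trans h); rewrite ler_wpM2l ?mulr_ge0// ler_expR ler_wpM2l//.
  by rewrite mulr_ge0// ltW.
exact: dist_in0T.
Qed.

Lemma solution_bound u tau x X : tau \in `[0, T] ->
  solution T (ode u) tau x X -> {in `[0, T], forall s, `|X s| <= growth `|x|}.
Proof. by move=> tT [bG XG]; apply: (apriori_bound tT bG XG) => s _; exact: fg. Qed.

Lemma solution_exists u tau x : control T u -> tau \in `[0, T] ->
  exists X, solution T (ode u) tau x X.
Proof.
move=> cu tT; set r := growth `|x|.
have xr : `|x| <= r by exact: growth_le.
have r0 : 0 <= r by exact: le_trans xr.
have [L L0 fL] := fl r.
(* Clamping the state to the a priori ball makes the equation globally Lipschitz and does
   not change the solution. *)
pose g s y := f (clamp r y, u s).
have cg : caratheodory T L g.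
  split.
  - by move=> y i; exact: measurable_control.
  - move=> s _ y z; apply: (le_trans (fL _ _ _ (clamp_le _ r0) (clamp_le _ r0))).
    by rewrite ler_pM2l//; exact: clamp_lip.
  - exists (m * (1 + r)) => s _; apply: (le_trans (fg _ _)).
    by rewrite ler_pM2l// lerD2l clamp_le.
have [X [bG XG]] := picard x L0 cg tT.
have XB : {in `[0, T], forall s, `|X s| <= r}.
  apply: (apriori_bound tT bG XG) => s sT.
  apply: (le_trans (fg _ _)); rewrite ler_pM2l// lerD2l.
  exact: clamp_norm.
have Xc : {in `[0, T], forall s, g s (X s) = ode u s (X s)}.
  by move=> s sT; rewrite /g clamp_id// XB.
exists X; split.
  by move=> i; apply: eq_bmeas (bG i) => s sT; rewrite Xc.
by move=> s sT; rewrite (XG _ sT); congr (_ + _); apply: (eq_vint tT sT).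
Qed.

Lemma solution_shift g tau sigma x X : tau \in `[0, T] -> sigma \in `[0, T] ->
  solution T g tau x X -> solution T g sigma (X sigma) X.
Proof.
move=> tT oT [bG XG]; split; [exact: bG|move=> s sT].
by rewrite (XG _ sT) (XG _ oT) (vint_chasles bG tT oT sT) addrA.
Qed.

(** All trajectories issued from the ball of radius [r] stay in the ball of radius [growth r], where
    the Lipschitz constant of f is the same for every control value; hence [C] precedes [u]. *)
Lemma solution_lip r : exists2 C, 0 <= C & forall u tau x y X Y,
  tau \in `[0, T] -> `|x| <= r -> `|y| <= r ->
  solution T (ode u) tau x X -> solution T (ode u) tau y Y ->
  {in `[0, T], forall s, `|X s - Y s| <= C * `|x - y|}.
Proof.
have [L L0 fL] := fl (growth r).
exists (2 * expR (2 * L * T)); first by rewrite mulr_ge0// expR_ge0.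
move=> u tau x y X Y tT xr yr sX sY s sT.
have b0 := @integrable_bmeas_cst R T 0.
have := vint_stable L0 tT sX.1 sY.1 b0 (fun _ _ => lexx _) sX.2 sY.2.
rewrite ori_cst mul0r addr0 mulrAC; apply => // t t01.
rewrite add0r; apply: fL.
  by apply: (le_trans (solution_bound tT sX t01)); exact: growth_mono.
by apply: (le_trans (solution_bound tT sY t01)); exact: growth_mono.
Qed.

Lemma solution_unique u tau x X Y : tau \in `[0, T] ->
  solution T (ode u) tau x X -> solution T (ode u) tau x Y ->
  {in `[0, T], X =1 Y}.
Proof.
move=> tT sX sY s sT; have [C C0 CP] := solution_lip `|x|.
have := CP u tau x x X Y tT (lexx _) (lexx _) sX sY s sT.
by rewrite subrr normr0 mulr0 normr_le0 subr_eq0 => /eqP.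
Qed.

(* [is_flow] only provides integrability of the velocity; this bounds the trajectory, and
   then linear growth bounds the velocity. *)
Lemma flow_solution u Phi tau x : is_flow T f u Phi -> tau \in `[0, T] ->
  solution T (ode u) tau x (fun s => Phi tau s x).
Proof.
move=> fP tT.
have TT : T \in `[0, T] by rewrite in_itv /= lexx ltW.
pose F i s := f (Phi tau s x, u s) 0 i.
have iF i : (@completed_lebesgue_measure R).-integrable `[0, T] (EFin \o F i).
  by have [_ /(_ x i)[]] := fP tau T tT TT.
have mF i : measurable_fun (`[0, T]%classic : set (LT R)) (F i).
  by have /integrableP[/measurable_EFinP] := iF i.
pose N i := \int[lam R]_(s in `[0, T]) `|F i s|.
have FN i a b : a \in `[0, T] -> b \in `[0, T] -> `|\int[lam R]_(s in `[a, b]) F i s| <= N i.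
  move=> aT bT; have mI := @lam_measurable_itv R.
  have sub := sub_itv0T aT bT.
  have iab : (lam R).-integrable `[a, b] (EFin \o F i).
    exact: (integrableS (mI _) (mI _) sub (iF i)).
  apply: (le_trans (le_normr_Rintegral (mI _) iab)).
  rewrite /N /Rintegral fine_le//.
  - apply: integrable_fin_num => //; exact: (integrable_norm iab).
  - apply: integrable_fin_num => //; exact: (integrable_norm (iF i)).
  - apply: ge0_subset_integral => //.
    by have /integrableP[] := integrable_norm (iF i).
have PB s : s \in `[0, T] -> `|Phi tau s x| <= `|x| + \sum_i N i.
  have N0 i : 0 <= N i by apply: Rintegral_ge0.
  move=> sT; apply: rV_norm_le => [|i]; first by rewrite addr_ge0// sumr_ge0.
  have [_ /(_ x i)[_ ->]] := fP tau s tT sT.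
  rewrite (le_trans (ler_normD _ _))// lerD ?le_rV_norm//.
  apply: (@le_trans _ _ (N i)); last by rewrite (bigD1 i)//= lerDl sumr_ge0.
  by rewrite /oriented_integral; case: (leP tau s) => _; rewrite ?normrN FN.
split.
  move=> i; split; first exact: mF.
  exists (m * (1 + (`|x| + \sum_i N i))) => s sT.
  apply: (le_trans (le_rV_norm _ _)); apply: (le_trans (fg _ _)).
  by rewrite ler_pM2l// lerD2l PB.
by move=> s sT; apply/rowP => i; rewrite !mxE; have [_ /(_ x i)[_ ->]] := fP tau s tT sT.
Qed.

Lemma flow_exists u : control T u -> exists Phi, is_flow T f u Phi.
Proof.
move=> cu.
have H (tx : R * 'rV[R]_d) : exists X, tx.1 \in `[0, T] -> solution T (ode u) tx.1 tx.2 X.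
  have [tT|_] := boolP (tx.1 \in `[0, T]); last by exists (fun=> 0).
  by have [X XP] := solution_exists tx.2 cu tT; exists X.
have [F FP] := choice H.
exists (fun tau s x => F (tau, x) s) => tau t tT sT.
have TT : T \in `[0, T] by rewrite in_itv /= lexx ltW.
split.
  move=> x; apply/(@cvgrPdist_lt _ _ _ _ (nbhs_filter (x : 'rV[R]_d))) => e e0.
  have [C C0 CP] := solution_lip (`|x| + 1).
  have C1 : 0 < C + 1 by rewrite ltr_pwDr.
  near=> y.
  have xy : `|x - y| <= 1.
    by apply: ltW; near: y; exact: (@cvgr_dist_lt _ _ _ (nbhs (x : 'rV[R]_d)) _ id x).
  have yx : `|y| <= `|x| + 1.
    by rewrite -[y](subKr x) (le_trans (ler_normB _ _))// lerD2l.
  have xx : `|x| <= `|x| + 1 by rewrite lerDl.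
  have := CP u tau x y _ _ tT xx yx (FP (tau, x) tT) (FP (tau, y) tT) t sT.
  move=> h; apply: (le_lt_trans h).
  apply: (@le_lt_trans _ _ ((C + 1) * `|x - y|)); first by rewrite ler_wpM2r// lerDl.
  rewrite mulrC -ltr_pdivlMr//.
  near: y; apply: (@cvgr_dist_lt _ _ _ (nbhs (x : 'rV[R]_d)) _ id x) => //.
  by rewrite divr_gt0.
move=> x i; have [bG XG] := FP (tau, x) tT; split.
  exact: (bmeas_integrable (bG i) in0T TT).
by rewrite XG// !mxE.
Unshelve. all: by end_near. Qed.

(** Both sides are trajectories through the same point at time [sigma], so uniqueness applies. The
    three times come in any order, which also yields inverses. *)
Lemma flow_semigroup u Phi tau sigma t x : is_flow T f u Phi ->
  tau \in `[0, T] -> sigma \in `[0, T] -> t \in `[0, T] ->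
  Phi sigma t (Phi tau sigma x) = Phi tau t x.
Proof.
move=> fP tT oT t01; apply/esym.
have sX := flow_solution x fP tT.
exact: (solution_unique oT (solution_shift tT oT sX) (flow_solution (Phi tau sigma x) fP oT) t01).
Qed.

Lemma flow_id u Phi tau x : is_flow T f u Phi -> tau \in `[0, T] -> Phi tau tau x = x.
Proof.
move=> fP tT; have [bG XG] := flow_solution x fP tT.
by rewrite (XG _ tT) (vint_self bG tT) addr0.
Qed.

Lemma flow_bound u Phi tau s x : is_flow T f u Phi -> tau \in `[0, T] -> s \in `[0, T] ->
  `|Phi tau s x| <= growth `|x|.
Proof. by move=> fP tT; exact: (solution_bound tT (flow_solution x fP tT)). Qed.

End Flow.

(** * The flow is continuously differentiable *)

Section FlowDiff.
Context {R : realType} {d : nat} {U : metricType R}.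
Implicit Types (x y v : 'rV[R]_d) (s t tau : R) (X Y : R -> 'rV[R]_d).
Context (T m : R) (f : 'rV[R]_d * U -> 'rV[R]_d).
Hypotheses (T0 : 0 < T) (m0 : 0 < m) (fc : continuous f).
Hypotheses (fg : linear_growth m f) (fl : locally_lipschitz f).
Hypothesis fC1 : forall w : U, C1 (fun x => f (x, w)).
Context (u : R -> U) (cu : control T u).

Let A s x v := 'd (fun y => f (y, u s)) x v.

Let fD s x : differentiable (fun y => f (y, u s)) x.
Proof. by have [] := fC1 (u s). Qed.

Let AB s x v w : A s x (v - w) = A s x v - A s x w.
Proof. exact: linearB. Qed.

(** Compactness of the control set is of no help here, the differential being continuous in x only;
    the bound uniform in [s] comes from the Lipschitz constant on a slightly larger ball. *)
Let A_bound r : exists2 L, 0 < L & forall s x v, `|x| <= r -> `|A s x v| <= L * `|v|.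
Proof.
have [L L0 fL] := fl (r + 1); exists L => // s x v xr.
apply: (diff_lip v (fD s x)); apply: filterS (near_norm1 x) => y yx.
apply: fL; last by rewrite (le_trans xr)// lerDl.
by rewrite (le_trans yx)// lerD2r.
Qed.

(** A limit of difference quotients of [f], each measurable in [s]; no regularity of the
    differential in the control is involved. *)
Let A_meas x v i : measurable_fun (`[0, T]%classic : set (LT R)) (fun s => A s x v 0 i).
Proof.
apply: (@measurable_fun_cvg _ (LT R) R _
  (fun n s => n.+1%:R * (f (x + n.+1%:R^-1 *: v, u s) 0 i - f (x, u s) 0 i))).
  move=> n; apply: measurable_funM; first exact: measurable_cst.
  by apply: measurable_funB; exact: measurable_control.
move=> s sT.
have := @diff_cvg_seq _ _ _ _ _ v (fD s x).
move=> H; have := @cvg_comp _ _ _ _ _ _ _ _ H (@coord_continuous R 1 d 0 i _); apply: cvg_trans; apply: near_eq_cvg.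
by apply: nearW => n /=; rewrite !mxE.
Qed.

Let A_carath X : lipT T X -> exists2 L, 0 < L & caratheodory T L (fun s y => A s (X s) y).
Proof.
move=> lX; have [M XM] := lipT_bound lX; have [L L0 AL] := A_bound M.
exists L; [exact: L0|split].
- move=> y i.
  apply: (@measurable_carath _ _ _ (fun s x => A s x y 0 i) X _ _ lX).
    by move=> x; exact: A_meas.
  move=> s _ x; apply: (@continuous_comp _ _ _ (fun x => A s x y) (fun y => y 0 i));
    last exact: coord_continuous.
  by have [_ cA] := fC1 (u s); exact: cA.
- by move=> s sT y z; rewrite /A -linearB; apply: AL; exact: XM.
- by exists 0 => s _; rewrite /A linear0 normr0.
Qed.

Variable Phi : R -> R -> 'rV[R]_d -> 'rV[R]_d.
Hypothesis fP : is_flow T f u Phi.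
Variables (tau t : R).
Hypotheses (tT : tau \in `[0, T]) (t01 : t \in `[0, T]).

Let F := Phi tau t.
Let sol x : solution T (ode f u) tau x (fun s => Phi tau s x).
Proof. exact: (flow_solution T0 m0 fg x fP tT). Qed.
Let solL x : lipT T (fun s => Phi tau s x).
Proof. exact: (solution_lipT tT (sol x)). Qed.

Let variational x v : exists w, solution T (fun s y => A s (Phi tau s x) y) tau v w.
Proof. by have [L L0 cL] := A_carath (solL x); exact: (picard v L0 cL tT). Qed.

Let mainW : exists W : 'rV[R]_d -> 'rV[R]_d -> R -> 'rV[R]_d, forall x v,
  solution T (fun s y => A s (Phi tau s x) y) tau v (W x v).
Proof.
have /choice[W WP] := fun xv : 'rV[R]_d * 'rV[R]_d => variational xv.1 xv.2.
by exists (fun x v => W (x, v)) => x v; exact: (WP (x, v)).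
Qed.

(** The candidate differential in the direction v is the variational solution [W x v t]. Its
    linearity and boundedness, the remainder estimate and its continuity in x are four comparisons
    by [vint_stable], the first two with error 0. *)
Lemma flow_C1 : C1 (Phi tau t).
Proof.
have [W WP] := mainW.
have Wlip x v : lipT T (W x v) by exact: (solution_lipT tT (WP x v)).
have T01 : 0 \in `[0, T] := in0T T0.
have TT : T \in `[0, T] by rewrite in_itv /= lexx ltW.
have PB r x s : `|x| <= r -> s \in `[0, T] -> `|Phi tau s x| <= growth T m r.
  move=> xr sT; apply: (le_trans (flow_bound T0 m0 fg x fP tT sT)).
  exact: growth_mono.
have Wlin x : linear (fun v => W x v t).
  move=> k v w; have [L L0 cL] := A_carath (solL x); have [_ AL _] := cL.
  have b0 := @integrable_bmeas_cst R T 0.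
  have [bv Ev] := WP x v; have [bw Ew] := WP x w.
  have [bkw Ekw] := WP x (k *: v + w).
  have Ez : {in `[0, T], forall s, k *: W x v s + W x w s = (k *: v + w) +
      vint tau s (fun r => k *: A r (Phi tau r x) (W x v r) + A r (Phi tau r x) (W x w r))}.
    move=> s sT; rewrite (vintP k bv bw tT sT) (Ev _ sT) (Ew _ sT).
    by rewrite scalerDr addrACA.
  have := vint_stable L0 tT bkw (vbmeasP k bv bw) b0 (fun _ _ => lexx _) Ekw Ez.
  rewrite subrr normr0 ori_cst mul0r addr0 mulr0 mul0r => /(_ _ t t01).
  rewrite normr_le0 subr_eq0 => H; apply/eqP; apply: H => s sT.
  by rewrite add0r -linearP; exact: AL.
have Wbound x : exists K, forall v, `|W x v t| <= K * `|v|.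
  have [L L0 cL] := A_carath (solL x); have [_ AL _] := cL.
  exists (2 * expR (2 * L * T)) => v.
  have b0 := @integrable_bmeas_cst R T 0.
  have [bv Ev] := WP x v.
  have E0 : {in `[0, T], forall s, (fun=> 0) s = 0 + vint tau s (fun=> 0) :> 'rV[R]_d}.
    by move=> s sT; rewrite vint0 addr0.
  have := vint_stable L0 tT bv (@vbmeas0 R d T) b0 (fun _ _ => lexx _) Ev E0.
  rewrite !subr0 ori_cst mul0r addr0 => /(_ _ t t01).
  rewrite mulrAC subr0; apply=> s sT; rewrite add0r !subr0.
  by have := AL s sT (W x v s) 0; rewrite /A linear0 !subr0.
(* G k is the linearisation error along the trajectory; divided by |k| it tends to 0
   pointwise and boundedly, so its integral is o(|k|). *)
have main x : differentiable F x /\ 'd F x = (fun v => W x v t) :> ('rV[R]_d -> 'rV[R]_d).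
  have [K WK] := Wbound x.
  apply: (eps_diff (Wlin x) WK) => e e0.
  have [C C0 CP] := solution_lip T m0 fg fl (`|x| + 1).
  have [L L0 cL] := A_carath (solL x); have [_ AL _] := cL.
  have [L' L'0 fL] := fl (growth T m (`|x| + 1)).
  pose j k s := Phi tau s (x + k) - Phi tau s x.
  pose G k s := f (Phi tau s (x + k), u s) - f (Phi tau s x, u s) - A s (Phi tau s x) (j k s).
  have bj k : lipT T (j k).
    have [c1 c10 H1] := solL (x + k); have [c2 c20 H2] := solL x.
    exists (c1 + c2); first exact: addr_ge0.
    move=> a b aT bT; rewrite /j opprD addrACA -opprD (le_trans (ler_normB _ _))//.
    by rewrite mulrDl lerD// ?H1// H2.
  have bA k := carath_vbmeas (ltW L0) cL (bj k).
  have bG k : vbmeas T (G k).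
    by apply: vbmeasB (bA k); apply: vbmeasB; [exact: (sol (x + k)).1|exact: (sol x).1].
  have bnG k := vbmeas_norm (bG k).
  set E := expR (2 * L * T); have E0 : 0 < E by exact: expR_gt0.
  have est k : `|F (x + k) - F x - W x k t| <= 2 * oriented_integral 0 T (fun s => `|G k s|) * E.
    have [bk Ek] := WP x k.
    have bz : vbmeas T (fun r => (f (Phi tau r (x + k), u r) - f (Phi tau r x, u r))
        - A r (Phi tau r x) (W x k r)).
      by apply: vbmeasB bk; apply: vbmeasB; [exact: (sol (x + k)).1|exact: (sol x).1].
    have Ez : {in `[0, T], forall s, Phi tau s (x + k) - Phi tau s x - W x k s = 0 +
        vint tau s (fun r => (f (Phi tau r (x + k), u r) - f (Phi tau r x, u r))
        - A r (Phi tau r x) (W x k r))}.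
      move=> s sT.
      have b1 : vbmeas T (fun r => f (Phi tau r (x + k), u r) - f (Phi tau r x, u r)).
        by apply: vbmeasB; [exact: (sol (x + k)).1|exact: (sol x).1].
      rewrite (vintB b1 bk tT sT) (vintB (sol (x + k)).1 (sol x).1 tT sT) add0r.
      rewrite ((sol (x + k)).2 _ sT) ((sol x).2 _ sT) (Ek _ sT).
      by apply/rowP => i; rewrite !mxE; ring.
    have E0' : {in `[0, T], forall s, (fun=> 0) s = 0 + vint tau s (fun=> 0) :> 'rV[R]_d}.
      by move=> s sT; rewrite vint0 addr0.
    have := vint_stable L0 tT bz (@vbmeas0 R d T) (bnG k) (fun _ _ => normr_ge0 _) Ez E0'.
    rewrite subr0 normr0 add0r => /(_ _ t t01); rewrite subr0; apply => s sT.
    rewrite !subr0.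
    set g1 := f _ - f _.
    have -> : g1 - A s (Phi tau s x) (W x k s) = G k s + A s (Phi tau s x) (j k s - W x k s).
      by rewrite /G -/g1 AB addrA subrK.
    rewrite (le_trans (ler_normD _ _))// lerD2l.
    by have := AL s sT (j k s - W x k s) 0; rewrite /A linear0 !subr0.
  suff : \forall k \near (0 : 'rV[R]_d), `|F (x + k) - F x - W x k t| <= e * `|k|.
    move=> /nbhs_ballP[delta d0 dP]; exists delta => // k kd; apply: dP.
    by rewrite -ball_normE /= sub0r normrN.
  (* Dominated convergence needs sequences; [|k| <= 1] keeps the perturbed initial points in the
     ball of radius [|x| + 1], so that the constants chosen above apply. *)
  apply: (@near_seq _ _ (fun k => `|k| <= 1)).
    by apply: filterS (near_dist1 0) => k; rewrite sub0r normrN.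
  move=> k_ k0 k1.
  have jC n s : s \in `[0, T] -> `|j (k_ n) s| <= C * `|k_ n|.
    move=> sT; have xk : `|x + k_ n| <= `|x| + 1.
      by rewrite (le_trans (ler_normD _ _))// lerD2l.
    have := CP u tau (x + k_ n) x _ _ tT xk _ (sol _) (sol _) s sT.
    by rewrite addrAC subrr add0r; apply; rewrite lerDl.
  have Gle n s : s \in `[0, T] -> `|G (k_ n) s| <= (L' + L) * (C * `|k_ n|).
    move=> sT; apply: (le_trans (ler_normB _ _)); rewrite mulrDl lerD//.
      apply: (@le_trans _ _ (L' * `|j (k_ n) s|)); last by rewrite ler_pM2l// jC.
      apply: fL; apply: PB => //; last by rewrite lerDl.
      by rewrite (le_trans (ler_normD _ _))// lerD2l.
    apply: (@le_trans _ _ (L * `|j (k_ n) s|)); last by rewrite ler_pM2l// jC.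
    by have := AL s sT (j (k_ n) s) 0; rewrite /A linear0 !subr0.
  have H : oriented_integral 0 T (fun s => `|k_ n|^-1 * `|G (k_ n) s|) @[n --> \oo] -->
      oriented_integral 0 T (fun=> 0).
    apply: (@ori_dct _ T _ _ ((L' + L) * C) 0 T _ T01 TT).
    - by move=> n; exact: (bmeasZ _ (bnG _)).
    - move=> n s sT; rewrite normrM normr_id ger0_norm ?invr_ge0//.
      (* At [k_ n = 0] the inverse is 0, so the normalised error is 0 there. *)
      have [->|kn0] := eqVneq (k_ n) 0.
        by rewrite normr0 invr0 mul0r mulr_ge0// addr_ge0// ltW.
      rewrite mulrC ler_pdivrMr ?normr_gt0// -mulrA; exact: Gle.
    - move=> s sT; apply/cvgrPdist_le => eps eps0.
      have C1 : 0 < C + 1 by rewrite ltr_pwDr.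
      have [delta d0 dP] := diff_eps (fD s (Phi tau s x)) (divr_gt0 eps0 C1).
      near=> n; rewrite sub0r normrN normrM normr_id ger0_norm ?invr_ge0//.
      have [->|kn0] := eqVneq (k_ n) 0; first by rewrite normr0 invr0 mul0r ltW.
      rewrite mulrC ler_pdivrMr ?normr_gt0//.
      have jd : `|j (k_ n) s| < delta.
        apply: (le_lt_trans (jC _ _ sT)).
        apply: (@le_lt_trans _ _ ((C + 1) * `|k_ n|)); first by rewrite ler_wpM2r// lerDl.
        rewrite mulrC -ltr_pdivlMr// -[k_ n]subr0 distrC.
        by near: n; apply: cvgr_dist_lt => //; rewrite divr_gt0.
      have := dP _ jd; rewrite {1}/j [Phi tau s x + _]addrC subrK => h; apply: (le_trans h).
      rewrite -mulrA ler_pM2l// ler_pdivrMl//; apply: (le_trans (jC _ _ sT)).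
      by rewrite ler_wpM2r// lerDl.
  have e1 : 0 < e / (2 * E) by rewrite divr_gt0// mulr_gt0.
  rewrite ori_cst mul0r in H.
  have /cvgrPdist_le/(_ _ e1)[N _ /(_ N (leqnn _))] := H.
  rewrite /= sub0r normrN (oriZ _ (bnG _) T01 TT) => h; exists N.
  have [k00|kn0] := eqVneq (k_ N) 0.
    have := WK (k_ N); rewrite k00 addr0 subrr sub0r normrN normr0 mulr0 => h2.
    by rewrite mulr0.
  apply: (le_trans (est _)).
  have := le_trans (ler_norm _) h; rewrite mulrC ler_pdivrMr ?normr_gt0// => h3.
  rewrite mulrAC -ler_pdivlMl ?mulr_gt0//; apply: (le_trans h3).
  by rewrite mulrA [_^-1 * _]mulrC.
split; first by move=> x; have [] := main x.
move=> v.
rewrite (_ : (fun x => 'd (Phi tau t) x v) = (fun x => W x v t)); last first.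
  by apply/funext => x; have [_ ->] := main x.
move=> x; apply/(@cvgrPdist_le _ _ _ _ (nbhs_filter (x : 'rV[R]_d))) => e e0.
have [C C0 CP] := solution_lip T m0 fg fl (`|x| + 1).
have [L L0 AL] := A_bound (growth T m (`|x| + 1)).
(* The same solution [W x v] enters both terms, so [G y] records only the change of coefficient; the
   difference of the two solutions goes into the Lipschitz term. *)
pose G y s := A s (Phi tau s x) (W x v s) - A s (Phi tau s y) (W x v s).
have bG y : vbmeas T (G y).
  apply: vbmeasB; first exact: (WP x v).1.
  by have [L' L'0 cL'] := A_carath (solL y); exact: (carath_vbmeas (ltW L'0) cL' (Wlip x v)).
have bnG y := vbmeas_norm (bG y).
set E := expR (2 * L * T); have E0 : 0 < E by exact: expR_gt0.
have est y : `|y| <= `|x| + 1 ->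
    `|W x v t - W y v t| <= 2 * oriented_integral 0 T (fun s => `|G y s|) * E.
  move=> yx; have [bx Ex] := WP x v; have [b_y Ey] := WP y v.
  have := vint_stable L0 tT bx b_y (bnG y) (fun _ _ => normr_ge0 _) Ex Ey.
  rewrite subrr normr0 add0r => /(_ _ t t01); apply => s sT.
  have -> : A s (Phi tau s x) (W x v s) - A s (Phi tau s y) (W y v s) =
     G y s + A s (Phi tau s y) (W x v s - W y v s).
    by rewrite /G AB addrA subrK.
  rewrite (le_trans (ler_normD _ _))// lerD2l.
  by apply: AL; apply: PB.
apply: (@near_seq _ _ (fun y => `|y| <= `|x| + 1)); first exact: near_norm1.
move=> y_ yx y1.
have [MW WM] := lipT_bound (Wlip x v).
have H : oriented_integral 0 T (fun s => `|G (y_ n) s|) @[n --> \oo] -->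
    oriented_integral 0 T (fun=> 0).
  apply: (@ori_dct _ T _ _ (L * MW + L * MW) 0 T (fun n => bnG (y_ n)) T01 TT).
  - move=> n s sT; rewrite normr_id (le_trans (ler_normB _ _))//.
    rewrite lerD//; apply: (@le_trans _ _ (L * `|W x v s|)).
    + by apply: AL; apply: PB => //; rewrite lerDl.
    + by rewrite ler_pM2l// WM.
    + by apply: AL; apply: PB.
    + by rewrite ler_pM2l// WM.
  - move=> s sT; apply/cvgrPdist_lt => eps eps0.
    have cA : {for Phi tau s x, continuous (fun z => A s z (W x v s))}.
      by have [_ cA] := fC1 (u s); exact: cA.
    have cP : Phi tau s (y_ n) @[n --> \oo] --> Phi tau s x.
      have [cF _] := fP tT sT.
      exact: (@cvg_comp _ _ _ y_ (Phi tau s) _ _ _ yx (cF x)).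
    have := @cvg_comp _ _ _ (fun n => Phi tau s (y_ n)) (fun z => A s z (W x v s)) _ _ _ cP cA.
    move=> /cvgrPdist_lt/(_ eps eps0); apply: filterS => n /=.
    by rewrite sub0r normrN normr_id.
rewrite ori_cst mul0r in H.
have e1 : 0 < e / (2 * E) by rewrite divr_gt0// mulr_gt0.
have /cvgrPdist_le/(_ _ e1)[N _ /(_ N (leqnn _))] := H.
rewrite /= sub0r normrN => h; exists N.
apply: (le_trans (est _ (y1 N))); rewrite mulrAC -ler_pdivlMl ?mulr_gt0//.
by apply: (le_trans (ler_norm _)); apply: (le_trans h); rewrite mulrC.
Unshelve. all: by end_near. Qed.

End FlowDiff.

(** * Absolutely continuous functions with zero derivative *)

Section ZeroDerivative.
Context {R : realType}.
Implicit Types (g : R -> R) (a b s t : R).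

Lemma lam_null_open (N : set (LT R)) (e : R) : 0 < e -> (lam R).-negligible N ->
  exists G : set R, [/\ open G, N `<=` G & (lebesgue_measure G < e%:E)%E].
Proof.
move=> e0 [A [mA A0 NA]].
have [B [mB BA nB]] := lam_measurable_borel (measurableC mA).
have mBl : measurable (B : set (LT R)) by exact: sub_caratheodory.
have B0 : lebesgue_measure (~` B) = 0%E.
  rewrite -[LHS]/(lam R (~` B)).
  have /negligibleP <- : measurable (~` B : set (LT R)) by exact: measurableC.
  apply: (@negligibleS _ _ _ (lam R) (A `|` (~` A `\` B))).
    by move=> x nBx; have [|] := pselect (A x); [left|right].
  apply: negligibleU nB; exact/negligibleP.
have mCB : measurable (~` B) by exact: measurableC.
have [|G [oG BG Ge]] := lebesgue_regularity_outer mCB _ e0.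
  by rewrite [X in (X < _)%E]B0 ltry.
exists G; split => //.
  by move=> x /NA Ax; apply: BG => Bx; exact: (BA x Bx).
have mG : measurable G by exact: open_measurable.
rewrite (_ : G = ~` B `|` (G `\` ~` B)); last by rewrite setDUK.
rewrite measureU//; first by rewrite [X in (X + _)%E]B0 add0e.
- exact: measurableD.
- by rewrite setDIK.
Qed.

Definition abs_cont (T : R) g := forall e : R, 0 < e -> exists2 delta : R, 0 < delta &
  forall (n : nat) (a b : 'I_n -> R),
    (forall i, [/\ 0 <= a i, a i <= b i & b i <= T]) ->
    trivIset [set: 'I_n] (fun i => `]a i, b i[%classic) ->
    \sum_(i < n) (b i - a i) < delta ->
    \sum_(i < n) `|g (b i) - g (a i)| < e.

(* The witnessing list collects the subintervals of [a, b] on which only absolute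
   continuity is available; they all lie in G. *)
Let covered g (G : set R) (e a b : R) := exists l : seq (R * R),
  [/\ forall p, p \in l -> [/\ a <= p.1, p.1 <= p.2 & p.2 <= b],
      pairwise (fun p q : R * R => p.2 <= q.1) l,
      ((\sum_(p <- l) (p.2 - p.1))%:E <= lebesgue_measure (G `&` `]a, b]%classic))%E &
      `|g b - g a| <= e * (b - a) + \sum_(p <- l) `|g p.2 - g p.1|].

(** The two lists are concatenated. Half-open intervals make the two traces on [G] disjoint, so that
    their measures add up. *)
Let covered_trans g G e a b c : open G -> a <= b -> b <= c ->
  covered g G e a b -> covered g G e b c -> covered g G e a c.
Proof.
move=> oG ab bc [l [l1 l2 l3 l4]] [k [k1 k2 k3 k4]]; exists (l ++ k); split.
- move=> p; rewrite mem_cat => /orP[/l1[? ? pb]|/k1[bp ? ?]]; split => //.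
    exact: le_trans pb bc.
  exact: le_trans ab bp.
- rewrite pairwise_cat l2 k2 !andbT; apply/allrelP => p q /l1[_ _ pb] /k1[bq _ _].
  exact: le_trans pb bq.
- rewrite big_cat /= EFinD.
  have -> : `]a, c]%classic = `]a, b]%classic `|` `]b, c]%classic.
    by apply: itv_bndbnd_setU; rewrite bnd_simp.
  rewrite setIUr measureU; first exact: leeD.
  + by apply: measurableI => //; exact: open_measurable.
  + by apply: measurableI => //; exact: open_measurable.
  + apply/seteqP; split => // x [[_ /=]]; rewrite in_itv /= => /andP[_ xb] [_ /=].
    by rewrite in_itv /= ltNge xb.
- rewrite big_cat /=.
  have -> : g c - g a = (g b - g a) + (g c - g b) by ring.
  apply: (le_trans (ler_normD _ _)); apply: (le_trans (lerD l4 k4)).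
  by rewrite le_eqVlt; apply/orP; left; apply/eqP; ring.
Qed.

(** The supremum of the s with [P 0 s] satisfies [P] by the local hypothesis at that point, and the
    same hypothesis would push it further if it were below [T]. *)
Let cousin (P : R -> R -> Prop) (T : R) : 0 <= T ->
  (forall a b c, a <= b -> b <= c -> P a b -> P b c -> P a c) ->
  (forall s, 0 <= s <= T -> exists2 r, 0 < r & forall a b,
     0 <= a -> a <= s -> s <= b -> b <= T -> s - r < a -> b < s + r -> P a b) ->
  P 0 T.
Proof.
move=> T0 Ptr Ploc.
pose S := [set s | 0 <= s <= T /\ P 0 s].
have S0 : S 0.
  split; first by rewrite lexx.
  have [r r0 rP] := Ploc 0 ltac:(by rewrite lexx).
  by apply: rP => //; lra.
have hS : has_sup S.
  by split; [exists 0|exists T => s [/andP[]]].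
set c := sup S.
have cT : 0 <= c <= T.
  apply/andP; split; first by apply: ub_le_sup => //; case: hS.
  by apply: ge_sup; [exists 0|move=> s [/andP[]]].
have [r r0 rP] := Ploc c cT; have /andP[c0 c1] := cT.
have [s [/andP[s0 s1] Ps] cs] := sup_adherent r0 hS.
have sc : s <= c by apply: ub_le_sup; [case: hS|split => //; rewrite s0].
have P0b b : c <= b -> b <= T -> b < c + r -> P 0 b.
  by move=> cb bT br; apply: (Ptr 0 s b) => //; [exact: le_trans cb|apply: rP].
have [cltT|Tc] := ltP c T; last first.
  have <- : c = T by apply/eqP; rewrite eq_le c1.
  by apply: P0b => //; rewrite ltrDl.
pose b := Num.min T (c + r / 2).
have b1 : b <= T by rewrite ge_min lexx.
have b2 : b <= c + r / 2 by rewrite ge_min lexx orbT.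
have b3 : c < b by rewrite lt_min cltT /= ltrDl divr_gt0.
have : b <= c.
  apply: ub_le_sup; first by case: hS.
  split; first by rewrite b1 (le_trans c0 (ltW b3)).
  by apply: P0b => //; [exact: ltW|lra].
by rewrite leNgt b3.
Qed.

(** Around a point where the derivative vanishes, short intervals contribute at most e times their
    length. Around an exceptional point they lie in an open set of measure below [delta], and
    absolute continuity bounds their total contribution by e. *)
Let zero_derivative_ends (T : R) g : 0 <= T -> abs_cont T g ->
  {ae lam R, forall tau, tau \in `]0, T[ ->
     h^-1 * (g (tau + h) - g tau) @[h --> 0^'] --> (0 : R)} ->
  g T = g 0.
Proof.
move=> T0 acg dg.
suff H e : 0 < e -> `|g T - g 0| <= e * (T + 1).
  apply/eqP; rewrite -subr_eq0 -normr_le0; apply/ler_addgt0Pl => e e0.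
  have T1 : 0 < T + 1 by rewrite ltr_pwDr.
  by rewrite addr0 (le_trans (H _ (divr_gt0 e0 T1)))// divfK// gt_eqF.
move=> e0; have [delta d0 dP] := acg e e0.
pose N : set (LT R) := ~` [set tau : R | tau \in `]0, T[ ->
  h^-1 * (g (tau + h) - g tau) @[h --> 0^'] --> (0 : R)].
have nN : (lam R).-negligible N by exact: dg.
have n1 (x : R) : (lam R).-negligible ([set x] : set (LT R)).
  exists `[x, x]%classic; split.
  - exact: lam_measurable_itv.
  - by rewrite -[LHS]/(lam R `[x, x]%classic) lam_itvcc// subrr.
  - by move=> y /= ->; rewrite in_itv /= lexx.
(* The ends 0 and T join the exceptional set, the derivative being known in the interior only. *)
have [G [oG NG Gd]] := lam_null_open d0 (negligibleU nN (negligibleU (n1 0) (n1 T))).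
have : covered g G e 0 T.
  apply: cousin => //.
    by move=> a b c; exact: covered_trans.
  move=> s sT; have [Gs|nGs] := pselect (G s).
    have /nbhs_ballP[r r0 rG] : nbhs s G by exact: open_nbhs_nbhs.
    exists r => // a b a0 as_ sb bT ra br.
    have ab : a <= b by exact: le_trans sb.
    exists [:: (a, b)]; split.
    + by move=> p; rewrite inE => /eqP ->.
    + by [].
    + rewrite big_seq1 /= setIidr; last first.
        move=> x /=; rewrite in_itv /= => /andP[ax xb]; apply: rG.
        by rewrite ball_itv /= in_itv /=; apply/andP; split; lra.
      rewrite lebesgue_measure_itv /= lte_fin; case: ltP => // ba.
      by rewrite lee_fin subr_le0.
    + by rewrite big_seq1 /= lerDr mulr_ge0 ?(ltW e0)// subr_ge0.
  have nNs : ~ N s by move=> Ns; apply: nGs; apply: NG; left.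
  have [s0 s1] : s != 0 /\ s != T.
    split; apply/eqP => E; apply: nGs; apply: NG; right; [left|right]; exact: E.
  have sI : s \in `]0, T[.
    by rewrite in_itv /= !lt_neqAle eq_sym s0 s1; case/andP: sT => -> ->.
  have := contrapT nNs => /= /(_ sI) /cvgrPdist_le /(_ e e0).
  move=> /nbhs_ballP[r r0 rP].
  have est b : b != s -> `|b - s| < r -> `|g b - g s| <= e * `|b - s|.
    move=> bs br; have := rP (b - s); rewrite /ball /= sub0r normrN => /(_ br).
    rewrite subr_eq0 => /(_ bs); rewrite sub0r normrN normrM normfV [s + _]addrC subrK.
    by rewrite mulrC ler_pdivrMr// normr_gt0 subr_eq0.
  have est' b : `|b - s| < r -> `|g b - g s| <= e * `|b - s|.
    by have [->|bs] := eqVneq b s; [rewrite !subrr normr0 mulr0|exact: est].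
  exists r => // a b a0 as_ sb bT ra br.
  exists [::]; split => //; rewrite big_nil ?addr0//.
  have -> : g b - g a = (g b - g s) - (g a - g s) by ring.
  apply: (le_trans (ler_normB _ _)).
  have ha : `|a - s| < r by rewrite ler0_norm ?subr_le0// opprB ltrBlDr -ltrBlDl.
  have hb : `|b - s| < r by rewrite ger0_norm ?subr_ge0// ltrBlDl.
  have h1 := est' b hb; have h2 := est' a ha.
  rewrite (@ger0_norm _ (b - s)) ?subr_ge0// in h1.
  rewrite (@ler0_norm _ (a - s)) ?subr_le0// in h2.
  apply: (le_trans (lerD h1 h2)).
  by rewrite -mulrDr opprB addrA subrK.
move=> [l [l1 l2 l3 l4]].
apply: (le_trans l4); rewrite subr0 mulrDr mulr1 lerD2l; apply: ltW.
rewrite (big_nth (0, 0)) big_mkord.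
apply: (dP (size l) (fun i => (nth (0, 0) l i).1) (fun i => (nth (0, 0) l i).2)).
- by move=> i; have [? ? ?] := l1 _ (mem_nth (0, 0) (ltn_ord i)).
- move=> i j _ _ [x [/=]]; rewrite !in_itv /= => /andP[i1 i2] /andP[j1 j2].
  have H (i' j' : 'I_(size l)) : (i' < j')%N -> (nth (0, 0) l i').2 <= (nth (0, 0) l j').1.
    move=> ij; have /pairwiseP := l2; move=> /(_ (0, 0) i' j'); apply => //.
      by rewrite inE.
    by rewrite inE.
  case: (ltngtP (nat_of_ord i) (nat_of_ord j)) => [/H h|/H h|/ord_inj //].
    by have := lt_trans (lt_le_trans i2 h) j1; rewrite ltxx.
  by have := lt_trans (lt_le_trans j2 h) i1; rewrite ltxx.
- rewrite -(big_mkord xpredT (fun i => (nth (0, 0) l i).2 - (nth (0, 0) l i).1)).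
  rewrite -(big_nth (0, 0) xpredT (fun p : R * R => p.2 - p.1)) -lte_fin.
  apply: (le_lt_trans l3); apply: le_lt_trans Gd.
  apply: le_measure; rewrite ?inE; last exact: subIsetl.
    by apply: measurableI => //; exact: open_measurable.
  exact: open_measurable.
Qed.

Lemma zero_derivative_cst (T : R) g : abs_cont T g ->
  {ae lam R, forall tau, tau \in `]0, T[ ->
     h^-1 * (g (tau + h) - g tau) @[h --> 0^'] --> (0 : R)} ->
  {in `[0, T], forall s, g s = g 0}.
Proof.
move=> acg dg s sT; have /andP[s0 s1] : 0 <= s <= T by move: sT; rewrite in_itv.
apply: zero_derivative_ends s0 _ _.
  move=> e e0; have [delta d0 dP] := acg e e0; exists delta => // n a b ab.
  by apply: dP => i; have [? ? h] := ab i; split => //; exact: le_trans h s1.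
apply: negligibleS dg => tau /= nH H; apply: nH => tT; apply: H.
by move: tT; rewrite !in_itv /= => /andP[-> h]; exact: lt_le_trans h s1.
Qed.

End ZeroDerivative.

(** * Measurable selection of a common zero *)

Lemma exists_natSinv_lt (R : realType) (e : R) : 0 < e -> exists n : nat, n.+1%:R^-1 < e.
Proof.
move=> e0; have [n _ /(_ n (leqnn n)) ne] := near_infty_natSinv_lt (PosNum e0).
by exists n.
Qed.

Section CompactMetric.
Context {R : realType} {U : metricType R}.
Hypothesis cU : compact [set: U].

Lemma compact_dense_seq (u0 : U) :
  exists c : nat -> U, forall v (e : R), 0 < e -> exists k, ball (c k) e v.
Proof.
have /choice[s sP] (n : nat) : exists s : seq U, forall v, exists2 w, w \in s & ball w n.+1%:R^-1 v.
  have n0 : 0 < n.+1%:R^-1 :> R by rewrite invr_gt0.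
  apply: contrapT => nex.
  (* Without a finite net at this radius the sets [B s] generate a proper filter; a cluster point
     [v] of it contradicts [B [:: v]]. *)
  pose B (s : seq U) := [set v | forall w, w \in s -> ~ ball w (n.+1%:R^-1 : R) v].
  pose F := filter_from [set: seq U] B.
  have FF : ProperFilter F.
    apply: filter_from_proper; last first.
      move=> s _; apply: contrapT => Bs; apply: nex; exists s => v.
      apply: contrapT => nv; apply: Bs; exists v => w ws wv; apply: nv.
      by exists w.
    apply: filter_from_filter; first by exists [::].
    move=> s1 s2 _ _; exists (s1 ++ s2) => // v Bv.
    by split=> w ws; apply: Bv; rewrite mem_cat ws ?orbT.
  have [v [_ cv]] := cU FF (filterT : F setT).
  have FB : F (B [:: v]) by exists [:: v].
  have [z [Bz vz]] := cv _ _ FB (nbhsx_ballx v _ n0).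
  by apply: Bz vz; rewrite inE.
exists (fun k => if @unpickle (nat * nat)%type k is Some (n, i) then nth u0 (s n) i else u0).
move=> v e e0; have [n ne] := exists_natSinv_lt e0.
have [w ws wv] := sP n v.
exists (pickle (n, index w (s n))); rewrite pickleK nth_index//.
exact: (le_ball (ltW ne)).
Qed.

(** The dense sequence of [U] may miss [C] altogether, so a point of [C] is chosen in each small
    ball around it that meets [C]. *)
Lemma dense_seq_in (C : set U) (v0 : U) : C v0 ->
  exists c : nat -> U, (forall k, C (c k)) /\
    forall v (e : R), C v -> 0 < e -> exists k, ball (c k) e v.
Proof.
move=> Cv0; have [c cP] := compact_dense_seq v0.
have H (nk : nat * nat) : exists w, C w /\
   forall v, C v -> ball (c nk.2) nk.1.+1%:R^-1 v -> ball (c nk.2) nk.1.+1%:R^-1 w.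
  have [[w [Cw bw]]|nw] := pselect (exists w, C w /\ ball (c nk.2) nk.1.+1%:R^-1 w).
    by exists w.
  by exists v0; split => // v Cv bv; exfalso; apply: nw; exists v.
have [w wP] := choice H.
exists (fun k => if @unpickle (nat * nat)%type k is Some nk then w nk else v0); split.
  by move=> k; case: unpickle => // nk; case: (wP nk).
move=> v e Cv e0; have e2 : 0 < e / 2 by rewrite divr_gt0.
have [n ne] := exists_natSinv_lt e2.
have n0 : 0 < n.+1%:R^-1 :> R by rewrite invr_gt0.
have [k kv] := cP v _ n0.
exists (pickle (n, k)); rewrite pickleK.
have [_ /(_ v Cv kv) kw] := wP (n, k).
rewrite [e]splitr; apply: (@ball_triangle _ _ (c k)).
  by apply: (le_ball (ltW ne)); exact: ball_sym.
exact: (le_ball (ltW ne)).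
Qed.

Lemma separating_closed_seq (u0 : U) : exists V : nat -> set U,
  (forall k, closed (V k)) /\ forall v w, v <> w -> exists k, V k v /\ ~ V k w.
Proof.
have [c cP] := compact_dense_seq u0.
pose V k := if @unpickle (nat * nat)%type k is Some nk
  then closure (ball (c nk.2) (nk.1.+1%:R^-1 : R)) else setT.
exists V; split.
  by move=> k; rewrite /V; case: unpickle => [nk|]; [exact: closed_closure|exact: closedT].
move=> v w vw.
have r0 : 0 < mdist v w by rewrite mdist_gt0; exact/eqP.
(* If [w] were in the closure of the ball, three radii would join [v] to the centre, the centre to
   some [z], and [z] to [w]. *)
have r3 : 0 < mdist v w / 3 by rewrite divr_gt0.
have [n ne] := exists_natSinv_lt r3.
have n0 : 0 < n.+1%:R^-1 :> R by rewrite invr_gt0.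
have [k kv] := cP v _ n0.
exists (pickle (n, k)); rewrite /V pickleK /=; split; first exact: subset_closure.
move=> /(_ (ball w n.+1%:R^-1) (nbhsx_ballx _ _ n0)) [z []].
move: kv; rewrite !ballEmdist /= => kv kz wz.
have := metric_triangle v (c k) w; have := metric_triangle (c k) z w.
rewrite (metric_sym v (c k)) (metric_sym z w) => h1 h2.
by move: kv kz wz ne h1 h2 r0; set a := n.+1%:R^-1; lra.
Qed.

Lemma nested_closed_nonempty (A : nat -> set U) :
  (forall k, closed (A k)) -> (forall k, A k !=set0) ->
  (forall k, A k.+1 `<=` A k) -> exists v, forall k, A k v.
Proof.
move=> clA A0 Adec.
have Amono k n : (k <= n)%N -> A n `<=` A k.
  elim: n => [|n IH]; first by rewrite leqn0 => /eqP ->.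
  rewrite leq_eqVlt => /predU1P[->//|]; rewrite ltnS => /IH h.
  exact: subset_trans (Adec n) h.
pose F := filter_from [set: nat] A.
have FF : ProperFilter F.
  apply: filter_from_proper; last by move=> k _; exact: A0.
  apply: filter_from_filter; first by exists 0%N.
  move=> i j _ _; exists (maxn i j) => // x Ax; split.
    exact: Amono (leq_maxl i j) _ Ax.
  exact: Amono (leq_maxr i j) _ Ax.
have [v [_ cv]] := cU FF (filterT : F setT).
exists v => k; rewrite ((closure_id (A k)).1 (clA k)) => B nB.
by apply: cv nB; exists k.
Qed.

End CompactMetric.

Section Selection.
Context {R : realType} {U : metricType R} (cU : compact [set: U]) (u0 : U).
Context {disp : measure_display} {Omega : measurableType disp} (E : set Omega).
Hypothesis mE : measurable E.
Variable q : nat -> Omega -> U -> R.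
Hypothesis mq : forall j v, measurable_fun E (fun w => q j w v).
Hypothesis cq : forall j w, E w -> continuous (q j w).
Hypothesis qE : forall w, E w -> exists v, forall j, q j w v = 0.

Let Gam w : set U := [set v | forall j, q j w v = 0].

Let closed_Gam w : E w -> closed (Gam w).
Proof.
move=> Ew; rewrite (_ : Gam w = \bigcap_j (q j w @^-1` [set 0])); last first.
  by apply/seteqP; split => [v H j _|v H j]; [exact: H|exact: (H j I)].
apply: closed_bigI => j _; apply: preimage_closed; [|exact: closed_eq].
by move=> v _; exact: cq.
Qed.

(** The preimage of [C] under a set-valued map; measurability of the map is expressed by testing it
    on closed sets [C]. *)
Let meet (A : Omega -> set U) (C : set U) := [set w | E w /\ exists v, A w v /\ C v].

(* By compactness, a common zero in C exists as soon as, for every n, some point of a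
   dense sequence of C makes the first n functions smaller than 1/n. *)
Let measurable_Gam C : closed C -> measurable (meet Gam C).
Proof.
move=> clC; have [[v0 Cv0]|nC] := pselect (exists v, C v); last first.
  rewrite (_ : meet Gam C = set0) //; apply/seteqP; split => // w [_ [v [_ Cv]]].
  by apply: nC; exists v.
have [c [cC cd]] := dense_seq_in cU Cv0.
rewrite (_ : meet Gam C = \bigcap_n \bigcup_k \bigcap_j
    (E `&` [set w | (j <= n)%N -> `|q j w (c k)| < n.+1%:R^-1])).
  apply: bigcap_measurable => [|n _]; first by exists 0%N.
  apply: bigcupT_measurable => k; apply: bigcap_measurable => [|j _]; first by exists 0%N.
  have [jn|jn] := boolP (j <= n)%N; last first.
    rewrite (_ : [set w | _] = setT) ?setIT//; apply/seteqP; split => // w _ /=.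
  have mn : measurable_fun E (fun w => `|q j w (c k)|) by exact: measurableT_comp.
  have := mn mE `]-oo, n.+1%:R^-1[%classic (measurable_itv _).
  by congr (measurable _); apply/seteqP; split => w /= [Ew]; rewrite in_itv /= => H; split => //; exact: H.
apply/seteqP; split.
- move=> w [Ew [v [Gv Cv]]] n _.
  have : \forall z \near v, forall j : 'I_n.+1, `|q j w z| < n.+1%:R^-1.
    apply: filter_forall => j.
    have n0 : 0 < n.+1%:R^-1 :> R by rewrite invr_gt0.
    have /cvgrPdist_lt/(_ _ n0) := @cq j w Ew v.
    by rewrite Gv; apply: filterS => z; rewrite sub0r normrN.
  move=> /nbhs_ballP[r r0 rP].
  have [k kv] := cd v r Cv r0.
  exists k => // j _; split => // jn.
  apply: (rP _ _ (Ordinal (jn : (j < n.+1)%N))); exact: ball_sym.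
- move=> w H.
  have Ew : E w by have [k _ /(_ 0%N I)[]] := H 0%N I.
  split => //.
  pose A (n : nat) := C `&` [set v | forall j, (j <= n)%N -> `|q j w v| <= n.+1%:R^-1].
  have [||n|v Av] := @nested_closed_nonempty R U cU A.
  - move=> n; apply: closedI => //.
    rewrite (_ : [set v | _] = \bigcap_(j in [set j | (j <= n)%N])
       ((fun v => `|q j w v|) @^-1` [set r | r <= n.+1%:R^-1])); last first.
      by apply/seteqP; split => v H' j; exact: H'.
    apply: closed_bigI => j _; apply: preimage_closed; last exact: closed_le.
    by move=> v _; apply: (@continuous_comp _ _ _ (q j w) Num.norm);
      [exact: cq|exact: norm_continuous].
  - move=> n; have [k _ kP] := H n I; exists (c k); split => // j jn.
    by apply: ltW; have [_ ] := kP j I; apply.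
  - move=> v [Cv Hv]; split => // j jn; apply: (le_trans (Hv j (leqW jn))).
    by rewrite lef_pV2 ?posrE ?ltr0n// ler_nat.
  exists v; split; last by case: (Av 0%N).
  move=> j; apply/eqP; rewrite -normr_le0; apply/ler_addgt0Pl => e e0; rewrite addr0.
  have [n ne] := exists_natSinv_lt e0.
  have [_ /(_ j (leq_maxl j n)) h] := Av (maxn j n).
  apply: (le_trans h); apply: le_trans (ltW ne).
  by rewrite lef_pV2 ?posrE ?ltr0n// ler_nat ltnS leq_maxr.
Qed.

Lemma measurable_selection : exists s : Omega -> U,
  (forall w, E w -> forall j, q j w (s w) = 0) /\
  forall O, open O -> measurable (E `&` s @^-1` O).
Proof.
have [V [clV sepV]] := separating_closed_seq cU u0.
(* At step k the value set is intersected with V k whenever this leaves it nonempty; since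
   the V k separate points, it shrinks to a single point. *)
pose A := fix A (k : nat) (w : Omega) : set U := if k is k'.+1
  then [set v | A k' w v /\ ((exists z, A k' w z /\ V k' z) -> V k' v)] else Gam w.
have AS k w : A k.+1 w = [set v | A k w v /\ ((exists z, A k w z /\ V k z) -> V k v)] by [].
have clA k w : E w -> closed (A k w).
  move=> Ew; elim: k => [|k IH]; first exact: closed_Gam.
  rewrite AS; have [ex|nex] := pselect (exists z, A k w z /\ V k z).
    rewrite (_ : [set v | _] = A k w `&` V k); first exact: closedI.
    by apply/seteqP; split => v [Av Hv]; split => //; exact: Hv.
  rewrite (_ : [set v | _] = A k w) //.
  by apply/seteqP; split => v; [case|move=> Av; split].
have A0 k w : E w -> exists v, A k w v.
  move=> Ew; elim: k => [|k [v Av]]; first exact: qE.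
  rewrite AS; have [[z [Az Vz]]|nex] := pselect (exists z, A k w z /\ V k z).
    by exists z.
  by exists v.
have Adec k w : A k.+1 w `<=` A k w by move=> v [].
have mA k C : closed C -> measurable (meet (A k) C).
  elim: k C => [|k IH] C clC; first exact: measurable_Gam.
  (* A point of [A k w] in [C] survives the step either by lying in [V k], or because no point of
     [A k w] does. *)
  rewrite (_ : meet _ _ = meet (A k) (V k `&` C) `|` (meet (A k) C `\` meet (A k) (V k))).
    apply: measurableU; first by apply: IH; exact: closedI.
    by apply: measurableD; exact: IH.
  apply/seteqP; split => [w [Ew [v [[Av Hv] Cv]]]|w [[Ew [v [Av [Vv Cv]]]]|[[Ew [v [Av Cv]]] nm]]].
  - have [ex|nex] := pselect (exists z, A k w z /\ V k z).
      by left; split => //; exists v; do !split => //; exact: Hv.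
    by right; split; [split => //; exists v|move=> [_]].
  - by split => //; exists v.
  - by split => //; exists v; do !split => //; move=> ex; exfalso; apply: nm; split.
have sex w : exists v, E w -> forall k, A k w v.
  have [Ew|nEw] := pselect (E w); last by exists u0.
  have [||k|v Av] := @nested_closed_nonempty R U cU (fun k => A k w); last by exists v.
  - by move=> k; exact: clA.
  - by move=> k; have [v Av] := A0 k w Ew; exists v.
  - exact: Adec.
have [s sP] := choice sex.
exists s; split; first by move=> w Ew j; exact: (sP w Ew 0%N).
have uniqA w v v' : (forall k, A k w v) -> (forall k, A k w v') -> v = v'.
  move=> Av Av'; apply: contrapT => /sepV[k [Vv nVv']]; apply: nVv'.
  by have [_] := Av' k.+1; apply; exists v; split; [exact: Av|exact: Vv].
move=> O oO; have clO : closed (~` O) by exact: open_closedC.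
(* If every [A k w] meets the complement of [O], compactness gives a point outside [O] common to all
   of them, and this point can only be [s w]. *)
rewrite (_ : _ `&` _ = E `\` \bigcap_k meet (A k) (~` O)).
  by apply: measurableD => //; apply: bigcap_measurable => [|k _]; [exists 0%N|exact: mA].
apply/seteqP; split => w [Ew H]; split => //.
  move=> nO; have [||k|v Av] := @nested_closed_nonempty R U cU (fun k => A k w `&` ~` O).
  - by move=> k; apply: closedI => //; exact: clA.
  - by move=> k; have [_ [v [Av Ov]]] := nO k I; exists v.
  - by move=> v [Av Ov]; split => //; exact: Adec.
  have E1 : v = s w by apply: (uniqA w) => k; [case: (Av k)|exact: sP].
  by have [_ +] := Av 0%N; apply; rewrite E1.
by apply: contrapT => nO; apply: H => k _; split => //; exists (s w); split => //; exact: sP.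
Qed.

End Selection.

(** * Functions of class C1 with bounded support *)

Lemma continuous_sumr (R : realType) (V : topologicalType) (I : Type) (s : seq I) (F : I -> V -> R) :
  (forall i, continuous (F i)) -> continuous (fun x => \sum_(i <- s) F i x).
Proof.
move=> cF; elim: s => [|i s IH] x.
  under eq_fun do rewrite big_nil; exact: cvg_cst.
under eq_fun do rewrite big_cons.
by apply: cvgD; [exact: cF|exact: IH].
Qed.

Lemma continuous_sum_mul (R : realType) (V : topologicalType) (n : nat) (a b : 'I_n -> V -> R) :
  (forall i, continuous (a i)) -> (forall i, continuous (b i)) ->
  continuous (fun x => \sum_i a i x * b i x).
Proof.
move=> ca cb; apply: continuous_sumr => i x.
exact: continuousM (ca i x) (cb i x).
Qed.

Section SmoothCompact.
Context {R : realType} {d : nat}.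
Implicit Types (p : 'rV[R]_d -> R) (x y v : 'rV[R]_d).

(** Compact support with an explicit radius, which can be followed through the flow uniformly in
    time and in the control. *)
Definition vanishes_outside (A : nmodType) (r : R) (p : 'rV[R]_d -> A) :=
  forall x, r < `|x| -> p x = 0.

Lemma rV_sum_delta v : v = \sum_i v 0 i *: delta_mx 0 i.
Proof. by rewrite [LHS]row_sum_delta. Qed.

Lemma diff_sum p x v : 'd p x v = \sum_i v 0 i * 'd p x (delta_mx 0 i).
Proof.
by rewrite {1}(rV_sum_delta v) linear_sum; apply: eq_bigr => i _; rewrite linearZ.
Qed.

Lemma diff_sumB p x y v : 'd p x v - 'd p y v =
  \sum_i v 0 i * ('d p x (delta_mx 0 i) - 'd p y (delta_mx 0 i)).
Proof.
transitivity (\sum_i v 0 i * 'd p x (delta_mx 0 i) -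
  \sum_i v 0 i * 'd p y (delta_mx 0 i)).
  by congr (_ - _); exact: diff_sum.
by rewrite -sumrB; apply: eq_bigr => i _; rewrite mulrBr.
Qed.

Lemma mean_value p x v : (forall y, differentiable p y) ->
  exists2 c, 0 <= c <= 1 & p (x + v) - p x = 'd p (x + c *: v) v.
Proof.
move=> dp; pose h (t : R) := p (x + t *: v).
have dh t : is_derive t (1 : R) h ('d p (x + t *: v) v).
  pose D (k : R) := 'd p (x + t *: v) (k *: v).
  have lD : linear D by move=> k a b; rewrite /D scalerDl -scalerA linearP.
  have bD (k : R) : `|D k| <= `|'d p (x + t *: v) v| * `|k|.
    by rewrite /D linearZ /= normrM mulrC.
  have [|dht dhE] := @eps_diff R R R h t D _ lD bD.
    move=> e e0; have v1 : 0 < `|v| + 1 by rewrite ltr_pwDr.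
    have [delta d0 dP] := diff_eps (dp (x + t *: v)) (divr_gt0 e0 v1).
    exists (delta / (`|v| + 1)); first by rewrite divr_gt0.
    move=> k kd; have kvd : `|k *: v| < delta.
      rewrite normrZ; apply: (@le_lt_trans _ _ (`|k| * (`|v| + 1))).
        by rewrite ler_wpM2l// lerDl.
      by rewrite -ltr_pdivlMr.
    have := dP _ kvd; rewrite /h /D scalerDl addrA => H; apply: (le_trans H).
    rewrite normrZ -mulrA ler_pM2l// mulrC ler_pdivrMr//.
    by rewrite ler_wpM2l// lerDl.
  apply: DeriveDef; first exact/derivable1_diffP.
  by rewrite deriveE// dhE /D scale1r.
have [|c] := @MVT_segment R h (fun t => 'd p (x + t *: v) v) 0 1 ler01 (fun t _ => dh t).
  apply: continuous_subspaceT => t; apply: differentiable_continuous.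
  by apply/derivable1_diffP; case: (dh t).
rewrite in_itv /= => c01; rewrite /h scale1r scale0r addr0 subr0 mulr1 => H.
by exists c.
Qed.

Lemma diff_vanishes p r : vanishes_outside r p -> forall x v, r < `|x| ->
  'd p x v = 0.
Proof.
move=> vp x v rx.
have N0 : \forall y \near x, p y = 0.
  have e0 : 0 < `|x| - r by rewrite subr_gt0.
  apply/nbhs_ballP; exists (`|x| - r) => // y; rewrite -ball_normE /= => xy.
  by apply: vp; have := ler_normB (x - y) (- y); rewrite opprK subrK normrN; lra.
have l0 : linear (fun _ : 'rV[R]_d => 0 : R) by move=> k y z; rewrite scaler0 addr0.
have [||_ ->//] := @eps_diff R _ _ p x _ 0 l0.
  by move=> k; rewrite normr0 mul0r.
move=> e e0; move/nbhs_ballP : N0 => [r0 r00 rP]; exists r0 => // k kr.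
have -> : p (x + k) = 0.
  by apply: rP; rewrite -ball_normE /= opprD addrA subrr sub0r normrN.
by rewrite vp// !subr0 normr0 mulr_ge0// ltW.
Qed.

Section C1Compact.
Context (p : 'rV[R]_d -> R) (r : R).
Hypotheses (pC1 : C1 p) (pv : vanishes_outside r p).

Let dp x : differentiable p x. Proof. by case: pC1. Qed.
Let cdp v : continuous (fun x => 'd p x v). Proof. by case: pC1. Qed.

Lemma C1c_diff_bound : exists2 L, 0 < L & forall x v, `|'d p x v| <= L * `|v|.
Proof.
have H i : exists M, forall x, `|'d p x (delta_mx 0 i)| <= M.
  have : compact ((fun x => 'd p x (delta_mx 0 i)) @` [set x | `|x| <= r]).
    apply: continuous_compact; last exact: compact_ball_rV.
    exact: continuous_subspaceT.
  move=> /compact_bounded[M [_ MP]]; exists (`|M| + 1) => x.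
  have [xr|rx] := leP `|x| r; last by rewrite (diff_vanishes pv)// normr0.
  apply: (MP (`|M| + 1)); last by exists x.
  by rewrite (le_lt_trans (ler_norm _))// ltrDl.
have [M MP] := choice H.
exists (\sum_i `|M i| + 1); first by rewrite ltr_wpDl// sumr_ge0.
move=> x v; rewrite diff_sum (le_trans (ler_norm_sum _ _ _))//.
apply: (@le_trans _ _ (\sum_i `|M i| * `|v|)); last first.
  by rewrite -mulr_suml ler_wpM2r// lerDl.
apply: ler_sum => i _; rewrite normrM mulrC; apply: ler_pM => //.
  exact: le_trans (MP i x) (ler_norm _).
exact: le_rV_norm.
Qed.

Lemma C1c_lip : exists2 L, 0 < L & forall x y, `|p x - p y| <= L * `|x - y|.
Proof.
have [L L0 LP] := C1c_diff_bound; exists L => // x y.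
have [c _ H] := @mean_value p y (x - y) dp.
by rewrite addrCA subrr addr0 in H; rewrite H.
Qed.

(** The partial derivatives vanish off a ball, hence are uniformly continuous; the mean value
    theorem turns this into a remainder bound uniform in x. *)
Lemma C1c_unif_diff e : 0 < e -> exists2 delta, 0 < delta &
  forall x k, `|k| < delta -> `|p (x + k) - p x - 'd p x k| <= e * `|k|.
Proof.
move=> e0.
have UC i eps : 0 < eps -> exists2 delta, 0 < delta & forall x y, `|x - y| < delta ->
    `|'d p x (delta_mx 0 i) - 'd p y (delta_mx 0 i)| <= eps.
  move=> eps0; set q := fun x => 'd p x (delta_mx 0 i).
  apply: contrapT => nex.
  (* A violating pair has its first point in the ball of radius [r + 1]: otherwise both points, at
     distance less than 1, lie outside the ball of radius [r], where [q] vanishes. *)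
  have /choice[xy xyP] (n : nat) : exists xy : 'rV[R]_d * 'rV[R]_d,
      [/\ `|xy.1| <= r + 1, `|xy.1 - xy.2| < n.+1%:R^-1 & eps < `|q xy.1 - q xy.2|].
    apply: contrapT => nn; apply: nex; exists n.+1%:R^-1; first by rewrite invr_gt0.
    move=> x y xy; rewrite leNgt; apply/negP => ee; apply: nn.
    have [xr|rx] := leP `|x| (r + 1); first by exists (x, y).
    have n1 : n.+1%:R^-1 <= 1 :> R by rewrite invf_le1 ?ltr0n// ler1n.
    have ry : r < `|y|.
      have h : `|x| <= `|x - y| + `|y| by rewrite -{1}(subrK y x) ler_normD.
      by move: (lt_le_trans rx h) xy n1; set a := n.+1%:R^-1; lra.
    have rx' : r < `|x| by lra.
    have qx : q x = 0 by exact: diff_vanishes pv _ _ rx'.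
    have qy : q y = 0 by exact: diff_vanishes pv _ _ ry.
    have : eps < `|q x - q y| by exact: ee.
    by rewrite qx qy subrr normr0 => /(lt_trans eps0); rewrite ltxx.
  have [z [_ cz]] : [set x : 'rV[R]_d | `|x| <= r + 1] `&`
      cluster ((fun n => (xy n).1) @ \oo) !=set0.
    by apply: compact_ball_rV; exists 0%N => // n _ /=; case: (xyP n).
  have cqz : {for z, continuous q} := @cdp (delta_mx 0 i) z.
  clear nex; clearbody q; have eps2 : 0 < eps / 2 by rewrite divr_gt0.
  have /cvgrPdist_lt/(_ _ eps2)/nbhs_ballP[dl dl0 dlP] := cqz.
  have dl2 : 0 < dl / 2 by rewrite divr_gt0.
  have [N _ NP] := near_infty_natSinv_lt (PosNum dl2).
  have F1 : ((fun n => (xy n).1) @ \oo) [set x | exists n, (N <= n)%N /\ x = (xy n).1].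
    by exists N => // n Nn; exists n.
  have [x [[n [Nn ->]] xz]] := cz _ _ F1 (nbhsx_ballx z _ dl2).
  have [_ x12 epsq] := xyP n; have := NP n Nn => /= nd.
  rewrite -ball_normE /= in xz.
  have b1 : ball z dl (xy n).1 by rewrite -ball_normE /=; lra.
  have b2 : ball z dl (xy n).2.
    rewrite -ball_normE /= -[z](subrK (xy n).1) -addrA.
    apply: (le_lt_trans (ler_normD _ _)); rewrite [ltRHS]splitr; apply: ltrD => //.
    exact: lt_trans x12 nd.
  have h1 := dlP _ b1; have h2 := dlP _ b2; rewrite /= in h1 h2.
  have := ler_normB (q z - q (xy n).2) (q z - q (xy n).1).
  rewrite opprB addrC addrA subrK => h3; have := lt_le_trans epsq h3; have := ltrD h2 h1.
  by rewrite -splitr => h4 h5; have := lt_trans h4 h5; rewrite ltxx.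
(* Each of the d coordinates contributes at most e'; the added 1 covers d = 0. *)
pose e' := e / (d%:R + 1).
have d1 : 0 < d%:R + 1 :> R by rewrite ltr_wpDl.
have e'0 : 0 < e' by rewrite divr_gt0.
have /choice[dl dlP] : forall i : 'I_d, exists delta, 0 < delta /\
   forall x y, `|x - y| < delta -> `|'d p x (delta_mx 0 i) - 'd p y (delta_mx 0 i)| <= e'.
  by move=> i; have [dl dl0 dlP] := UC i e' e'0; exists dl.
exists (\big[Num.min/1]_i dl i).
  by apply: lt_bigmin => // i _; case: (dlP i).
move=> x k kd; have [c /andP[c0 c1] ->] := mean_value x k dp.
set y := x + c *: k; have yx : y - x = c *: k by rewrite /y addrAC subrr add0r.
clearbody y; rewrite diff_sumB; apply: (le_trans (ler_norm_sum _ _ _)).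
apply: (@le_trans _ _ (\sum_(i < d) e' * `|k|)).
  apply: ler_sum => i _; rewrite normrM mulrC.
  apply: ler_pM; [exact: normr_ge0|exact: normr_ge0| |exact: le_rV_norm].
  have [_] := dlP i; apply; rewrite yx normrZ (ger0_norm c0).
  apply: (@le_lt_trans _ _ `|k|); first by rewrite ler_piMl.
  apply: (lt_le_trans kd); exact: bigmin_le_cond.
rewrite sumr_const card_ord -[leLHS]mulr_natl mulrA ler_wpM2r// /e' mulrCA ger_pMr//.
by rewrite ler_pdivrMr// mul1r lerDl.
Qed.

End C1Compact.

End SmoothCompact.

(** * Observables *)

Section Observables.
Context {R : realType} {d : nat}.
Implicit Types (g : observable R d).

Lemma normc_le (z : R[i]) : Normc.normc z <= `|complex.Re z| + `|complex.Im z|.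
Proof.
case: z => a b /=.
rewrite -[leRHS]ger0_norm ?addr_ge0// -sqrtr_sqr ler_sqrt ?sqr_ge0//.
rewrite sqrrD !real_normK ?num_real// -addrA lerD2l lerDr.
by rewrite mulrn_wge0// mulr_ge0.
Qed.

Lemma Re_le_normc (z : R[i]) : `|complex.Re z| <= Normc.normc z.
Proof.
by case: z => a b /=; rewrite -sqrtr_sqr ler_sqrt ?addr_ge0 ?sqr_ge0// lerDl sqr_ge0.
Qed.

Lemma Im_le_normc (z : R[i]) : `|complex.Im z| <= Normc.normc z.
Proof.
by case: z => a b /=; rewrite -sqrtr_sqr ler_sqrt ?addr_ge0 ?sqr_ge0// lerDr sqr_ge0.
Qed.

Lemma normc_ge0 (z : R[i]) : 0 <= Normc.normc z.
Proof. by case: z => a b /=; exact: sqrtr_ge0. Qed.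

Lemma supnorm_le g M : (forall x, Normc.normc (g x) <= M) -> supnorm g <= M.
Proof.
move=> gM; apply: ge_sup; first by exists (Normc.normc (g 0)), 0.
by move=> _ [x _ <-].
Qed.

(** A bound is assumed because [sup] returns 0 on an unbounded set. *)
Lemma le_supnorm g M x : (forall x, Normc.normc (g x) <= M) -> Normc.normc (g x) <= supnorm g.
Proof.
move=> gM; apply: ub_le_sup; last by exists x.
by exists M => _ [y _ <-].
Qed.

Lemma supnorm_ge0 g : 0 <= supnorm g.
Proof.
rewrite /supnorm; pose E := range (fun x => Normc.normc (g x)); rewrite -/E.
have [hs|/sup_out ->//] := pselect (has_sup E).
apply: (@le_trans _ _ (Normc.normc (g 0))); first exact: normc_ge0.
by apply: ub_le_sup; [case: hs|exists 0].
Qed.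

Lemma vanishes_compactly_supported (r : R) g : vanishes_outside r g -> compactly_supported g.
Proof.
move=> gr; apply: (subclosed_compact (@closed_closure _ _) (@compact_ball_rV R d r)).
rewrite closureE => x; apply; split; last first.
  by move=> y /= gy; rewrite leNgt; apply/negP => /gr g0; rewrite g0 eqxx in gy.
by apply: compact_closed; [exact: norm_hausdorff|exact: compact_ball_rV].
Qed.

Lemma compactly_supported_vanishes g : compactly_supported g ->
  exists2 r, 0 <= r & vanishes_outside r g.
Proof.
move=> /compact_bounded[M [_ MP]]; exists (`|M| + 1); first by rewrite addr_ge0.
move=> x rx; apply/eqP; apply: contraTT rx => gx; rewrite -leNgt.
apply: (MP (`|M| + 1)); last exact: subset_closure.
by rewrite (le_lt_trans (ler_norm _))// ltrDl.
Qed.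

Lemma vanishes_re (r : R) g : vanishes_outside r g -> vanishes_outside r (obs_re g).
Proof. by move=> gr x /gr; rewrite /obs_re => ->. Qed.

Lemma vanishes_im (r : R) g : vanishes_outside r g -> vanishes_outside r (obs_im g).
Proof. by move=> gr x /gr; rewrite /obs_im => ->. Qed.

Lemma Re_sum (I : Type) (s : seq I) (F : I -> R[i]) :
  complex.Re (\sum_(i <- s) F i) = \sum_(i <- s) complex.Re (F i).
Proof.
elim: s => [|i s IH]; first by rewrite !big_nil.
by rewrite !big_cons -IH; move: (\sum_(j <- s) F j) => z; case: (F i) z => a b [a' b'].
Qed.

Lemma Im_sum (I : Type) (s : seq I) (F : I -> R[i]) :
  complex.Im (\sum_(i <- s) F i) = \sum_(i <- s) complex.Im (F i).
Proof.
elim: s => [|i s IH]; first by rewrite !big_nil.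
by rewrite !big_cons -IH; move: (\sum_(j <- s) F j) => z; case: (F i) z => a b [a' b'].
Qed.

Lemma Re_advection g x (w : 'rV[R]_d) : differentiable (obs_re g) x ->
  complex.Re (\sum_(i < d) partial i g x * Complex (w 0 i) 0) = 'd (obs_re g) x w.
Proof.
move=> dg; transitivity (\sum_i w 0 i * 'd (obs_re g) x (delta_mx 0 i)); last first.
  by apply/esym; exact: diff_sum.
rewrite Re_sum; apply: eq_bigr => i _; rewrite /partial /= mulr0 subr0 mulrC.
by congr (_ * _); exact: deriveE.
Qed.

Lemma Im_advection g x (w : 'rV[R]_d) : differentiable (obs_im g) x ->
  complex.Im (\sum_(i < d) partial i g x * Complex (w 0 i) 0) = 'd (obs_im g) x w.
Proof.
move=> dg; transitivity (\sum_i w 0 i * 'd (obs_im g) x (delta_mx 0 i)); last first.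
  by apply/esym; exact: diff_sum.
rewrite Im_sum; apply: eq_bigr => i _; rewrite /partial /= mulr0 add0r mulrC.
by congr (_ * _); exact: deriveE.
Qed.

(** Continuity of the differential is given for a fixed direction, whereas in the chain rule the
    direction moves with x; expanding in partial derivatives separates the two dependences. *)
Lemma C1_comp (p : 'rV[R]_d -> R) (F : 'rV[R]_d -> 'rV[R]_d) : C1 p -> C1 F ->
  C1 (p \o F).
Proof.
move=> [dp cp] [dF cF]; split.
  by move=> x; apply: differentiable_comp; [exact: dF|exact: dp].
move=> v.
have E : (fun x => \sum_i ('d F x v) 0 i * 'd p (F x) (delta_mx 0 i)) =
    (fun x => 'd (p \o F) x v).
  apply/funext => x; transitivity ('d p (F x) ('d F x v)); first by apply/esym; exact: diff_sum.
  exact: esym (congr1 (fun k => k v) (diff_comp (dF x) (dp (F x)))).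
apply: (eq_ind _ (fun h : 'rV[R]_d -> R => continuous h) _ _ E).
apply: (@continuous_sum_mul _ _ _ (fun i x => ('d F x v) 0 i)
  (fun i x => 'd p (F x) (delta_mx 0 i))) => i x.
  apply: (@continuous_comp _ _ _ (fun x => 'd F x v) (fun y => y 0 i)); first exact: cF.
  exact: coord_continuous.
apply: (@continuous_comp _ _ _ F (fun y => 'd p y (delta_mx 0 i))); last exact: cp.
exact: differentiable_continuous (dF x).
Qed.

Lemma continuous_advection (p : 'rV[R]_d -> R) (w : 'rV[R]_d -> 'rV[R]_d) : C1 p ->
  continuous w -> continuous (fun x => 'd p x (w x)).
Proof.
move=> [dp cp] cw.
have E : (fun x => \sum_i (w x) 0 i * 'd p x (delta_mx 0 i)) = (fun x => 'd p x (w x)).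
  by apply/funext => x; apply/esym; exact: diff_sum.
apply: (eq_ind _ (fun h : 'rV[R]_d -> R => continuous h) _ _ E).
apply: (@continuous_sum_mul _ _ _ (fun i x => (w x) 0 i)
  (fun i x => 'd p x (delta_mx 0 i))) => i x; last exact: cp.
apply: (@continuous_comp _ _ _ w (fun y => y 0 i)); first exact: cw.
exact: coord_continuous.
Qed.

Lemma rational_dense (x : 'rV[R]_d) (e : R) : 0 < e ->
  exists y : 'rV[rat]_d, `|x - map_mx ratr y| < e.
Proof.
move=> e0; have e2 : 0 < e / 2 by rewrite divr_gt0.
have /choice[q qP] : forall i : 'I_d, exists q : rat, `|x 0 i - ratr q| <= e / 2.
  move=> i; have [|q] := @rat_in_itvoo R (x 0 i - e / 2) (x 0 i + e / 2).
    by rewrite ltrD2l gtrN.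
  rewrite in_itv /= => /andP[q1 q2]; exists q.
  by rewrite ler_norml; apply/andP; split; lra.
exists (\row_i q i); apply: (@le_lt_trans _ _ (e / 2)).
  by apply: rV_norm_le => [|i]; [exact: ltW|rewrite !mxE].
by rewrite ltr_pdivrMr// ltr_pMr// ltr1n.
Qed.

End Observables.

(** * Difference quotients of the flow at Lebesgue points of the control *)

Section FlowQuotient.
Context {R : realType} {d : nat} {U : metricType R}.
Implicit Types (x y : 'rV[R]_d) (s t tau : R).
Context (T m : R) (f : 'rV[R]_d * U -> 'rV[R]_d).
Hypotheses (T0 : 0 < T) (m0 : 0 < m) (fc : continuous f).
Hypotheses (fg : linear_growth m f) (fl : locally_lipschitz f).

(** The bound is asked only within distance [|b - a|] of [a]: the integrand it is meant for is small
    only near the starting time. *)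
Lemma ori_bound_local (F : R -> R) (M a b : R) : bmeas T F -> a \in `[0, T] -> b \in `[0, T] ->
  (forall s, s \in `[0, T] -> `|s - a| <= `|b - a| -> `|F s| <= M) ->
  `|oriented_integral a b F| <= M * `|b - a|.
Proof.
move=> bF aT bT FM; rewrite /oriented_integral; case: (leP a b) => ab.
  rewrite (@ger0_norm _ (b - a)) ?subr_ge0//; apply: (Rint_le_bound bF aT bT ab).
  move=> s sab; apply: FM; first exact: (sub_itv0T aT bT).
  move: sab; rewrite in_itv /= => /andP[h1 h2].
  by rewrite !ger0_norm ?subr_ge0//; lra.
rewrite normrN (@ltr0_norm _ (b - a)) ?subr_lt0// opprB.
apply: (Rint_le_bound bF bT aT (ltW ab)).
move=> s sab; apply: FM; first exact: (sub_itv0T bT aT).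
move: sab; rewrite in_itv /= => /andP[h1 h2].
by rewrite ler0_norm ?subr_le0// ltr0_norm ?subr_lt0//; lra.
Qed.

Lemma vint_bound_local (G : R -> 'rV[R]_d) (M a b : R) : vbmeas T G -> a \in `[0, T] ->
  b \in `[0, T] -> 0 <= M ->
  (forall s, s \in `[0, T] -> `|s - a| <= `|b - a| -> `|G s| <= M) ->
  `|vint a b G| <= M * `|b - a|.
Proof.
move=> bG aT bT M0 GM; apply: rV_norm_le => [|i]; first by rewrite mulr_ge0.
rewrite mxE; apply: (ori_bound_local (bG i) aT bT) => s sT sab.
exact: le_trans (le_rV_norm _ _) (GM s sT sab).
Qed.

Context (u : R -> U) (cu : control T u).

Lemma vbmeas_control x : vbmeas T (fun s => f (x, u s)).
Proof.
move=> i; split; first exact: (measurable_control fc x i cu).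
by exists (m * (1 + `|x|)) => s _; exact: le_trans (le_rV_norm _ _) (fg _ _).
Qed.

(** The position is frozen at [x], so this depends on the control but on no trajectory. *)
Definition avg tau (h : R) x : 'rV[R]_d := h^-1 *: vint tau (tau + h) (fun s => f (x, u s)) - f (x, u tau).

Definition lebesgue_point tau := forall x (e : R), 0 < e -> \forall h \near (0 : R)^', `|avg tau h x| <= e.

Lemma near0_ltr (e : R) : 0 < e -> \forall h \near (0 : R), `|h| < e.
Proof.
move=> e0; apply: filterS (nbhsx_ballx (0 : R) _ e0) => h.
by rewrite -ball_normE /= sub0r normrN.
Qed.

Lemma near_in0T tau : tau \in `]0, T[ -> \forall h \near (0 : R), tau + h \in `[0, T].
Proof.
rewrite in_itv /= => /andP[t0 tT].
have e0 : 0 < Num.min tau (T - tau) by rewrite lt_min t0 subr_gt0.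
apply: filterS (near0_ltr e0) => h; rewrite lt_min !ltr_norml in_itv /=.
by move=> /andP[/andP[h1 h2] /andP[h3 h4]]; apply/andP; split; lra.
Qed.

(** The constant is independent of [h]: one [L] comes from the mean velocity, the other from the
    velocity at [tau]. *)
Let avg_lip tau h x y (r L : R) : 0 < L -> tau \in `[0, T] -> tau + h \in `[0, T] ->
  (forall x y v, `|x| <= r -> `|y| <= r -> `|f (x, v) - f (y, v)| <= L * `|x - y|) ->
  `|x| <= r -> `|y| <= r -> h != 0 -> `|avg tau h x - avg tau h y| <= 2 * L * `|x - y|.
Proof.
move=> L0 tT hT fL xr yr h0.
have -> : avg tau h x - avg tau h y =
   h^-1 *: vint tau (tau + h) (fun s => f (x, u s) - f (y, u s)) - (f (x, u tau) - f (y, u tau)).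
  rewrite (vintB (vbmeas_control x) (vbmeas_control y) tT hT) /avg scalerBr.
  by apply/rowP => i; rewrite !mxE; ring.
have b := vint_bound (vbmeasB (vbmeas_control x) (vbmeas_control y)) tT hT
  (fun s _ => fL x y (u s) xr yr).
rewrite (le_trans (ler_normB _ _))// mulrDl mul1r mulrDl lerD//; last exact: fL.
rewrite normrZ normfV ler_pdivrMl ?normr_gt0//; apply: (le_trans b).
by rewrite [tau + h]addrC addrK mulrC.
Qed.

Lemma ae_lebesgue_point : {ae lam R, forall tau, tau \in `]0, T[ -> lebesgue_point tau}.
Proof.
(* The null set is built from rational x only; the bound avg_lip then reaches every x. *)
pose xq (y : 'rV[rat]_d) : 'rV[R]_d := map_mx ratr y.
pose N (k : nat) : set (LT R) := if @unpickle ('rV[rat]_d * 'I_d)%type k is Some yi then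
   [set tau : R | ~ (tau \in `]0, T[ ->
     h^-1 * oriented_integral tau (tau + h) (fun s => f (xq yi.1, u s) 0 yi.2) @[h --> 0^']
       --> f (xq yi.1, u tau) 0 yi.2)] else set0.
have nN k : (lam R).-negligible (N k).
  rewrite /N; case: unpickle => [yi|]; last exact: negligible_set0.
  exact: (ae_cvg_average (vbmeas_control (xq yi.1) yi.2)).
apply: negligibleS (negligible_bigcup nN) => tau /= nL; apply: contrapT => nNk; apply: nL => tT.
have tT' : tau \in `[0, T] by move: tT; rewrite !in_itv /= => /andP[/ltW -> /ltW].
have cq (y : 'rV[rat]_d) i : h^-1 * oriented_integral tau (tau + h) (fun s => f (xq y, u s) 0 i) @[h --> 0^']
       --> f (xq y, u tau) 0 i.
  apply: contrapT => nc; apply: nNk; exists (pickle (y, i)) => //.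
  by rewrite /N pickleK /= => /(_ tT).
have aq (y : 'rV[rat]_d) e : 0 < e -> \forall h \near 0^', `|avg tau h (xq y)| <= e.
  move=> e0.
  have : \forall h \near 0^', forall i : 'I_d,
     `|f (xq y, u tau) 0 i - h^-1 * oriented_integral tau (tau + h) (fun s => f (xq y, u s) 0 i)| <= e.
    by apply: filter_forall => i; have /cvgrPdist_le := cq y i; exact.
  apply: filterS => h H; apply: rV_norm_le => [|i]; first exact: ltW.
  by rewrite !mxE distrC.
move=> x e e0; have [L L0 fL] := fl (`|x| + 1).
have e1 : 0 < Num.min 1 (e / 2 / (2 * L)) by rewrite lt_min ltr01 !divr_gt0// mulr_gt0.
have [y xy] := rational_dense x e1.
have e2 : 0 < e / 2 by rewrite divr_gt0.
have hT : \forall h \near 0^', tau + h \in `[0, T] by apply: nbhs_dnbhs; exact: near_in0T.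
have h0 : \forall h \near 0^', h != 0 :> R by exact: nbhs_dnbhs_neq.
near=> h.
rewrite lt_min in xy; have /andP[xy1 xy2] := xy.
have yr : `|xq y| <= `|x| + 1.
  by rewrite -[xq y](subKr x) (le_trans (ler_normB _ _))// lerD2l ltW.
rewrite -[avg tau h x](subrK (avg tau h (xq y))) (le_trans (ler_normD _ _))//.
rewrite [leRHS]splitr lerD//; last by near: h; exact: aq.
have hh0 : h != 0 by near: h.
have hhT : tau + h \in `[0, T] by near: h.
apply: (le_trans (avg_lip L0 tT' hhT fL _ yr hh0)); first by rewrite lerDl.
rewrite mulrC -ler_pdivlMr ?mulr_gt0//; exact: ltW.
Unshelve. all: by end_near. Qed.

(** The trajectory leaves x by at most [M |h|], so freezing the position changes the velocity by at
    most [L M |h|]; what remains is [avg], uniformly small on the ball. The plus sign reflects that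
    the flow runs from [tau + h] to [tau]. *)
Lemma flow_quotient tau Phi (r e : R) : is_flow T f u Phi -> tau \in `]0, T[ ->
  lebesgue_point tau -> 0 <= r -> 0 < e -> \forall h \near 0^', forall x, `|x| <= r ->
    `|h^-1 *: (Phi (tau + h) tau x - x) + f (x, u tau)| <= e.
Proof.
move=> fP tT lp r0 e0.
have tT' : tau \in `[0, T] by move: tT; rewrite !in_itv /= => /andP[/ltW -> /ltW].
have e2 : 0 < e / 2 by rewrite divr_gt0.
have unif : \forall h \near 0^', forall x, `|x| <= r -> `|avg tau h x| <= e / 2.
  suff : \forall h \near (0 : R), h != 0 -> forall x, `|x| <= r -> `|avg tau h x| <= e / 2.
    by [].
  have [L L0 fL] := fl r.
  apply: (@near_seq R _ (fun h => tau + h \in `[0, T])); first exact: near_in0T.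
  move=> h_ h0 hT; apply: contrapT => nex.
  have /choice[x_ xP] (n : nat) : exists x, [/\ `|x| <= r, h_ n != 0 & e / 2 < `|avg tau (h_ n) x|].
    apply: contrapT => nx; apply: nex; exists n => hn0 x xr; rewrite leNgt; apply/negP => h.
    by apply: nx; exists x.
  (* At a cluster point [z] of the bad points [avg] is eventually small, and [avg_lip] transfers
     this to a bad point near [z]. *)
  have [z [zr cz]] : [set x : 'rV[R]_d | `|x| <= r] `&` cluster (x_ @ \oo) !=set0.
    by apply: compact_ball_rV; exists 0%N => // n _ /=; case: (xP n).
  have e4 : 0 < e / 2 / 2 by rewrite divr_gt0.
  have : \forall n \near \oo, `|avg tau (h_ n) z| <= e / 2 / 2.
    have : \forall h \near (0 : R), h != 0 -> `|avg tau h z| <= e / 2 / 2 := lp z _ e4.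
    move=> /h0 [N _ NP]; exists N => // n Nn; apply: NP => //; by case: (xP n).
  move=> [N _ NP].
  have F1 : (x_ @ \oo) [set x | exists n, (N <= n)%N /\ x = x_ n].
    by exists N => // n Nn; exists n.
  have eL : 0 < e / 2 / 2 / (2 * L) by rewrite !divr_gt0// mulr_gt0.
  have [x [[n [Nn ->]] xz]] := cz _ _ F1 (nbhsx_ballx z _ eL).
  have [xr hn0] := xP n; rewrite ltNge => /negP; apply.
  rewrite -[avg _ _ _](subrK (avg tau (h_ n) z)) (le_trans (ler_normD _ _))//.
  rewrite [leRHS]splitr lerD//; last exact: NP.
  apply: (le_trans (avg_lip L0 tT' (hT n) fL xr zr hn0)).
  rewrite mulrC -ler_pdivlMr ?mulr_gt0// distrC ltW//.
  by rewrite -ball_normE in xz.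
have [L L0 fL] := fl (growth T m r).
pose M := m * (1 + growth T m r).
have g0 : 0 <= growth T m r by apply: (le_trans r0); exact: growth_le.
have M0 : 0 < M by rewrite mulr_gt0// ltr_pwDl.
have hT : \forall h \near 0^', tau + h \in `[0, T] by apply: nbhs_dnbhs; exact: near_in0T.
have h0 : \forall h \near 0^', h != 0 :> R by exact: nbhs_dnbhs_neq.
have hs : \forall h \near (0 : R)^', `|h| <= e / 2 / (L * M).
  have eLM : 0 < e / 2 / (L * M) by rewrite divr_gt0// mulr_gt0.
  by apply: nbhs_dnbhs; apply: filterS (near0_ltr eLM) => h /ltW.
near=> h => x xr.
have avgx : `|avg tau h x| <= e / 2 by move: x xr; near: h; exact: unif.
have hhT : tau + h \in `[0, T] by near: h.
have hh0 : h != 0 by near: h.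
have [bG EG] := flow_solution T0 m0 fg x fP hhT.
have XB s : s \in `[0, T] -> `|Phi (tau + h) s x| <= growth T m r.
  move=> sT; apply: (le_trans (flow_bound T0 m0 fg x fP hhT sT)); exact: growth_mono.
have GB s : s \in `[0, T] -> `|ode f u s (Phi (tau + h) s x)| <= M.
  by move=> sT; apply: (le_trans (fg _ _)); rewrite ler_pM2l// lerD2l XB.
have xg : `|x| <= growth T m r by apply: (le_trans xr); exact: growth_le.
have E1 : Phi (tau + h) tau x - x = - vint tau (tau + h) (fun s => f (x, u s)) +
    vint (tau + h) tau (fun s => ode f u s (Phi (tau + h) s x) - f (x, u s)).
  rewrite (EG _ tT') (vintB bG (vbmeas_control x) hhT tT') addrAC subrr add0r.
  have := vint_chasles (vbmeas_control x) tT' hhT tT'.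
  rewrite (vint_self (vbmeas_control x) tT') => /eqP; rewrite eq_sym addr_eq0 => /eqP <-.
  by rewrite addrCA addNr addr0.
have E2 : h^-1 *: (Phi (tau + h) tau x - x) + f (x, u tau) = - avg tau h x + h^-1 *:
    vint (tau + h) tau (fun s => ode f u s (Phi (tau + h) s x) - f (x, u s)).
  by rewrite E1 scalerDr scalerN /avg opprB addrAC [- _ + _]addrC.
rewrite E2 (le_trans (ler_normD _ _))// normrN [leRHS]splitr lerD//.
rewrite normrZ normfV ler_pdivrMl ?normr_gt0//.
have dh : `|tau - (tau + h)| = `|h| by rewrite opprD addrA subrr sub0r normrN.
have LM0 : 0 <= L * (M * `|h|).
  by apply: mulr_ge0; [exact: ltW|apply: mulr_ge0; [exact: ltW|exact: normr_ge0]].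
apply: (le_trans (vint_bound_local (M := L * (M * `|h|)) (vbmeasB bG (vbmeas_control x)) hhT tT' LM0 _)).
  move=> s sT sh; apply: (le_trans (fL _ _ _ (XB s sT) xg)); rewrite ler_pM2l//.
  have -> : Phi (tau + h) s x - x = vint (tau + h) s (fun r => ode f u r (Phi (tau + h) r x)).
    by rewrite (EG _ sT) addrAC subrr add0r.
  rewrite dh in sh.
  apply: (le_trans (vint_bound bG hhT sT GB)); rewrite ler_pM2l//.
rewrite dh mulrC ler_pM2l ?normr_gt0//.
have LMp : 0 < L * M by exact: mulr_gt0.
rewrite mulrA [_ * `|h|]mulrC -(ler_pdivlMr _ _ LMp); near: h; exact: hs.
Unshelve. all: by end_near. Qed.

End FlowQuotient.

(** * Koopman observables of a fixed control are strong solutions *)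

Section Forward.
Context {R : realType} {d : nat} {U : metricType R}.
Implicit Types (x y : 'rV[R]_d) (s t tau : R) (u : R -> U).
Context (T m : R) (f : 'rV[R]_d * U -> 'rV[R]_d).
Hypotheses (T0 : 0 < T) (m0 : 0 < m) (fc : continuous f).
Hypotheses (fg : linear_growth m f) (fl : locally_lipschitz f).
Hypothesis fC1 : forall w : U, C1 (fun x => f (x, w)).

(** The flow increment is [k = h (q - w)], with [w] the velocity and [q] the error of
    [flow_quotient]. The expansion of [p], uniform in x, leaves ['d p x q] and a remainder, each at
    most e / 2. *)
Lemma quotient_along_flow u Phi tau (p : 'rV[R]_d -> R) (r e : R) :
  control T u -> is_flow T f u Phi -> tau \in `]0, T[ ->
  lebesgue_point f u tau -> 0 <= r -> C1 p -> vanishes_outside r p -> 0 < e ->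
  \forall h \near (0 : R)^', forall x, `|x| <= r ->
    `|h^-1 * (p (Phi (tau + h) tau x) - p x) + 'd p x (f (x, u tau))| <= e.
Proof.
move=> cu fP tT lp r0 pC1 pv e0.
have [L L0 LP] := C1c_diff_bound pC1 pv.
pose B := m * (1 + r); have B0 : 0 < B by rewrite mulr_gt0// ltr_pwDl.
have B1 : 0 < B + 1 by rewrite addr_gt0.
have e2 : 0 < e / 2 by rewrite divr_gt0.
have [dl dl0 dlP] := C1c_unif_diff pC1 pv (divr_gt0 e2 B1).
(* The bound 1 on [q] gives [|k| <= |h| (B + 1)]; the other one makes ['d p x q] at most e / 2. *)
have eL : 0 < Num.min 1 (e / 2 / L) by rewrite lt_min ltr01 divr_gt0.
have H1 := flow_quotient T0 m0 fc fg fl cu fP tT lp r0 eL.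
have H2 : \forall h \near (0 : R)^', `|h| < dl / (B + 1).
  by apply: nbhs_dnbhs; apply: near0_ltr; rewrite divr_gt0.
have H3 : \forall h \near (0 : R)^', h != 0 by exact: nbhs_dnbhs_neq.
near=> h => x xr.
have h0 : h != 0 by near: h.
have hp : 0 < `|h| by rewrite normr_gt0.
have q1 : `|h^-1 *: (Phi (tau + h) tau x - x) + f (x, u tau)| <= Num.min 1 (e / 2 / L).
  by move: x xr; near: h; exact: H1.
set k := Phi (tau + h) tau x - x in q1 *; set w := f (x, u tau) in q1 *.
have wB : `|w| <= B by apply: (le_trans (fg _ _)); rewrite ler_pM2l// lerD2l.
set q := h^-1 *: k + w in q1.
have kq : k = h *: (q - w) by rewrite /q addrK scalerA divff// scale1r.
have q11 : `|q| <= 1 by apply: (le_trans q1); rewrite ge_min lexx.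
have q2 : `|q| <= e / 2 / L by apply: (le_trans q1); rewrite ge_min lexx orbT.
have kB : `|k| <= `|h| * (B + 1).
  by rewrite kq normrZ ler_wpM2l// (le_trans (ler_normB _ _))// addrC lerD.
have kd : `|k| < dl.
  apply: (le_lt_trans kB); rewrite -ltr_pdivlMr//; near: h; exact: H2.
have := dlP x k kd.
have -> : x + k = Phi (tau + h) tau x by rewrite /k addrCA subrr addr0.
set rem := _ - 'd p x k => remk.
have E : h^-1 * (p (Phi (tau + h) tau x) - p x) + 'd p x w = 'd p x q + h^-1 * rem.
  have dq : 'd p x q = h^-1 * 'd p x k + 'd p x w by exact: linearP.
  by rewrite dq /rem; move: (p _ - p x) => D; rewrite mulrBr [RHS]addrC addrA subrK.
rewrite E (le_trans (ler_normD _ _))// [leRHS]splitr lerD//.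
  by rewrite (le_trans (LP _ _))// mulrC -ler_pdivlMr.
rewrite normrM normfV ler_pdivrMl//; apply: (le_trans remk).
apply: (le_trans (ler_wpM2l _ kB)); first by rewrite divr_ge0 ?ltW.
by rewrite mulrC -mulrA [(B + 1) * _]mulrC divfK// gt_eqF.
Unshelve. all: by end_near. Qed.

(** A trajectory that is in the ball of radius [r] at time [t] has, run back to [tau], norm at most
    [growth T m r]. *)
Lemma flow_vanishes (A : nmodType) (phi : 'rV[R]_d -> A) (r : R) u Phi tau t :
  is_flow T f u Phi -> tau \in `[0, T] -> t \in `[0, T] -> vanishes_outside r phi ->
  vanishes_outside (growth T m r) (phi \o Phi tau t).
Proof.
move=> fP tT t01 vp x rx; apply: vp; rewrite ltNge; apply/negP => Pr.
have := flow_semigroup T0 m0 fg fl x fP tT t01 tT.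
rewrite (flow_id T0 m0 fg x fP tT) => E.
move: rx; rewrite ltNge => /negP; apply.
rewrite -E; apply: (le_trans (flow_bound T0 m0 fg _ fP t01 tT)).
exact: growth_mono.
Qed.

Context (phi : observable R d) (phiC1c : C1c phi).

Lemma flow_C1c u Phi tau t : control T u -> is_flow T f u Phi -> tau \in `[0, T] ->
  t \in `[0, T] -> C1c (phi \o Phi tau t).
Proof.
move=> cu fP tT t01; have [reC1 imC1 cs] := phiC1c.
have FC1 := flow_C1 T0 m0 fc fg fl fC1 cu fP tT t01.
have [r r0 vr] := compactly_supported_vanishes cs.
split; [exact: (C1_comp reC1 FC1)|exact: (C1_comp imC1 FC1)|].
exact: (vanishes_compactly_supported (flow_vanishes fP tT t01 vr)).
Qed.

Lemma observable_lip : exists2 L, 0 < L & forall x y,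
  Normc.normc (phi x - phi y) <= L * `|x - y|.
Proof.
have [reC1 imC1 cs] := phiC1c; have [r r0 vr] := compactly_supported_vanishes cs.
have [L1 L10 L1P] := C1c_lip reC1 (vanishes_re vr).
have [L2 L20 L2P] := C1c_lip imC1 (vanishes_im vr).
exists (L1 + L2); first exact: addr_gt0.
move=> x y; apply: (le_trans (normc_le _)); rewrite mulrDl lerD//.
  have -> : complex.Re (phi x - phi y) = obs_re phi x - obs_re phi y.
    by rewrite /obs_re; case: (phi x) (phi y) => a b [a' b'].
  exact: L1P.
have -> : complex.Im (phi x - phi y) = obs_im phi x - obs_im phi y.
  by rewrite /obs_im; case: (phi x) (phi y) => a b [a' b'].
exact: L2P.
Qed.

Lemma pullback_lip (r : R) : exists2 C, 0 <= C & forall u Phi tau t x y,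
  is_flow T f u Phi -> tau \in `[0, T] -> t \in `[0, T] -> `|x| <= r -> `|y| <= r ->
  Normc.normc (phi (Phi tau t x) - phi (Phi tau t y)) <= C * `|x - y|.
Proof.
have [L L0 LP] := observable_lip; have [C C0 CP] := solution_lip T m0 fg fl r.
exists (L * C); first by rewrite mulr_ge0// ltW.
move=> u Phi tau t x y fP tT t01 xr yr; apply: (le_trans (LP _ _)).
rewrite -mulrA ler_pM2l//.
exact: (CP u tau x y _ _ tT xr yr (flow_solution T0 m0 fg x fP tT)
  (flow_solution T0 m0 fg y fP tT) t t01).
Qed.

(** [Phi a t x] is [Phi b t (Phi a b x)], so changing the initial time moves the initial point by at
    most [M |b - a|]. Points outside the ball of radius [r1] give 0, and [r2] bounds the
    trajectories issued from that ball. *)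
Lemma flow_time_lip : exists2 K, 0 <= K & forall u Phi a b t x, is_flow T f u Phi ->
  a \in `[0, T] -> b \in `[0, T] -> t \in `[0, T] ->
  Normc.normc (phi (Phi b t x) - phi (Phi a t x)) <= K * `|b - a|.
Proof.
have [_ _ cs] := phiC1c; have [r r0 vr] := compactly_supported_vanishes cs.
set r1 := growth T m r; set r2 := growth T m r1.
have r10 : 0 <= r1 by apply: (le_trans r0); exact: growth_le.
have r12 : r1 <= r2 by exact: growth_le.
have [C C0 CP] := pullback_lip r2.
pose M := m * (1 + r2).
have M0 : 0 <= M by rewrite mulr_ge0 ?(ltW m0)// addr_ge0// (le_trans r10).
exists (C * M); first exact: mulr_ge0.
move=> u Phi a b t x fP aT bT t01.
have [xr|rx] := leP `|x| r1; last first.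
  rewrite [phi (Phi b t x)](flow_vanishes fP bT t01 vr rx).
  rewrite [phi (Phi a t x)](flow_vanishes fP aT t01 vr rx) subrr.
  by rewrite Normc.normc0; apply: mulr_ge0; [exact: mulr_ge0|exact: normr_ge0].
rewrite -(flow_semigroup T0 m0 fg fl x fP aT bT t01).
have PB s : s \in `[0, T] -> `|Phi a s x| <= r2.
  move=> sT; apply: (le_trans (flow_bound T0 m0 fg x fP aT sT)); exact: growth_mono.
apply: (le_trans (CP u Phi b t x _ fP bT t01 (le_trans xr r12) (PB b bT))).
rewrite -mulrA ler_wpM2l//.
have [bG EG] := flow_solution T0 m0 fg x fP aT.
rewrite (EG _ bT) opprD addrA subrr sub0r normrN.
apply: (vint_bound bG aT bT) => s sT.
by apply: (le_trans (fg _ _)); rewrite ler_pM2l// lerD2l PB.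
Qed.

Lemma generated_strong_solution (J : set R) u (psi : R -> R -> observable R d) :
  (forall t, J t -> t \in `[0, T]) -> control T u ->
  generated_by T f phi J u psi -> strong_solution T f phi J psi.
Proof.
move=> JT cu [Phi fP psiE]; have [reC1 imC1 cs] := phiC1c.
have [r r0 vr] := compactly_supported_vanishes cs.
split.
- by move=> tau t tT Jt; rewrite (psiE _ _ tT Jt); exact: (flow_C1c cu fP tT (JT t Jt)).
- move=> t Jt; have t01 := JT t Jt.
  have [K K0 KP] := flow_time_lip.
  move=> e e0; have K1 : 0 < K + 1 by rewrite ltr_pwDr.
  exists (e / (K + 1)); first by rewrite divr_gt0.
  move=> n a b ab _ S.
  apply: (@le_lt_trans _ _ (\sum_(i < n) (K + 1) * (b i - a i))); last first.
    by rewrite -mulr_sumr mulrC -ltr_pdivlMr.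
  apply: ler_sum => i _; have [a0 aib bT] := ab i.
  have aiT : a i \in `[0, T] by rewrite in_itv /= a0 (le_trans aib bT).
  have biT : b i \in `[0, T] by rewrite in_itv /= bT (le_trans a0 aib).
  apply: supnorm_le => x; rewrite (psiE _ _ aiT Jt) (psiE _ _ biT Jt).
  apply: (le_trans (KP u Phi (a i) (b i) t x fP aiT biT t01)).
  by rewrite ger0_norm ?subr_ge0// ler_wpM2r ?subr_ge0// lerDl.
(* Apart from the two end points the exceptional set consists of times that are not Lebesgue points;
   it depends on the control alone and so serves every [t] in [J]. *)
- have n1 (x : R) : (lam R).-negligible ([set x] : set (LT R)).
    exists `[x, x]%classic; split.
    + exact: lam_measurable_itv.
    + by rewrite -[LHS]/(lam R `[x, x]%classic) lam_itvcc// subrr.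
    + by move=> y /= ->; rewrite in_itv /= lexx.
  have nL := ae_lebesgue_point fc fg fl cu.
  apply: negligibleS (negligibleU nL (negligibleU (n1 0) (n1 T))) => tau /= nH.
  apply: contrapT => /not_orP[/contrapT lpt /not_orP[t_0 t_T]]; apply: nH => tT t Jt.
  have tI : tau \in `]0, T[.
    move: tT; rewrite !in_itv /= !lt_neqAle => /andP[-> ->]; rewrite !andbT.
    by apply/andP; split; apply/eqP => // E; apply: t_0.
  have {}lpt := lpt tI; have t01 := JT t Jt.
  have [pre pim pcs] := flow_C1c cu fP tT t01.
  pose r1 := growth T m r.
  have r10 : 0 <= r1 by apply: (le_trans r0); exact: growth_le.
  have pv : vanishes_outside r1 (phi \o Phi tau t) by exact: flow_vanishes fP tT t01 vr.
  set p : observable R d := phi \o Phi tau t in pre pim pcs pv.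
  pose w x := f (x, u tau).
  have cw : continuous w.
    by move=> x; apply: differentiable_continuous; case: (fC1 (u tau)).
  pose dpsi : observable R d := fun x => - \sum_(i < d) partial i p x * Complex (w x 0 i) 0.
  have dre x : differentiable (obs_re p) x by case: pre.
  have dim_ x : differentiable (obs_im p) x by case: pim.
  have reE : obs_re dpsi = (fun x => - 'd (obs_re p) x (w x)).
    apply/funext => x; rewrite -(Re_advection _ (dre x)) /obs_re /dpsi.
    by case: (\sum_(i < d) _).
  have imE : obs_im dpsi = (fun x => - 'd (obs_im p) x (w x)).
    apply/funext => x; rewrite -(Im_advection _ (dim_ x)) /obs_im /dpsi.
    by case: (\sum_(i < d) _).
  have dv : vanishes_outside r1 dpsi.
    move=> x rx.
    have h1 : obs_re dpsi x = 0.
      rewrite reE; apply/eqP; rewrite oppr_eq0; apply/eqP.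
      exact: (diff_vanishes (vanishes_re pv)).
    have h2 : obs_im dpsi x = 0.
      rewrite imE; apply/eqP; rewrite oppr_eq0; apply/eqP.
      exact: (diff_vanishes (vanishes_im pv)).
    by move: h1 h2; rewrite /obs_re /obs_im; case: (dpsi x) => a b /= -> ->.
  exists dpsi; split.
  + split; last exact: vanishes_compactly_supported dv.
      have ca := continuous_advection pre cw.
      rewrite reE => x; exact: (cvgN (ca x)).
    have ca := continuous_advection pim cw.
    rewrite imE => x; exact: (cvgN (ca x)).
  + apply/cvgrPdist_le => e e0.
    have e2 : 0 < e / 2 by rewrite divr_gt0.
    have H1 := quotient_along_flow cu fP tI lpt r10 pre (vanishes_re pv) e2.
    have H2 := quotient_along_flow cu fP tI lpt r10 pim (vanishes_im pv) e2.
    have H3 : \forall h \near (0 : R)^', tau + h \in `[0, T].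
      by apply: nbhs_dnbhs; exact: near_in0T.
    apply: filterS (filterI (filterI H1 H2) H3) => h [[q1 q2] hT].
    rewrite sub0r normrN ger0_norm ?supnorm_ge0//.
    apply: supnorm_le => x; rewrite (psiE _ _ hT Jt) (psiE _ _ tT Jt) /=.
    (* Outside the ball of radius [r1] all three terms vanish, so uniformity on that ball is
       uniformity in x. *)
    have [xr|rx] := leP `|x| r1; last first.
      rewrite [phi (Phi (tau + h) t x)](flow_vanishes fP hT t01 vr rx).
      rewrite [phi (Phi tau t x)](flow_vanishes fP tT t01 vr rx) dv// !subr0 mulr0.
      by rewrite Normc.normc0 ltW.
    rewrite -(flow_semigroup T0 m0 fg fl x fP hT tT t01).
    apply: (le_trans (normc_le _)); rewrite [leRHS]splitr lerD//.
      have -> : complex.Re (Complex h^-1 0 * (phi (Phi tau t (Phi (tau + h) tau x)) - phi (Phi tau t x)) - dpsi x) =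
         h^-1 * (obs_re p (Phi (tau + h) tau x) - obs_re p x) + 'd (obs_re p) x (w x).
        have -> : 'd (obs_re p) x (w x) = - obs_re dpsi x by rewrite reE opprK.
        rewrite /obs_re /p /=; case: (dpsi x) => a b /=.
        case: (phi (Phi tau t (Phi (tau + h) tau x))) => a1 b1 /=.
        by case: (phi (Phi tau t x)) => a2 b2 /=; ring.
      exact: q1.
    have -> : complex.Im (Complex h^-1 0 * (phi (Phi tau t (Phi (tau + h) tau x)) - phi (Phi tau t x)) - dpsi x) =
       h^-1 * (obs_im p (Phi (tau + h) tau x) - obs_im p x) + 'd (obs_im p) x (w x).
      have -> : 'd (obs_im p) x (w x) = - obs_im dpsi x by rewrite imE opprK.
      rewrite /obs_im /p /=; case: (dpsi x) => a b /=.
      case: (phi (Phi tau t (Phi (tau + h) tau x))) => a1 b1 /=.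
      by case: (phi (Phi tau t x)) => a2 b2 /=; ring.
    exact: q2.
  + exists (fun x => \sum_(i < d) partial i p x * Complex (w x 0 i) 0).
      by exists (u tau); rewrite (psiE _ _ tT Jt).
    by apply/funext => x.
- move=> t Jt; have t01 := JT t Jt; rewrite (psiE _ _ t01 Jt); apply/funext => x /=.
  by rewrite (flow_id T0 m0 fg x fP t01).
Qed.

End Forward.

(** * Strong solutions made of Koopman observables *)

Section Parts.
Context {R : realType} {d : nat}.
Implicit Types (g : observable R d) (z : R[i]) (b : bool).

(** The Boolean index treats real and imaginary parts at once, and also enters the countable index
    set of the selection equations. *)
Definition part b z : R := if b then complex.Re z else complex.Im z.

Lemma part_le b z : `|part b z| <= Normc.normc z.
Proof. by case: b; [exact: Re_le_normc|exact: Im_le_normc]. Qed.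

Lemma partB b z z' : part b (z - z') = part b z - part b z'.
Proof. by case: b z z' => -[x y] [x' y']. Qed.

Lemma partN b z : part b (- z) = - part b z.
Proof. by case: b z => -[x y]. Qed.

Lemma partZ b (r : R) z : part b (Complex r 0 * z) = r * part b z.
Proof. by case: b z => -[x y]; rewrite /part /= mul0r ?subr0 ?addr0. Qed.

Lemma part_inj z z' : (forall b, part b z = part b z') -> z = z'.
Proof.
by case: z z' => [x y] [x' y'] H; have /= -> := H true; have /= -> := H false.
Qed.

Lemma part_C1 b g : C1c g -> C1 (fun x : 'rV[R]_d => part b (g x)).
Proof. by case: b => -[reg img _]; [exact: reg|exact: img]. Qed.

Lemma part_continuous b g : C0c g -> continuous (fun x : 'rV[R]_d => part b (g x)).
Proof. by case: b => -[reg img _]; [exact: reg|exact: img]. Qed.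

Lemma part_advection b g x (w : 'rV[R]_d) :
  differentiable (fun y : 'rV[R]_d => part b (g y)) x ->
  part b (\sum_(i < d) partial i g x * Complex (w 0 i) 0) =
  'd (fun y : 'rV[R]_d => part b (g y)) x w.
Proof. by case: b => dg; [exact: (Re_advection w dg)|exact: (Im_advection w dg)]. Qed.

Lemma C1c_C0c g : C1c g -> C0c g.
Proof.
move=> [[dr _] [di _] cs]; split => //.
  by move=> x; apply: differentiable_continuous; exact: dr.
by move=> x; apply: differentiable_continuous; exact: di.
Qed.

Lemma C0c_bounded g : C0c g -> exists M, forall x, Normc.normc (g x) <= M.
Proof.
move=> [cr ci cs]; have [r r0 vr] := compactly_supported_vanishes cs.
have bnd (h : 'rV[R]_d -> R) : continuous h -> exists M, forall x, `|x| <= r -> `|h x| <= M.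
  move=> ch; have : compact (h @` [set x | `|x| <= r]).
    by apply: continuous_compact; [exact: continuous_subspaceT|exact: compact_ball_rV].
  move=> /compact_bounded[M [_ MP]]; exists (`|M| + 1) => x xr.
  by apply: MP; [rewrite (le_lt_trans (ler_norm _))// ltrDl|exists x].
have [M1 M1P] := bnd _ cr; have [M2 M2P] := bnd _ ci.
have M10 : 0 <= M1 + M2.
  by rewrite (le_trans _ (lerD (M1P 0 _) (M2P 0 _))) ?normr0// addr_ge0.
exists (M1 + M2) => x; have [xr|rx] := leP `|x| r.
  by apply: (le_trans (normc_le _)); rewrite lerD//; [exact: M1P|exact: M2P].
by rewrite vr// Normc.normc0.
Qed.

Lemma continuous_rational_zero (h : 'rV[R]_d -> R) : continuous h ->
  (forall y : 'rV[rat]_d, h (map_mx ratr y) = 0) -> forall x, h x = 0.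
Proof.
move=> ch h0 x; apply/eqP; rewrite -normr_le0; apply/ler_addgt0Pl => e e0; rewrite addr0.
have /cvgrPdist_le/(_ e e0)/nbhs_ballP[dl /= dl0 dlP] := ch x.
have [y xy] := rational_dense x dl0.
by have := dlP (map_mx ratr y); rewrite -ball_normE /= h0 subr0; exact.
Qed.

Lemma near_natSinv (P : R -> Prop) : (\forall h \near 0^', P h) ->
  \forall n \near \oo, P n.+1%:R^-1.
Proof.
move=> /nbhs_ballP[e /= e0 eP]; near=> n.
apply: eP; last by rewrite invr_neq0.
rewrite -ball_normE /= sub0r normrN ger0_norm ?invr_ge0//; near: n.
exact: (near_infty_natSinv_lt (PosNum e0)).
Unshelve. all: by end_near. Qed.

(** The chain rule in the quotient form of [quotient_along_flow], at a single time and point: [q] is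
    only differentiable at [X tau], where [X] has derivative [w]. *)
Lemma chain_quotient (q : 'rV[R]_d -> R) (X : R -> 'rV[R]_d) tau w (L e : R) :
  differentiable q (X tau) -> 0 < L -> (forall v, `|'d q (X tau) v| <= L * `|v|) ->
  (forall e, 0 < e -> \forall h \near (0 : R)^', `|h^-1 *: (X (tau + h) - X tau) - w| <= e) ->
  0 < e ->
  \forall h \near (0 : R)^',
    `|h^-1 * (q (X (tau + h)) - q (X tau)) - 'd q (X tau) w| <= e.
Proof.
move=> dq L0 qL Xw e0.
have w1 : 0 < `|w| + 1 by rewrite ltr_pwDr.
have e2 : 0 < e / 2 by rewrite divr_gt0.
have [dl dl0 dlP] := diff_eps dq (divr_gt0 e2 w1).
have eL : 0 < Num.min 1 (e / 2 / L) by rewrite lt_min ltr01 divr_gt0.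
have H2 : \forall h \near (0 : R)^', `|h| < dl / (`|w| + 1).
  by apply: nbhs_dnbhs; apply: near0_ltr; rewrite divr_gt0.
have H3 : \forall h \near (0 : R)^', h != 0 by exact: nbhs_dnbhs_neq.
apply: filterS (filterI (filterI (Xw _ eL) H2) H3) => h [[q1 hd] h0].
have hp : 0 < `|h| by rewrite normr_gt0.
set k := X (tau + h) - X tau in q1 *; set v := h^-1 *: k - w in q1.
have kq : k = h *: (v + w) by rewrite /v subrK scalerA divff// scale1r.
have v1 : `|v| <= 1 by apply: (le_trans q1); rewrite ge_min lexx.
have v2 : `|v| <= e / 2 / L by apply: (le_trans q1); rewrite ge_min lexx orbT.
have kB : `|k| <= `|h| * (`|w| + 1).
  by rewrite kq normrZ ler_wpM2l// (le_trans (ler_normD _ _))// addrC lerD.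
have kd : `|k| < dl by apply: (le_lt_trans kB); rewrite -ltr_pdivlMr.
have := dlP k kd.
have -> : X tau + k = X (tau + h) by rewrite /k addrCA subrr addr0.
set rem := _ - 'd q (X tau) k => remk.
have dv : 'd q (X tau) v = h^-1 * 'd q (X tau) k - 'd q (X tau) w.
  have lin : 'd q (X tau) (h^-1 *: k + - w) = h^-1 * 'd q (X tau) k + 'd q (X tau) (- w).
    by exact: linearP.
  have linN : 'd q (X tau) (- w) = - 'd q (X tau) w by exact: linearN.
  transitivity (h^-1 * 'd q (X tau) k + 'd q (X tau) (- w)); first exact: lin.
  by rewrite linN.
have E : h^-1 * (q (X (tau + h)) - q (X tau)) - 'd q (X tau) w = 'd q (X tau) v + h^-1 * rem.
  rewrite dv /rem; move: (q _ - q _) => D; rewrite mulrBr.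
  by rewrite [RHS]addrC addrA subrK.
rewrite E (le_trans (ler_normD _ _))// [leRHS]splitr lerD//.
  by rewrite (le_trans (qL _))// mulrC -ler_pdivlMr.
rewrite normrM normfV ler_pdivrMl//; apply: (le_trans remk).
apply: (le_trans (ler_wpM2l _ kB)); first by rewrite divr_ge0 ?ltW.
by rewrite mulrC -mulrA [(`|w| + 1) * _]mulrC divfK// gt_eqF.
Qed.

End Parts.

(** * Bounds and measurability in tau for a family of Koopman observables *)

Section Backward.
Context {R : realType} {d : nat} {U : metricType R}.
Implicit Types (x y : 'rV[R]_d) (s tau : R).
Context (T m : R) (f : 'rV[R]_d * U -> 'rV[R]_d).
Hypotheses (T0 : 0 < T) (m0 : 0 < m).
Hypotheses (fg : linear_growth m f) (fl : locally_lipschitz f).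
Context (phi : observable R d) (phiC1c : C1c phi).
Context (t : R) (t01 : t \in `[0, T]) (p : R -> observable R d).
Hypothesis hk : forall tau, tau \in `[0, T] -> koopman T f tau t phi (p tau).

(** Each [p tau] comes with its own control and flow; this bound, the common support and the
    Lipschitz constant below are uniform in tau because none of them depends on the control. *)
Lemma koopman_bounded : exists M, forall tau x, tau \in `[0, T] -> Normc.normc (p tau x) <= M.
Proof.
have [M MP] := C0c_bounded (C1c_C0c phiC1c); exists M => tau x tT.
by have [u [Phi [_ _ ->]]] := hk tT; exact: MP.
Qed.

Lemma koopman_vanishes : exists2 r, 0 <= r &
  forall tau, tau \in `[0, T] -> vanishes_outside r (p tau).
Proof.
have [_ _ cs] := phiC1c; have [r r0 vr] := compactly_supported_vanishes cs.
exists (growth T m r); first by apply: (le_trans r0); exact: growth_le.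
by move=> tau tT; have [u [Phi [_ fP ->]]] := hk tT; exact: flow_vanishes fP tT t01 vr.
Qed.

Lemma koopman_lip (r : R) : exists2 C, 0 <= C & forall tau x y, tau \in `[0, T] ->
  `|x| <= r -> `|y| <= r -> Normc.normc (p tau x - p tau y) <= C * `|x - y|.
Proof.
have [C C0 CP] := pullback_lip T0 m0 fg fl phiC1c r; exists C => // tau x y tT xr yr.
by have [u [Phi [_ fP ->]]] := hk tT; exact: (CP u Phi tau t x y fP tT t01 xr yr).
Qed.

Lemma koopman_dist tau s x : tau \in `[0, T] -> s \in `[0, T] ->
  Normc.normc (p tau x - p s x) <= supnorm (p tau - p s).
Proof.
move=> tT sT; have [M MP] := koopman_bounded.
apply: (@le_supnorm _ _ (p tau - p s) (M + M)) => y /=.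
apply: (le_trans (le_normcD _ _)); rewrite normcN; apply: lerD; exact: MP.
Qed.

(** Uniformity in [x] is the content of strong convergence; the supremum norm does bound each value
    here since the quotients and [D] are bounded. *)
Lemma koopman_quotient tau D e : tau \in `]0, T[ -> C0c D -> strong_derivative p tau D ->
  0 < e -> \forall h \near (0 : R)^', forall b x,
    `|h^-1 * (part b (p (tau + h) x) - part b (p tau x)) - part b (D x)| <= e.
Proof.
move=> tI CD sD e0; have [M MP] := koopman_bounded; have [MD MDP] := C0c_bounded CD.
have tT : tau \in `[0, T] by move: tI; rewrite !in_itv /= => /andP[/ltW -> /ltW].
have /cvgrPdist_le/(_ e e0) H1 := sD.
have H2 : \forall h \near (0 : R)^', tau + h \in `[0, T].
  by apply: nbhs_dnbhs; exact: near_in0T.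
apply: filterS (filterI H1 H2) => h [H hT] b x.
rewrite sub0r normrN in H; apply: le_trans (le_trans (ler_norm _) H).
rewrite -partB -partZ -partB; apply: (le_trans (part_le _ _)).
apply: (@le_supnorm _ _ (fun x => Complex h^-1 0 * (p (tau + h) x - p tau x) - D x)
  (Normc.normc (Complex h^-1 0) * (M + M) + MD)) => y.
apply: (le_trans (le_normcD _ _)); rewrite normcN Normc.normcM lerD//.
rewrite ler_wpM2l ?normc_ge0//.
apply: (le_trans (le_normcD _ _)); rewrite normcN; apply: lerD; exact: MP.
Qed.

Hypothesis pAC : abs_continuous T p.

Lemma ac_uniform e : 0 < e -> exists2 dl, 0 < dl & forall tau s b x,
  tau \in `[0, T] -> s \in `[0, T] -> `|tau - s| < dl ->
  `|part b (p tau x) - part b (p s x)| < e.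
Proof.
move=> e0; have [dl dl0 dlP] := pAC e0; exists dl => // tau s b x.
wlog st : tau s / s <= tau.
  move=> W tT sT ts; have [st|ts'] := leP s tau; first exact: W.
  by rewrite distrC; apply: W => //; [exact: ltW|rewrite distrC].
move=> tT sT; rewrite ger0_norm ?subr_ge0// => ts.
rewrite -partB; apply: (le_lt_trans (part_le _ _)); apply: (le_lt_trans (koopman_dist x tT sT)).
have := dlP 1%N (fun=> s) (fun=> tau); rewrite !big_ord1; apply => //.
  move=> _; move: tT sT; rewrite !in_itv /= => /andP[_ ->] /andP[-> _].
  by split.
by move=> i j _ _ _; rewrite (ord1 i) (ord1 j).
Qed.

(* Nothing is known about p outside [0,T], hence the clamped time. *)
Let cl tau : R := Num.max 0 (Num.min T tau).

Let cl_in tau : cl tau \in `[0, T].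
Proof.
rewrite /cl in_itv /= le_max lexx /= ge_max (ltW T0) /= ge_min lexx //.
Qed.

Let cl_id tau : tau \in `[0, T] -> cl tau = tau.
Proof.
by rewrite in_itv /= => /andP[h1 h2]; rewrite /cl (min_idPr _)// (max_idPr _).
Qed.

Let cl_dist tau s : `|cl tau - cl s| <= `|tau - s|.
Proof.
have T0' := ltW T0.
wlog st : tau s / s <= tau.
  move=> W; have [|/ltW] := leP s tau; first exact: W.
  by move=> ts; rewrite distrC [leRHS]distrC; exact: W.
rewrite (@ger0_norm _ (tau - s)) ?subr_ge0// ler_norml /cl /Num.max /Num.min.
by case: (ltP T tau) => ?; case: (ltP T s) => ?; repeat case: ltP => ?; apply/andP; split; lra.
Qed.

Lemma ac_continuous b x : continuous (fun tau => part b (p (cl tau) x)).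
Proof.
move=> tau; apply/cvgrPdist_lt => e e0; have [dl dl0 dlP] := ac_uniform e0.
apply: filterS (nbhsx_ballx tau _ dl0) => s; rewrite -ball_normE /= => ts.
apply: dlP; [exact: cl_in|exact: cl_in|exact: le_lt_trans (cl_dist _ _) ts].
Qed.

Context (E : set (LT R)) (E0T : E `<=` `]0, T[%classic).

Let E0T' tau : E tau -> tau \in `[0, T].
Proof. by move=> /E0T; rewrite /= !in_itv /= => /andP[/ltW -> /ltW]. Qed.

Lemma measurable_value b x : measurable_fun E (fun tau => part b (p tau x)).
Proof.
have mc := borel_lam_measurable (D := E) (continuous_measurable_fun (@ac_continuous b x)).
by apply: eq_measurable_fun mc => tau; rewrite inE => /E0T' tT; rewrite (cl_id tT).
Qed.

(** However [D] was chosen, on [E] its values are limits of difference quotients that are continuous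
    in tau. *)
Lemma measurable_derivative b x (D : R -> observable R d) :
  (forall tau, E tau -> C0c (D tau) /\ strong_derivative p tau (D tau)) ->
  measurable_fun E (fun tau => part b (D tau x)).
Proof.
move=> DP.
apply: (@measurable_fun_cvg _ (LT R) R _ (fun n tau =>
   n.+1%:R * (part b (p (cl (tau + n.+1%:R^-1)) x) - part b (p (cl tau) x)))).
  move=> n; apply: borel_lam_measurable; apply: continuous_measurable_fun => tau.
  apply: cvgM; first exact: cvg_cst.
  apply: cvgB; last exact: ac_continuous.
  apply: (@continuous_comp _ _ _ (fun tau => tau + n.+1%:R^-1)
    (fun tau => part b (p (cl tau) x))); last exact: ac_continuous.
  by apply: cvgD; [exact: cvg_id|exact: cvg_cst].
move=> tau Et; have [CD sD] := DP tau Et.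
apply/cvgrPdist_le => e e0.
have H1 := near_natSinv (koopman_quotient (E0T Et) CD sD e0).
have H2 := near_natSinv (nbhs_dnbhs (near_in0T (E0T Et))).
apply: filterS (filterI H1 H2) => n [/(_ b x) Q hT].
by rewrite distrC (cl_id hT) (cl_id (E0T' Et)); move: Q; rewrite invrK.
Qed.

Hypothesis pC1c : forall tau, tau \in `[0, T] -> C1c (p tau).

Lemma measurable_differential b x v :
  measurable_fun E (fun tau => 'd (fun y : 'rV[R]_d => part b (p tau y)) x v).
Proof.
apply: (@measurable_fun_cvg _ (LT R) R _ (fun n tau =>
   n.+1%:R * (part b (p tau (x + n.+1%:R^-1 *: v)) - part b (p tau x)))).
  move=> n; apply: measurable_funM; first exact: measurable_cst.
  by apply: measurable_funB; exact: measurable_value.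
move=> tau Et; have [dp _] := part_C1 b (pC1c (E0T' Et)).
exact: (diff_cvg_seq (v := v) (dp x)).
Qed.

End Backward.

(** * A measurable control realising the inclusion *)

Section ControlSelection.
Context {R : realType} {d : nat} {U : metricType R}.
Implicit Types (x y : 'rV[R]_d) (s tau : R).
Context (T : R) (f : 'rV[R]_d * U -> 'rV[R]_d).
Hypotheses (T0 : 0 < T) (cU : compact [set: U]) (fc : continuous f).
Context (phi : observable R d) (phiC1c : C1c phi).
Context (t : R) (t01 : t \in `[0, T]) (p : R -> observable R d).
Hypothesis hk : forall tau, tau \in `[0, T] -> koopman T f tau t phi (p tau).
Hypothesis pAC : abs_continuous T p.
Hypothesis pC1c : forall tau, tau \in `[0, T] -> C1c (p tau).

(** The transport equation D + grad p . f_v = 0 at every point, for real and imaginary parts. *)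
Definition transported tau (D : observable R d) v := forall b x,
  part b (D x) + 'd (fun y : 'rV[R]_d => part b (p tau y)) x (f (x, v)) = 0.

Lemma control_extend (E : set (LT R)) (s : R -> U) (u0 : U) : measurable E ->
  E `<=` `[0, T]%classic ->
  (forall O, open O -> measurable (E `&` s @^-1` O)) ->
  control T (fun tau => if pselect (E tau) then s tau else u0).
Proof.
move=> mE ET ms O oO; rewrite /Lebesgue_measurable.
have mT : measurable (`[0, T]%classic : set (LT R)) by exact: lam_measurable_itv.
have -> : `[0, T]%classic `&` (fun tau => if pselect (E tau) then s tau else u0) @^-1` O =
    (E `&` s @^-1` O) `|` ((`[0, T]%classic `\` E) `&` [set _ | O u0]).
  apply/seteqP; split => [tau [tT]|tau] /=.
    by case: pselect => Et Ot; [left|right].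
  by case=> [[Et Ot]|[[tT nE] Ou]]; split; [exact: ET| |exact: tT|]; case: pselect.
apply: measurableU; first exact: ms.
have [Ou|nOu] := pselect (O u0).
  rewrite (_ : [set _ | O u0] = setT) ?setIT; first exact: measurableD.
  by apply/seteqP; split.
rewrite (_ : [set _ | O u0] = set0) ?setI0; first exact: measurable0.
by apply/seteqP; split.
Qed.

Lemma continuous_transport tau x b : continuous (fun v =>
  'd (fun y : 'rV[R]_d => part b (p tau y)) x (f (x, v))).
Proof.
set q := fun y : 'rV[R]_d => part b (p tau y).
have E : (fun v => \sum_i f (x, v) 0 i * 'd q x (delta_mx 0 i)) = (fun v => 'd q x (f (x, v))).
  by apply/funext => v; apply/esym; exact: diff_sum.
apply: (eq_ind _ (fun h : U -> R => continuous h) _ _ E).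
apply: (@continuous_sum_mul _ _ _ (fun i v => f (x, v) 0 i)
  (fun i v => 'd q x (delta_mx 0 i))) => i v; last exact: cvg_cst.
apply: (@continuous_comp _ _ _ (fun v => f (x, v)) (fun y => y 0 i)); last exact: coord_continuous.
apply: (@continuous_comp _ _ _ (fun v => (x, v)) f); last exact: fc.
exact: (cvg_pair (cvg_cst _) cvg_id).
Qed.

(** By continuity in x the transport equation need only hold at rational points, that is, for
    countably many functions of tau and the control value, measurable in the former and continuous
    in the latter: the setting of [measurable_selection]. *)
Lemma selected_control :
  {ae lam R, forall tau, tau \in `[0, T] -> exists dpsi, [/\ C0c dpsi,
     strong_derivative p tau dpsi & [set - g | g in liouville f (p tau)] dpsi]} ->
  exists2 u, control T u & {ae lam R, forall tau, tau \in `]0, T[ ->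
    exists D, [/\ C0c D, strong_derivative p tau D & transported tau D (u tau)]}.
Proof.
move=> [A [mA A0 nA]].
(* Supplies a point [u1 0] of [U], the value given to the control outside [E]. *)
have [u1 [Phi1 [_ _ _]]] := hk t01.
(* Removing a measurable null set that contains the exceptional times keeps the domain of the
   selection measurable. *)
pose E : set (LT R) := `]0, T[%classic `&` ~` A.
have mE : measurable E by apply: measurableI; [exact: lam_measurable_itv|exact: measurableC].
have EO : E `<=` `]0, T[%classic by move=> tau [].
have ET : E `<=` `[0, T]%classic.
  by move=> tau /EO; rewrite /= !in_itv /= => /andP[/ltW -> /ltW].
have /choice[D DP] : forall tau, exists D, E tau ->
    [/\ C0c D, strong_derivative p tau D & exists v, transported tau D v].
  move=> tau; have [Et|] := pselect (E tau); last by exists phi.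
  have [D [CD sD [g [v gE] gD]]] :
    exists dpsi, [/\ C0c dpsi, strong_derivative p tau dpsi
      & [set - g | g in liouville f (p tau)] dpsi].
    by apply: contrapT => nex; case: (Et) => _; apply; apply: nA => /= /(_ (ET _ Et)).
  exists D => _; split => //; exists v => b x.
  have [dq _] := part_C1 b (pC1c (ET _ Et)).
  have <- := part_advection (f (x, v)) (dq x).
  have -> : D x = - \sum_(i < d) partial i (p tau) x * Complex (f (x, v) 0 i) 0.
    by rewrite -gD gE.
  by rewrite partN addNr.
pose xq (y : 'rV[rat]_d) : 'rV[R]_d := map_mx ratr y.
pose q (j : nat) (tau : LT R) (v : U) : R :=
  if @unpickle ('rV[rat]_d * bool)%type j is Some (y, b) then
    part b (D tau (xq y)) +
      'd (fun x : 'rV[R]_d => part b (p tau x)) (xq y) (f (xq y, v)) else 0.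
have mq j v : measurable_fun E (fun tau => q j tau v).
  rewrite /q; case: unpickle => [[y b]|]; last exact: measurable_cst.
  set x := xq y.
  apply: measurable_funD.
    have DE tau : E tau -> C0c (D tau) /\ strong_derivative p tau (D tau) by move=> /DP[].
    exact: (measurable_derivative T0 phiC1c hk pAC EO b x DE).
  exact: (measurable_differential T0 phiC1c hk pAC EO pC1c).
have cq j tau : E tau -> continuous (q j tau).
  move=> Et; rewrite /q; case: unpickle => [[y b]|]; last by move=> v; exact: cvg_cst.
  move=> v; apply: cvgD; first exact: cvg_cst.
  exact: (@continuous_transport tau _ b v).
have qE tau : E tau -> exists v, forall j, q j tau v = 0.
  move=> /DP[_ _ [v vP]]; exists v => j; rewrite /q; case: unpickle => [[y b]|//].
  exact: vP.
have [s [sP ms]] := measurable_selection cU (u1 0) mE mq cq qE.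
exists (fun tau => if pselect (E tau) then s tau else u1 0); first exact: control_extend.
exists A; split => // tau nt; apply: contrapT => nAt; apply: nt => tI.
have Et : E tau by [].
have [CD sD _] := DP tau Et; exists (D tau); split => //.
have -> : (if pselect (E tau) then s tau else u1 0) = s tau by case: pselect.
move=> b.
have [dq cq'] := part_C1 b (pC1c (ET _ Et)).
apply: continuous_rational_zero.
  have c1 := part_continuous (b := b) CD.
  have cf : continuous (fun z => f (z, s tau)).
    move=> z; apply: (@continuous_comp _ _ _ (fun z => (z, s tau)) f); last exact: fc.
    apply: (@cvg_pair _ _ _ (nbhs z) (nbhs z) (nbhs (s tau)) _ _ _ id (fun=> s tau)).
      exact: cvg_id.
    exact: cvg_cst.
  have c2 := continuous_advection (part_C1 b (pC1c (ET _ Et))) cf.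
  by move=> x; exact: (cvgD (c1 x) (c2 x)).
by move=> y; have := sP tau Et (pickle (y, b)); rewrite /q pickleK.
Qed.

End ControlSelection.

(** * Constancy of the observables along the trajectories of the selected control *)

Section Transport.
Context {R : realType} {d : nat} {U : metricType R}.
Implicit Types (x y : 'rV[R]_d) (s tau : R).
Context (T m : R) (f : 'rV[R]_d * U -> 'rV[R]_d).
Hypotheses (T0 : 0 < T) (m0 : 0 < m).
Hypotheses (fg : linear_growth m f) (fl : locally_lipschitz f).
Context (phi : observable R d) (phiC1c : C1c phi).
Context (t : R) (t01 : t \in `[0, T]) (p : R -> observable R d).
Hypothesis hk : forall tau, tau \in `[0, T] -> koopman T f tau t phi (p tau).
Hypothesis pAC : abs_continuous T p.
Hypothesis pC1c : forall tau, tau \in `[0, T] -> C1c (p tau).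
Context (u : R -> U) (Phi : R -> R -> 'rV[R]_d -> 'rV[R]_d).
Hypotheses (fP : is_flow T f u Phi).
Hypothesis uD : {ae lam R, forall tau, tau \in `]0, T[ ->
  exists D, [/\ C0c D, strong_derivative p tau D & transported f p tau D (u tau)]}.

Let X y s := Phi t s y.

Let X_lip y : lipT T (X y).
Proof. exact: solution_lipT t01 (flow_solution T0 m0 fg y fP t01). Qed.

(** The exceptional set may depend on [y], which is harmless: one trajectory is considered at a
    time. *)
Lemma flow_derivative y : {ae lam R, forall tau, tau \in `]0, T[ -> forall e, 0 < e ->
  \forall h \near (0 : R)^', `|h^-1 *: (X y (tau + h) - X y tau) - f (X y tau, u tau)| <= e}.
Proof.
have [bG EG] := flow_solution T0 m0 fg y fP t01.
pose G i s := f (X y s, u s) 0 i.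
pose N (k : nat) : set (LT R) := if @unpickle 'I_d k is Some i then
   [set tau : R | ~ (tau \in `]0, T[ ->
     h^-1 * oriented_integral tau (tau + h) (G i) @[h --> 0^'] --> G i tau)] else set0.
have nN k : (lam R).-negligible (N k).
  rewrite /N; case: unpickle => [i|]; last exact: negligible_set0.
  exact: (ae_cvg_average (bG i)).
apply: negligibleS (negligible_bigcup nN) => tau /= nL; apply: contrapT => nNk.
apply: nL => tI e e0.
have tT : tau \in `[0, T] by move: tI; rewrite !in_itv /= => /andP[/ltW -> /ltW].
have ci i : h^-1 * oriented_integral tau (tau + h) (G i) @[h --> 0^'] --> G i tau.
  apply: contrapT => nc; apply: nNk; exists (pickle i) => //.
  by rewrite /N pickleK /= => /(_ tI).
have H1 : \forall h \near (0 : R)^', forall i : 'I_d,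
     `|G i tau - h^-1 * oriented_integral tau (tau + h) (G i)| <= e.
  by apply: filter_forall => i; have /cvgrPdist_le := ci i; exact.
have H2 : \forall h \near (0 : R)^', tau + h \in `[0, T].
  by apply: nbhs_dnbhs; exact: near_in0T.
apply: filterS (filterI H1 H2) => h [H hT]; apply: rV_norm_le => [|i]; first exact: ltW.
have E : X y (tau + h) - X y tau = vint tau (tau + h) (fun s => f (X y s, u s)).
  rewrite /X (EG _ hT) (EG _ tT) (vint_chasles bG t01 tT hT).
  by rewrite opprD addrACA subrr add0r addrAC subrr add0r.
by rewrite E !mxE distrC; exact: H.
Qed.

(** The increment splits into a change of observable at a fixed point, bounded in supremum norm by
    absolute continuity, and a change of point for a fixed observable, bounded by [C * K] times the
    elapsed time. *)
Lemma observable_along_flow_abs_cont b y : abs_cont T (fun s => part b (p s (X y s))).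
Proof.
have [r XB] := lipT_bound (X_lip y).
have [C C0 CP] := koopman_lip T0 m0 fg fl phiC1c t01 hk r.
have [K K0 KP] := X_lip y.
move=> e e0; have e2 : 0 < e / 2 by rewrite divr_gt0.
have CK0 : 0 < C * K + 1 by rewrite ltr_pwDr// mulr_ge0.
have [dl dl0 dlP] := pAC e2.
exists (Num.min dl (e / 2 / (C * K + 1))); first by rewrite lt_min dl0 divr_gt0.
move=> n a c ac tI; rewrite lt_min => /andP[S1 S2].
have H := dlP n a c ac tI S1.
have aT i : a i \in `[0, T].
  by have [h1 h2 h3] := ac i; rewrite in_itv /= h1 (le_trans h2 h3).
have cT i : c i \in `[0, T].
  by have [h1 h2 h3] := ac i; rewrite in_itv /= h3 (le_trans h1 h2).
apply: (@le_lt_trans _ _ (\sum_(i < n) supnorm (p (c i) - p (a i)) +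
  \sum_(i < n) (C * K + 1) * (c i - a i))); last first.
  by rewrite [ltRHS]splitr ltrD// -mulr_sumr mulrC -ltr_pdivlMr.
rewrite -big_split /=; apply: ler_sum => i _.
have [_ aci _] := ac i.
have E : part b (p (c i) (X y (c i))) - part b (p (a i) (X y (a i))) =
   part b (p (c i) (X y (c i)) - p (a i) (X y (c i))) +
   part b (p (a i) (X y (c i)) - p (a i) (X y (a i))).
  by rewrite !partB addrA subrK.
rewrite E (le_trans (ler_normD _ _))//; apply: lerD; apply: (le_trans (part_le _ _)).
  exact: (koopman_dist phiC1c hk).
apply: (le_trans (CP _ _ _ (aT i) (XB _ (cT i)) (XB _ (aT i)))).
apply: (@le_trans _ _ (C * (K * (c i - a i)))).
  by rewrite ler_wpM2l// (le_trans (KP _ _ (cT i) (aT i)))// ger0_norm ?subr_ge0.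
by rewrite mulrA ler_wpM2r ?subr_ge0// lerDl.
Qed.

(** The quotient splits in the same way. The part with changing observable is taken at the moving
    point [X y (tau + h)], so it requires uniform convergence to [D] and then continuity of [D]. The
    other part tends to ['d p (f)], and the two limits cancel by the transport equation. *)
Lemma observable_along_flow_derivative b y : {ae lam R, forall tau, tau \in `]0, T[ ->
  h^-1 * (part b (p (tau + h) (X y (tau + h))) - part b (p tau (X y tau)))
    @[h --> 0^'] --> (0 : R)}.
Proof.
have [r r0 pv] := koopman_vanishes T0 m0 fg fl phiC1c t01 hk.
apply: negligibleS (negligibleU uD (flow_derivative y)) => tau /= nH.
apply: contrapT => /not_orP[/contrapT uDt /contrapT Xt]; apply: nH => tI.
have tT : tau \in `[0, T] by move: tI; rewrite !in_itv /= => /andP[/ltW -> /ltW].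
have [D [CD sD tD]] := uDt tI; have {}Xt := Xt tI.
have pt1 := part_C1 b (pC1c tT).
have pv1 : vanishes_outside r (fun x : 'rV[R]_d => part b (p tau x)).
  by move=> x /(pv _ tT) ->; case: (b).
have [L L0 LP] := C1c_diff_bound pt1 pv1.
have [dq _] := pt1.
apply/cvgrPdist_le => e e0; have e3 : 0 < e / 3 by rewrite divr_gt0.
have H1 := koopman_quotient phiC1c hk tI CD sD e3.
have H2 := chain_quotient (dq _) L0 (LP _) Xt e3.
have H3 : \forall h \near (0 : R)^', `|part b (D (X y (tau + h))) - part b (D (X y tau))| <= e / 3.
  have /cvgrPdist_le/(_ _ e3)/nbhs_ballP[dl /= dl0 dlP] := @part_continuous _ _ b D CD (X y tau).
  have [K K0 KP] := X_lip y; have K1 : 0 < K + 1 by rewrite ltr_pwDr.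
  have Hh : \forall h \near (0 : R)^', `|h| < dl / (K + 1).
    by apply: nbhs_dnbhs; apply: near0_ltr; rewrite divr_gt0.
  have HT : \forall h \near (0 : R)^', tau + h \in `[0, T].
    by apply: nbhs_dnbhs; exact: near_in0T.
  apply: filterS (filterI Hh HT) => h [hd hT]; rewrite distrC; apply: dlP.
  rewrite -ball_normE /= distrC; apply: (le_lt_trans (KP _ _ hT tT)).
  have -> : tau + h - tau = h by rewrite addrAC subrr add0r.
  apply: (@le_lt_trans _ _ ((K + 1) * `|h|)); first by rewrite ler_wpM2r// lerDl.
  by rewrite mulrC -ltr_pdivlMr.
apply: filterS (filterI (filterI H1 H2) H3) => h [[q1 q2] q3].
have {}q1 := q1 b (X y (tau + h)).
rewrite sub0r normrN; move: q1 q2 q3 (tD b (X y tau)).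
move: ('d _ _ _) => w; rewrite -/(X y tau).
move: (part b (D (X y tau))) (part b (D (X y (tau + h)))) => D0 D1.
move: (part b (p tau (X y tau))) (part b (p tau (X y (tau + h))))
  (part b (p (tau + h) (X y (tau + h)))) h^-1 => a1 a2 a3 k.
have E : k * (a3 - a1) = k * (a3 - a2) + k * (a2 - a1) by rewrite -mulrDr addrA subrK.
rewrite {}E; move: (k * (a3 - a2)) (k * (a2 - a1)) => k1 k2.
rewrite !ler_norml => /andP[h1 h2] /andP[h3 h4] /andP[h5 h6] h7.
by apply/andP; split; lra.
Qed.

Lemma observable_along_flow tau y : p t = phi -> tau \in `[0, T] ->
  p tau (Phi t tau y) = phi y.
Proof.
move=> pt tT; apply: part_inj => b.
have H := zero_derivative_cst (observable_along_flow_abs_cont b y)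
  (observable_along_flow_derivative b y).
have := H tau tT; rewrite -(H t t01) /X => ->.
by rewrite pt (flow_id T0 m0 fg y fP t01).
Qed.

End Transport.

(** The equivalence is stated for each [t] separately because a strong solution may use a different
    control for each [t]: for f(x, u) = u on the line and constant controls c(t), the family phi(x +
    c(t) (t - tau)) solves the inclusion for all [t] with a common null set, yet for nonzero phi no
    single control generates it unless c is constant. The forward implication holds for all [t] at
    once. *)
Theorem proposition4p5 (R : realType) (d : nat) (T : R) (U : metricType R)
    (f : 'rV[R]_d * U -> 'rV[R]_d) (phi : observable R d)
    (T_gt0 : 0 < T)
    (U_compact : compact [set: U])
    (f_continuous : continuous f)
    (f_growth : exists2 m : R, 0 < m &
       forall x u, enorm (f (x, u)) <= m * (1 + enorm x))
    (f_lipschitz : forall K : set 'rV[R]_d, compact K ->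
       exists2 l : R, 0 < l &
         forall x y u, K x -> K y ->
           enorm (f (x, u) - f (y, u)) <= l * enorm (x - y))
    (f_C1 : forall u, C1 (fun x => f (x, u)))
    (phi_C1c : C1c phi)
    (psi : R -> R -> observable R d)
    (psi_koopman : forall tau t, tau \in `[0, T] -> t \in `[0, T] ->
       koopman T f tau t phi (psi tau t)) :
  (forall t, t \in `[0, T] ->
     (exists2 u, control T u & generated_by T f phi [set t] u psi) <->
     strong_solution T f phi [set t] psi) /\
  ((exists2 u, control T u & generated_by T f phi `[0, T]%classic u psi) ->
   strong_solution T f phi `[0, T]%classic psi).
Proof.
have [m m0 fg] := enorm_linear_growth f_growth.
have fl := enorm_locally_lipschitz f_lipschitz.
split=> [t t01|[u cu gen]]; last first.
  exact: (generated_strong_solution T_gt0 m0 f_continuous fg fl f_C1 phi_C1c _ cu gen).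
split=> [[u cu gen]|[C1c_psi ac_psi dpsi psi_t]].
  apply: (generated_strong_solution T_gt0 m0 f_continuous fg fl f_C1 phi_C1c _ cu gen).
  by move=> _ ->.
have hk tau (tT : tau \in `[0, T]) := psi_koopman tau t tT t01.
have pC1c tau (tT : tau \in `[0, T]) : C1c (psi tau t) := C1c_psi tau t tT erefl.
have pAC : abs_continuous T (psi^~ t) := ac_psi t erefl.
have pt : psi t t = phi := psi_t t erefl.
have [|u cu uD] := selected_control T_gt0 U_compact f_continuous phi_C1c t01 hk pAC pC1c.
  by apply: negligibleS dpsi => tau /= nH H; apply: nH => tT; exact: H.
exists u => //.
have [Phi fP] := flow_exists T_gt0 m0 f_continuous fg fl cu.
exists Phi => // tau _ tT ->; apply/funext => x /=.
(* The trajectory taken is the one through [Phi tau t x] at time [t]; it passes through [x] at time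
   [tau]. *)
rewrite -(observable_along_flow T_gt0 m0 fg fl phi_C1c t01 hk pAC pC1c fP uD _ pt tT).
by rewrite (flow_semigroup T_gt0 m0 fg fl x fP tT t01 tT) (flow_id T_gt0 m0 fg x fP tT).
Qed.
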